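(* Let $\sigma\ge1$ and $\mu\ge1/2$. A function $f\in C^\infty(\mathbb{T}^m\times\mathbb{R}^n)\cap L^1(\mathbb{T}^m\times\mathbb{R}^n)$ belongs to $\mathcal{S}_{\sigma,\mu}(\mathbb{T}^m\times\mathbb{R}^n)$ if and only if there exist $C_0,C_1>0$ such that, for all $\alpha,\beta\in\mathbb{N}_0^n$ and $\gamma\in\mathbb{N}_0^m$, $$\sup_{(t,\xi)\in\mathbb{T}^m\times\mathbb{R}^n}|\xi^\alpha\partial_\xi^\beta\partial_t^\gamma\widehat{f}(t,\xi)|\leq C_0C_1^{|\alpha+\beta|+|\gamma|}(\alpha!\beta!)^\mu\gamma!^\sigma.$$
   Context: $\mathbb{T}^m=(\mathbb{R}/2\pi\mathbb{Z})^m$. Here $\widehat f(t,\xi)=\int_{\mathbb{R}^n}f(t,x)e^{-i\xi\cdot x}\,dx$ is the partial Euclidean Fourier transform; the displayed inequality is understood to include the existence of the derivatives of $\widehat f$ involved, i.e. smoothness of $\widehat f$. For $C>0$, $\mathcal{S}_{\sigma,\mu,C}(\mathbb{T}^m\times\mathbb{R}^n)$ is the space of $\varphi\in C^\infty(\mathbb{T}^m\times\mathbb{R}^n)$ with $$\sup_{\alpha,\beta\in\mathbb{N}_0^n}\sup_{\gamma\in\mathbb{N}_0^m}C^{-|\alpha+\beta|-|\gamma|}\gamma!^{-\sigma}(\alpha!\beta!)^{-\mu}\sup_{(t,x)}|x^\alpha\partial_x^\beta\partial_t^\gamma\varphi(t,x)|<\infty,$$ and $\mathcal{S}_{\sigma,\mu}(\mathbb{T}^m\times\mathbb{R}^n)=\bigcup_{C>0}\mathcal{S}_{\sigma,\mu,C}(\mathbb{T}^m\times\mathbb{R}^n)$.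 *)

(* Defs.v *)
From HB Require Import structures.
From mathcomp Require Import all_boot all_order all_algebra.
From mathcomp Require Import complex.
From mathcomp Require Import all_classical all_reals all_analysis.

Set Implicit Arguments.
Unset Strict Implicit.
Unset Printing Implicit Defensive.
Import Order.TTheory GRing.Theory Num.Theory.
Import numFieldNormedType.Exports.

Local Open Scope classical_set_scope.
Local Open Scope ring_scope.

Fact rV_display : measure_display. Proof. exact: default_measure_display. Qed.

(* R^n carries the Borel sigma-algebra, presented as the one generated by the
   coordinate functions (as the library does for n.-tuple T). *)
Section measurable_rV.
Context (R : realType) (n : nat).

Let coord (i : 'I_n) (x : 'rV[R]_n) : measurableTypeR R := x ord0 i.

Let rV_set0 : g_sigma_preimage coord set0.
Proof. exact: sigma_algebra0. Qed.

Let rV_setC A : g_sigma_preimage coord A -> g_sigma_preimage coord (~` A).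
Proof. exact: sigma_algebraC. Qed.

Let rV_bigcup (F : (set 'rV[R]_n)^nat) :
  (forall i, g_sigma_preimage coord (F i)) ->
  g_sigma_preimage coord (\bigcup_i F i).
Proof. exact: sigma_algebra_bigcup. Qed.

HB.instance Definition _ := @isMeasurable.Build rV_display 'rV[R]_n
  (g_sigma_preimage coord) rV_set0 rV_setC rV_bigcup.

Lemma measurable_rV_coord (i : 'I_n) :
  measurable_fun [set: 'rV[R]_n] (fun x => x ord0 i : measurableTypeR R).
Proof.
move=> _ Y mY; rewrite setTI; apply: sub_sigma_algebra => /=.
rewrite -bigcup_seq/=; exists i => /=; first by rewrite mem_index_enum.
by exists Y => //; rewrite setTI.
Qed.

End measurable_rV.

Lemma measurable_fun_rVP (R : realType) d (T : measurableType d) n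
    (f : T -> 'rV[R]_n) :
  (forall i, measurable_fun [set: T] (fun x => f x ord0 i : measurableTypeR R)) ->
  measurable_fun [set: T] f.
Proof.
move=> mf; pose c (i : 'I_n) (x : 'rV[R]_n) : measurableTypeR R := x ord0 i.
move=> _ Y mY; rewrite setTI.
have : preimage_set_system setT f (g_sigma_preimage c) (f @^-1` Y).
  by exists Y => //; rewrite setTI.
rewrite -g_sigma_preimage_comp; apply: smallest_sub.
  exact: sigma_algebra_measurable.
rewrite -bigcup_seq/=; apply: bigcup_sub => i _ A [B mB <-].
exact: mf.
Qed.

Definition rV_cons (R : realType) n (p : measurableTypeR R * 'rV[R]_n) :
  'rV[R]_n.+1 := row_mx (p.1%:M : 'rV[R]_1) p.2.

Lemma rV_consl (R : realType) n (p : measurableTypeR R * 'rV[R]_n) :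
  rV_cons p ord0 ord0 = p.1.
Proof.
rewrite (_ : ord0 = lshift n (ord0 : 'I_1)); last exact/val_inj.
by apply: etrans (row_mxEl _ _ _ _) _; rewrite mxE eqxx.
Qed.

Lemma rV_consr (R : realType) n (p : measurableTypeR R * 'rV[R]_n) (j : 'I_n) :
  rV_cons p ord0 (lift ord0 j) = p.2 ord0 j.
Proof.
rewrite (_ : lift ord0 j = rshift 1 j); last exact/val_inj.
exact: row_mxEr.
Qed.

Lemma measurable_rV_cons (R : realType) n :
  measurable_fun [set: measurableTypeR R * 'rV[R]_n] (@rV_cons R n).
Proof.
apply: measurable_fun_rVP => i; case: (unliftP ord0 i) => [j|] ->.
- have -> : (fun p => rV_cons p ord0 (lift ord0 j)) =
      (fun p : measurableTypeR R * 'rV[R]_n => p.2 ord0 j).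
    by apply/funext => p; exact: rV_consr.
  apply: (@measurableT_comp _ _ _ _ _ _
    (fun y : 'rV[R]_n => y ord0 j : measurableTypeR R)) => //.
  exact: measurable_rV_coord.
- have -> : (fun p => rV_cons p ord0 ord0) =
      (@fst (measurableTypeR R) 'rV[R]_n).
    by apply/funext => p; exact: rV_consl.
  exact: measurable_fst.
Qed.

(* Lebesgue measure on R^n.+1 as the image of the product of the Lebesgue
   measures on R and R^n. The sigma-finiteness of a product is reproved here
   because the library's instance for sigma-finite measures is not inferred. *)
Section leb_step.
Local Open Scope ereal_scope.
Context (R : realType) (n : nat) (mu : {sigma_finite_measure set 'rV[R]_n -> \bar R}).

Definition leb_step : set 'rV[R]_n.+1 -> \bar R :=
  pushforward (@lebesgue_measure R \x mu) (@rV_cons R n).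



Let leb_step0 : leb_step set0 = 0.
Proof. by rewrite /leb_step /pushforward preimage_set0 measure0. Qed.

Let leb_step_ge0 A : 0 <= leb_step A.
Proof. by apply: measure_ge0 => //; exact: measurable_rV_cons. Qed.

Let leb_step_sigma_additive : semi_sigma_additive leb_step.
Proof.
by apply: measure_semi_sigma_additive => //; exact: measurable_rV_cons.
Qed.

HB.instance Definition _ := isMeasure.Build _ _ _ leb_step
  leb_step0 leb_step_ge0 leb_step_sigma_additive.

Let leb_step_sigma_finite : sigma_finite setT leb_step.
Proof.
have /sigma_finiteP[F [TF ndF Foo]] := sigma_finiteT (@lebesgue_measure R).
have /sigma_finiteP[G [TG ndG Goo]] := sigma_finiteT mu.
pose tl (v : 'rV[R]_n.+1) : 'rV[R]_n := \row_j v ord0 (lift ord0 j).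
pose S k := [set v : 'rV[R]_n.+1 | F k (v ord0 ord0)] `&` tl @^-1` G k.
have mtl : measurable_fun setT tl.
  apply: measurable_fun_rVP => j.
  rewrite (_ : (fun _ => _) = fun v : 'rV[R]_n.+1 => v ord0 (lift ord0 j)).
    exact: measurable_rV_coord.
  by apply/funext => v; rewrite mxE.
exists S => [|k].
  apply/esym/seteqP; split=> // v _.
  have [i _ Fi] : (\bigcup_k F k) (v ord0 ord0) by rewrite -TF.
  have [j _ Gj] : (\bigcup_k G k) (tl v) by rewrite -TG.
  exists (maxn i j) => //; split => /=.
  - by move: (v ord0 ord0) Fi; exact/subsetPset/ndF/leq_maxl.
  - by move: (tl v) Gj; exact/subsetPset/ndG/leq_maxr.
have [mF Flt] := Foo k; have [mG Glt] := Goo k; split.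
  apply: measurableI; rewrite -[X in measurable X]setTI.
  - exact: (@measurable_rV_coord R n.+1 ord0).
  - exact: mtl.
rewrite /leb_step /pushforward (_ : _ @^-1` _ = F k `*` G k).
  by rewrite product_measure1E// lte_mul_pinfty// ge0_fin_numE.
rewrite /S; apply/seteqP; split=> -[a v] /=.
  rewrite rV_consl (_ : tl _ = v)//.
  by apply/rowP => j; rewrite mxE rV_consr.
rewrite rV_consl (_ : tl _ = v)//.
by apply/rowP => j; rewrite mxE rV_consr.
Qed.

HB.instance Definition _ := Measure_isSigmaFinite.Build _ _ _ leb_step
  leb_step_sigma_finite.

End leb_step.

Fixpoint leb (R : realType) n : {sigma_finite_measure set 'rV[R]_n -> \bar R} :=
  match n with
  | 0 => \d_(0%R : 'rV[R]_0)
  | n'.+1 => leb_step (leb R n')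
  end.

(* This characterizes leb R n among the sigma-finite Borel measures. *)
Lemma leb_box (R : realType) n (A : 'I_n -> set (measurableTypeR R)) :
  (forall i, measurable (A i)) ->
  leb R n [set x | forall i, A i (x ord0 i)] =
    (\prod_(i < n) @lebesgue_measure R (A i))%E.
Proof.
elim: n A => [|n IHn] A mA.
  rewrite big_ord0 /= diracE mem_set//.
  by case.
rewrite big_ord_recl -IHn; last by move=> i; exact: mA.
rewrite /= /leb_step /pushforward.
rewrite [X in (_ \x _)%E X](_ : _ = A ord0 `*`
    [set x : 'rV[R]_n | forall i, A (lift ord0 i) (x ord0 i)]).
  rewrite product_measure1E//.
  rewrite (_ : [set x | _] = \big[setI/setT]_(i < n)
      ((fun x : 'rV[R]_n => x ord0 i) @^-1` A (lift ord0 i))).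
    apply: bigsetI_measurable => i _; rewrite -[X in measurable X]setTI.
    exact: measurable_rV_coord.
  apply/seteqP; split=> x /=; rewrite -bigcap_seq /=.
  - by move=> Ax i _; exact: Ax.
  - by move=> Ax i; apply: Ax => /=; rewrite mem_index_enum.
apply/seteqP; split=> -[a v] /= H.
- split; first by move: (H ord0); rewrite rV_consl.
  by move=> i; move: (H (lift ord0 i)); rewrite rV_consr.
- case: H => Ha Hv i; case: (unliftP ord0 i) => [j|] ->.
  + by rewrite rV_consr.
  + by rewrite rV_consl.
Qed.

(* The complex numbers as a normed space over the reals, so that the
   derivatives 'D_v f of complex-valued f are those of the library. *)
HB.instance Definition _ (R : rcfType) := isPointed.Build (Rcomplex R) 0.
HB.instance Definition _ (R : rcfType) :=
  PseudoMetric.copy (Rcomplex R) (pseudoMetric_normed (Rcomplex R)).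
HB.instance Definition _ (R : rcfType) :=
  NormedZmod_PseudoMetric_eq.Build R (Rcomplex R) erefl.

Lemma Rcomplex_normrZ (R : rcfType) (a : R) (z : Rcomplex R) :
  `|a *: z| = `|a| * `|z|.
Proof.
case: z => x y; rewrite -[LHS]/(Num.sqrt ((a * x) ^+ 2 + (a * y) ^+ 2)).
rewrite -[X in _ = _ * X]/(Num.sqrt (x ^+ 2 + y ^+ 2)).
by rewrite -sqrtr_sqr -sqrtrM ?sqr_ge0// mulrDr !exprMn.
Qed.

HB.instance Definition _ (R : rcfType) :=
  PseudoMetricNormedZmod_Lmodule_isNormedModule.Build R (Rcomplex R)
    (@Rcomplex_normrZ R).

Section torus_space.
Context (R : realType) (m n : nat).

(* Functions on T^m x R^n are encoded as functions on R^m x R^n which are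
   2 pi-periodic in each of the first m coordinates. *)
Local Notation V := ('rV[R]_m * 'rV[R]_n)%type.
Local Notation fct := (V -> Rcomplex R).

Definition dir (k : 'I_m + 'I_n) : V :=
  match k with
  | inl i => (delta_mx ord0 i, 0)
  | inr j => (0, delta_mx ord0 j)
  end.

Definition periodic_torus (f : fct) : Prop :=
  forall i : 'I_m, periodic f ((pi *+ 2) *: dir (inl i)).

Definition partial (k : 'I_m + 'I_n) (f : fct) : fct := 'D_(dir k) f.

(* All iterated partial derivatives exist and are continuous. *)
Definition smooth (f : fct) : Prop :=
  forall s : seq ('I_m + 'I_n),
    continuous (foldr partial f s) /\
    forall k p, derivable (foldr partial f s) p (dir k).

Definition Cinfty : set fct := [set f | periodic_torus f /\ smooth f].

(* A complex-valued function is integrable when its real and imaginary parts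
   are; integration over T^m is integration over a fundamental cell. *)
Definition torus_cell : set 'rV[R]_m :=
  [set t | forall i, 0 <= t ord0 i < pi *+ 2].

Definition L1 : set fct := [set f |
  (leb R m \x leb R n)%E.-integrable (torus_cell `*` setT)
    (fun p => (complex.Re (f p))%:E) /\
  (leb R m \x leb R n)%E.-integrable (torus_cell `*` setT)
    (fun p => (complex.Im (f p))%:E)].

Definition Cintegral (g : 'rV[R]_n -> R[i]) : R[i] :=
  Complex (\int[leb R n]_x complex.Re (g x)) (\int[leb R n]_x complex.Im (g x)).

Definition dotp (xi x : 'rV[R]_n) : R := \sum_(j < n) xi ord0 j * x ord0 j.

Definition expi (theta : R) : R[i] := Complex (cos theta) (sin theta).

(* Rintegral is total: where f (t, .) is not integrable (a null set of t when
   L1 f holds) the value below carries no meaning. *)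
Definition fourier_x (f : fct) : fct :=
  fun p => Cintegral (fun x => (f (p.1, x) : R[i]) * expi (- dotp p.2 x)).

Definition mdeg d (a : {ffun 'I_d -> nat}) : nat := (\sum_(i < d) a i)%N.

Definition mfact d (a : {ffun 'I_d -> nat}) : nat := (\prod_(i < d) (a i)`!)%N.

Definition monom (a : {ffun 'I_n -> nat}) (x : 'rV[R]_n) : R :=
  \prod_(j < n) x ord0 j ^+ a j.

Definition partial_t (c : {ffun 'I_m -> nat}) (f : fct) : fct :=
  foldr (fun i => iter (c i) (partial (inl i))) f (enum 'I_m).

Definition partial_x (b : {ffun 'I_n -> nat}) (f : fct) : fct :=
  foldr (fun j => iter (b j) (partial (inr j))) f (enum 'I_n).

(* sup_(t, x) |x^a d_x^b d_t^c f(t, x)| *)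
Definition sup_mon_partial (a b : {ffun 'I_n -> nat}) (c : {ffun 'I_m -> nat})
    (f : fct) : \bar R :=
  ereal_sup [set `|monom a p.2 *: partial_x b (partial_t c f) p|%:E | p in setT].

(* The index ab is the pair (alpha, beta), and c is gamma. *)
Definition GSnorm (sigma mu C : R) (f : fct) : \bar R :=
  ereal_sup [set ereal_sup
    [set ((C ^- (mdeg (ab.1 + ab.2) + mdeg c)
           * (mfact c)%:R `^ (- sigma)
           * (mfact ab.1 * mfact ab.2)%:R `^ (- mu))%:E
          * sup_mon_partial ab.1 ab.2 c f)%E
    | c in [set: {ffun 'I_m -> nat}]]
  | ab in [set: {ffun 'I_n -> nat} * {ffun 'I_n -> nat}]].

Definition GSC (sigma mu C : R) : set fct :=
  [set f | Cinfty f /\ (GSnorm sigma mu C f < +oo)%E].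

Definition GS (sigma mu : R) : set fct :=
  \bigcup_(C in [set C | 0 < C]) GSC sigma mu C.

End torus_space.

(* Main.v *)
Require Import Defs.
From HB Require Import structures.
From mathcomp Require Import all_boot all_order all_algebra.
From mathcomp Require Import complex.
From mathcomp Require Import all_classical all_reals all_analysis.
From mathcomp Require Import measurable_realfun ring lra.

(** Let K_th u (t, xi) be the integral over x of u (t, x) cos (xi . x + th). With
    f = u + i v, the real and imaginary parts of the Fourier transform of f are
    K_0 u + K_(- pi / 2) v and K_0 v + K_(pi / 2) u, so it is enough to
    understand the real operators K_th. Two identities govern them
    ([is_derive_cosint_x] and [cosint_parts]): the derivative of K_th u in xi_j
    is K_(th + pi / 2) (x_j u), and xi_j K_th u is K_(th + pi / 2) applied to
    the derivative of u in x_j. Both advance the phase by the same quarter turn,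
    so a word of derivatives and multiplications acts on K_th u as the dual word
    acts on u, up to a phase that no estimate sees.

    The bounds are symmetric under this duality once they are written suitably.
    Since alpha! beta! <= (alpha + beta)! <= 2 ^ |alpha + beta| alpha! beta!, the
    factor (alpha! beta!) ^ mu may be replaced by (alpha + beta)! ^ mu, which
    depends only on how often each index j occurs in the word, as a derivative
    or as a multiplication ([wt]).

    The operators K_th preserve the estimates ([gs_cosint]). An integral is
    bounded by a constant times the supremum of its integrand multiplied by the
    product of the 1 + x_j^2, which adds at most 2 n letters to the dual word.
    The dual word has derivatives to the left of multiplications and has to be
    reordered ([commute_bound]). Each commutation of x_j with derivatives in x_j
    gives a factor at most the number c of these, and removes two letters j,
    that is, a factor at least c ^ (2 mu) of the weight. As mu >= 1 / 2, this
    compensates ([wt_double]). The number of terms is geometric in the length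
    of the word. This proves the estimate for the Fourier transform from that
    for f.

    For the converse, f (t, .) is integrable for almost every t. For such t, the
    inversion formula writes f (t, .) as a combination of cosine transforms of
    the real and imaginary parts of its Fourier transform. It is proved by
    pairing both sides with all Gaussians ([cosint_inversion]), because a
    continuous integrable function orthogonal to them vanishes
    ([gauss_orthogonal_eq0]). Both sides are continuous and periodic in t, so
    the formula extends to all t ([torus_inversion]). Then [gs_cosint], applied
    to the Fourier transform, gives the estimate for f. *)

Set Implicit Arguments.
Unset Strict Implicit.
Unset Printing Implicit Defensive.
Import Order.TTheory GRing.Theory Num.Theory.
Import numFieldNormedType.Exports.

Local Open Scope classical_set_scope.
Local Open Scope ring_scope.

(** * Integration over R^n by iterated integrals *)

(** Boxes with rational centres and radii 1 / (k + 1) form a countable base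
    of the topology, and they are intersections of preimages under the
    coordinates, which generate the sigma-algebra. *)
Lemma open_measurable_rV (R : realType) n (O : set 'rV[R]_n) :
  open O -> measurable O.
Proof.
move=> oO.
pose box (qk : 'rV[rat]_n * nat) : set 'rV[R]_n :=
  [set y | forall j, `|y ord0 j - ratr (qk.1 ord0 j)| < qk.2.+1%:R^-1].
have mbox qk : measurable (box qk).
  rewrite (_ : box qk = \big[setI/setT]_(j < n)
      ((fun y : 'rV[R]_n => y ord0 j) @^-1`
        ball (ratr (qk.1 ord0 j) : R) qk.2.+1%:R^-1)).
    apply: bigsetI_measurable => j _; rewrite -[X in measurable X]setTI.
    apply: measurable_rV_coord => //; apply: open_measurable.
    exact: ball_open.
  apply/seteqP; split=> y /=; rewrite -bigcap_seq /=.
  - by move=> yb j _ /=; rewrite /ball /= distrC.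
  - move=> yb j; move: (yb j); rewrite /ball /= distrC; apply.
    by rewrite mem_index_enum.
have -> : O = \bigcup_(qk in [set: 'rV[rat]_n * nat])
    (if `[< box qk `<=` O >] then box qk else set0).
  apply/seteqP; split => [x Ox|x [qk _]]; last first.
    by case: ifPn => // /asboolP h /h.
  have /nbhs_ballP[e /= e0 xeO] : nbhs x O by exact: open_nbhs_nbhs.
  have [k ke] : exists k : nat, k.+1%:R^-1 < e / 2.
    have e20 : 0 < e / 2 by rewrite divr_gt0.
    have /cvgrPdist_lt/(_ _ e20)[k _ /(_ k (leqnn k))/=] :=
      @cvg_harmonic R.
    by rewrite sub0r normrN ger0_norm// => h; exists k.
  have H j : exists q : rat, `|x ord0 j - ratr q| < k.+1%:R^-1.
    have [|q] := @rat_in_itvoo _ (x ord0 j - k.+1%:R^-1) (x ord0 j).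
      by rewrite ltrBlDr ltrDl invr_gt0.
    rewrite in_itv /= => /andP[q1 q2]; exists q.
    by rewrite gtr0_norm ?subr_gt0// ltrBlDr -ltrBlDl.
  exists (\row_j projT1 (cid (H j)), k) => //.
  case: ifPn => [_|/asboolP]; first by move=> j; rewrite /= mxE; case: cid.
  case=> y yb; apply: xeO; split=> // i j; rewrite (ord1 i).
  have := yb j; rewrite /= mxE; case: cid => q /= xq yq; rewrite /ball /=.
  rewrite (le_lt_trans (ler_distD (ratr q) _ _))// (splitr e).
  by rewrite ltrD// (lt_trans _ ke)// distrC.
apply: countable_bigcupT_measurable; first exact: countableP.
by move=> qk; case: ifP.
Qed.

Lemma continuous_measurable_rV (R : realType) n (g : 'rV[R]_n -> R) :
  continuous g -> measurable_fun [set: 'rV[R]_n] g.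
Proof.
move=> /continuousP cg; apply: (measurability _ (RGenOpens.measurableE R)).
move=> _ [_ [a [b ->] <-]]; rewrite setTI.
by apply: open_measurable_rV; exact/cg/interval_open.
Qed.

Section iterated_integral.
Context (R : realType) (n : nat).
Notation mu := (@lebesgue_measure R).
Local Open Scope ereal_scope.

Lemma integral_lebS (F : 'rV[R]_n.+1 -> \bar R) :
  \int[leb R n.+1]_x F x =
  \int[pushforward (mu \x leb R n) (@rV_cons R n)]_x F x.
Proof. by apply: eq_measure_integral => //; exact: measurable_rV_cons. Qed.

Lemma ge0_integral_lebS (F : 'rV[R]_n.+1 -> \bar R) :
  measurable_fun setT F -> (forall x, 0 <= F x) ->
  \int[leb R n.+1]_x F x =
  \int[mu]_a \int[leb R n]_v F (rV_cons (a, v)).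
Proof.
move=> mF F0; rewrite integral_lebS.
rewrite (@ge0_integral_pushforward _ _ _ _ _ _ (@measurable_rV_cons R n))//.
rewrite preimage_setT (fubini_tonelli1 (F \o @rV_cons R n))//=.
by apply: measurableT_comp => //; exact: measurable_rV_cons.
Qed.

Lemma integrable_lebS (F : 'rV[R]_n.+1 -> \bar R) :
  (leb R n.+1).-integrable setT F ->
  (mu \x leb R n).-integrable setT (F \o @rV_cons R n).
Proof.
move=> /integrableP[mF iF]; apply/integrableP; split.
  by apply: measurableT_comp => //; exact: measurable_rV_cons.
rewrite (le_lt_trans _ iF)// integral_lebS.
rewrite (@ge0_integral_pushforward _ _ _ _ _ _ (@measurable_rV_cons R n))//.
exact: measurableT_comp.
Qed.

Lemma integral_lebS12 (F : 'rV[R]_n.+1 -> \bar R) :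
  (leb R n.+1).-integrable setT F ->
  \int[leb R n.+1]_x F x = \int[mu]_a \int[leb R n]_v F (rV_cons (a, v)).
Proof.
move=> iF; have jF := integrable_lebS iF.
rewrite integral_lebS (@integral_pushforward _ _ _ _ _ _ (@measurable_rV_cons R n))//.
- by rewrite preimage_setT -integral12_prod_meas1.
- exact: measurable_int iF.
Qed.

Lemma integral_lebS21 (F : 'rV[R]_n.+1 -> \bar R) :
  (leb R n.+1).-integrable setT F ->
  \int[leb R n.+1]_x F x = \int[leb R n]_v \int[mu]_a F (rV_cons (a, v)).
Proof.
by move=> iF; rewrite integral_lebS12//; exact: (Fubini (integrable_lebS iF)).
Qed.

End iterated_integral.

Lemma integral_leb0 (R : realType) (F : 'rV[R]_0 -> \bar R) :
  measurable_fun setT F -> (\int[leb R 0]_x F x = F 0%R)%E.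
Proof.
move=> mF; rewrite -[LHS]/(\int[\d_(0%R : 'rV[R]_0)]_x F x)%E.
by rewrite integral_dirac// diracT mul1e.
Qed.

(** The integrable majorant used throughout. It is a product over the
    coordinates, and not a power of 1 + |x|^2, so that Fubini reduces the
    integrals of functions below it to dimension one. *)
Definition decay (R : realType) n (x : 'rV[R]_n) : R :=
  \prod_(j < n) (1 + x ord0 j ^+ 2)^-1.

Section decay.
Context (R : realType).
Notation mu := (@lebesgue_measure R).

Lemma onesqr_gt0 (a : R) : 0 < 1 + a ^+ 2.
Proof. by rewrite ltr_wpDr// sqr_ge0. Qed.

Lemma decay_gt0 n (x : 'rV[R]_n) : 0 < decay x.
Proof. by apply: prodr_gt0 => j _; rewrite invr_gt0 onesqr_gt0. Qed.

Lemma continuous_coord n (j : 'I_n) : continuous (fun x : 'rV[R]_n => x ord0 j).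
Proof. exact: coord_continuous. Qed.

Lemma continuous_decay n : continuous (@decay R n).
Proof.
apply: continuous_big => [p|j _ x]; first exact: mul_continuous.
apply: (@continuous_comp _ _ _ (fun x : 'rV[R]_n => x ord0 j)
  (fun z : R => (1 + z ^+ 2)^-1)); first exact: continuous_coord.
exact: continuous_oneDsqrV.
Qed.

Lemma measurable_decay n :
  measurable_fun [set: 'rV[R]_n] (EFin \o @decay R n).
Proof.
apply/measurable_EFinP.
exact: (continuous_measurable_rV (@continuous_decay n)).
Qed.

Lemma decay_cons n (a : R) (v : 'rV[R]_n) :
  decay (rV_cons (a, v)) = (1 + a ^+ 2)^-1 * decay v.
Proof.
rewrite /decay big_ord_recl rV_consl; congr (_ * _).
by apply: eq_bigr => j _; rewrite rV_consr.
Qed.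

Lemma integral_onesqrV : (\int[mu]_a (1 + a ^+ 2)^-1%:E = pi%:E)%E.
Proof.
rewrite ge0_symfun_integralT.
- rewrite (_ : [set x : R | 0 <= x] = `[0, +oo[%classic); last first.
    by apply/seteqP; split=> x /=; rewrite in_itv/= andbT.
  have := @integral0y_oneDsqr R; rewrite /oneDsqr => ->.
  by rewrite -EFinM mulrC divfK.
- by move=> a; rewrite invr_ge0 ltW// onesqr_gt0.
- exact: continuous_oneDsqrV.
- by move=> a /=; rewrite sqrrN.
Qed.

Lemma integrable_decay n : (leb R n).-integrable setT (EFin \o @decay R n).
Proof.
apply/integrableP; split.
  exact: measurable_decay.
rewrite (eq_integral (EFin \o @decay R n)); last first.
  by move=> x _ /=; rewrite ger0_norm// ltW// decay_gt0.
elim: n => [|n IH].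
  rewrite integral_leb0; first by rewrite ltry.
  exact: measurable_decay.
rewrite ge0_integral_lebS; last 2 first.
- exact: measurable_decay.
- by move=> x; rewrite lee_fin ltW// decay_gt0.
have mD : measurable_fun setT (EFin \o @decay R n).
  exact: measurable_decay.
have D0 x : [set: 'rV[R]_n] x -> (0 <= (EFin \o @decay R n) x)%E.
  by move=> _; rewrite lee_fin ltW// decay_gt0.
have fin : (\int[leb R n]_x (EFin \o @decay R n) x)%E \is a fin_num.
  by rewrite ge0_fin_numE// integral_ge0.
under eq_integral => a _.
  under eq_integral => v _ do rewrite /= decay_cons EFinM.
  rewrite (@ge0_integralZl _ _ _ _ _ measurableT (EFin \o @decay R n))//;
    last by rewrite lee_fin invr_ge0 ltW// onesqr_gt0.
  over.
rewrite /= -(fineK fin) ge0_integralZr//.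
- by rewrite integral_onesqrV -EFinM ltry.
- apply/measurable_EFinP; apply: continuous_measurable_fun.
  exact: continuous_oneDsqrV.
- by move=> a _; rewrite lee_fin invr_ge0 ltW// onesqr_gt0.
- by rewrite fineK// integral_ge0.
Qed.

End decay.

(** * Derivatives of decaying functions integrate to zero *)

(** A directional derivative depends only on the restriction to a line, so it
    can be computed through any map that sends that line to a line. This
    carries derivatives through [rV_cons], through sections and through
    translations. *)
Lemma derive_along (R : realType) (U V : normedModType R) (phi : U -> V)
    (F : V -> R) (p e : U) (e' : V) :
  (forall h : R, phi (h *: e + p) = h *: e' + phi p) ->
  'D_e (F \o phi) p = 'D_e' F (phi p) /\
  (derivable (F \o phi) p e <-> derivable F (phi p) e').
Proof.
move=> H; rewrite /derive /derivable.
have -> : (fun h : R => h^-1 *: (((F \o phi) \o shift p) (h *: e) - (F \o phi) p)) =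
          (fun h : R => h^-1 *: ((F \o shift (phi p)) (h *: e') - F (phi p))).
  by apply/funext => h /=; rewrite H.
by [].
Qed.

Lemma rV_cons_line0 (R : realType) n (a h : R) (v : 'rV[R]_n) :
  rV_cons (h *: 1 + a, v) = h *: delta_mx ord0 ord0 + rV_cons (a, v).
Proof.
apply/rowP => i; rewrite [RHS]mxE [X in _ = X + _]mxE [delta_mx _ _ _ _]mxE.
case: (unliftP ord0 i) => [j|] ->.
  by rewrite !rV_consr /= mulr0 add0r.
by rewrite !rV_consl /=.
Qed.

Lemma rV_cons_lineS (R : realType) n (a h : R) (v : 'rV[R]_n) (j : 'I_n) :
  rV_cons (a, h *: delta_mx ord0 j + v) =
  h *: delta_mx ord0 (lift ord0 j) + rV_cons (a, v).
Proof.
apply/rowP => i; rewrite [RHS]mxE [X in _ = X + _]mxE [delta_mx _ _ _ _]mxE.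
case: (unliftP ord0 i) => [k|] ->.
  by rewrite !rV_consr !mxE !eqxx !andTb.
by rewrite !rV_consl /= mulr0 add0r.
Qed.

Lemma continuous_rV_cons_r (R : realType) n (a : R) :
  continuous (fun v : 'rV[R]_n => rV_cons (a, v)).
Proof.
move=> v A /nbhs_ballP[e /= e0 eA]; apply/nbhs_ballP; exists e => // w vw.
apply: eA.
split=> // i0 i; rewrite (ord1 i0).
case: (unliftP ord0 i) => [j|] ->; last by rewrite !rV_consl; exact: ballxx.
rewrite !rV_consr /=.
by case: vw.
Qed.

Lemma continuous_rV_cons_l (R : realType) n (v : 'rV[R]_n) :
  continuous (fun a : R => rV_cons (a, v)).
Proof.
move=> a A /nbhs_ballP[e /= e0 eA]; apply/nbhs_ballP; exists e => // b ab.
apply: eA.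
split=> // i0 i; rewrite (ord1 i0).
case: (unliftP ord0 i) => [j|] ->; first by rewrite !rV_consr; exact: ballxx.
by rewrite !rV_consl /=.
Qed.

Section domination.
Context (R : realType).

Lemma dominated_integrable_rV n (F : 'rV[R]_n -> R) (M : R) :
  measurable_fun setT F -> (forall x, `|F x| <= M * decay x) ->
  (leb R n).-integrable setT (EFin \o F).
Proof.
move=> mF FM.
have iM : (leb R n).-integrable setT (EFin \o (fun x => M * decay x)).
  rewrite (_ : EFin \o _ = (fun x => M%:E * (EFin \o @decay R n) x)%E)//.
  by apply: integrableZl => //; exact: integrable_decay.
apply: (le_integrable _ _ _ iM) => //; first exact/measurable_EFinP.
by move=> x _; rewrite /= lee_fin (le_trans (FM x))// ler_norm.
Qed.

Definition decay_mass n : R := \int[leb R n]_x decay x.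

Lemma le_Rintegral_decay n (F : 'rV[R]_n -> R) (M : R) :
  measurable_fun setT F -> (forall x, `|F x| <= M * decay x) ->
  `|\int[leb R n]_x F x| <= M * decay_mass n.
Proof.
move=> mF FM; have iF := dominated_integrable_rV mF FM.
apply: (le_trans (le_normr_Rintegral measurableT iF)).
rewrite /decay_mass -RintegralZl//; last exact: integrable_decay.
apply: le_Rintegral => //.
- by apply: (integrable_norm iF).
- apply: (@dominated_integrable_rV _ _ `|M|).
    apply: measurable_funM => //; apply/measurable_EFinP; exact: measurable_decay.
  by move=> x; rewrite normrM ler_wpM2l// ger0_norm// ltW// decay_gt0.
Qed.

Lemma decay_mass_ge0 n : 0 <= decay_mass n.
Proof. by apply: Rintegral_ge0 => x _; rewrite ltW// decay_gt0. Qed.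

End domination.

Section integral_of_derivative.
Context (R : realType).
Notation mu := (@lebesgue_measure R).

(** The fundamental theorem of calculus on [-k, k], where the boundary values
    tend to zero with k and dominated convergence gives the whole line. *)
Lemma integral_derive1_eq0 (F f : R -> R) (M : R) :
  (forall x, derivable F x 1) -> (forall x, 'D_1 F x = f x) -> continuous f ->
  (forall x, `|F x| <= M * (1 + x ^+ 2)^-1) ->
  (forall x, `|f x| <= M * (1 + x ^+ 2)^-1) ->
  (\int[mu]_x (f x)%:E = 0)%E.
Proof.
move=> dF Ff cf FM fM.
have M0 : 0 <= M.
  by have := le_trans (normr_ge0 _) (FM 0); rewrite expr0n addr0 invr1 mulr1.
pose I (k : nat) : set R := `[- k.+1%:R, k.+1%:R]%classic.
pose f_ (k : nat) : R -> R := f \_ (I k).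
have mf : measurable_fun setT f by exact: continuous_measurable_fun.
have ig : mu.-integrable setT (EFin \o (fun x : R => M * (1 + x ^+ 2)^-1)).
  rewrite (_ : EFin \o _ = (fun x : R => M%:E * ((1 + x ^+ 2)^-1)%:E)%E)//.
  apply: integrableZl => //; apply/integrableP; split.
    apply/measurable_EFinP; apply: continuous_measurable_fun.
    exact: continuous_oneDsqrV.
  under eq_integral => x _.
    rewrite gee0_abs ?lee_fin ?invr_ge0 ?(ltW (onesqr_gt0 x))//.
    over.
  by rewrite integral_onesqrV ltry.
have [] := @dominated_convergence _ _ _ mu setT measurableT
    (fun k => EFin \o f_ k) (EFin \o f)
    (EFin \o (fun x : R => M * (1 + x ^+ 2)^-1)) _ _ _ ig _.
- move=> k; apply/measurable_EFinP/(measurable_restrictT _ _).1 => //.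
    exact: measurable_itv.
  exact: measurable_funTS.
- exact/measurable_EFinP.
- apply: aeW => x _; apply: cvg_near_cst.
  near=> k; rewrite /= /f_ patchE mem_set//.
  rewrite /I /= in_itv/= -ler_norml.
  have : `|x| <= k%:R by near: k; exact: nbhs_infty_ger.
  by move/le_trans; apply; rewrite ler_nat.
- apply: aeW => x k _; rewrite /= /f_ patchE; case: ifPn => _ /=.
    by rewrite lee_fin.
  by rewrite normr0 lee_fin mulr_ge0// invr_ge0 ltW// onesqr_gt0.
move=> _ _ cvg.
suff cvg0 : (fun k => \int[mu]_x (f_ k x)%:E)%E @ \oo --> 0%E.
  exact: (cvg_unique _ cvg cvg0).
have E k : (\int[mu]_x (f_ k x)%:E =
    (F k.+1%:R - F (- k.+1%:R))%:E)%E.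
  rewrite (_ : (fun x => (f_ k x)%:E) = ((EFin \o f) \_ (I k))); last first.
    by rewrite restrict_EFin.
  rewrite -integral_mkcond /I.
  rewrite (@continuous_FTC2 _ _ F).
  - by rewrite EFinB.
  - by rewrite (@lt_trans _ _ 0)// oppr_lt0.
  - exact: continuous_subspaceT.
  - split.
    + by move=> x _; exact: dF.
    + apply: cvg_at_right_filter.
      exact/differentiable_continuous/derivable1_diffP.
    + apply: cvg_at_left_filter.
      exact/differentiable_continuous/derivable1_diffP.
  - by move=> x _; rewrite derive1E.
rewrite (_ : (fun k => _)%E = EFin \o (fun k => F k.+1%:R - F (- k.+1%:R))); last first.
  by apply/funext => k /=; rewrite E.
apply/fine_cvgP; split; first by apply: nearW.
apply/cvgr0Pnorm_le => e e0.
near=> k; rewrite /=.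
have -> : e = e / 2 + e / 2 by rewrite -splitr.
have K (x : R) : x ^+ 2 = k.+1%:R ^+ 2 -> `|F x| <= e / 2.
  move=> xk; rewrite (le_trans (FM _))// xk ler_pdivrMr ?onesqr_gt0//.
  rewrite mulrC -ler_pdivrMr ?divr_gt0//.
  have h : M / (e / 2) <= k%:R by near: k; exact: nbhs_infty_ger.
  rewrite (le_trans h)// -natrX -(natrD _ 1) ler_nat.
  by rewrite expnS expn1 add1n leqW// (leq_trans (leqnSn k))// leq_pmulr.
rewrite (le_trans (ler_normB _ _))// lerD// K// ?sqrrN//.
Unshelve. all: by end_near. Qed.

(** There are no boundary terms in an integration by parts against decaying
    functions. Fubini peels off one coordinate at a time until the direction
    of differentiation is the first one, which is then integrated first. *)
Lemma integral_partial_eq0 n (j : 'I_n) (F : 'rV[R]_n -> R) (M : R) :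
  (forall x, derivable F x (delta_mx ord0 j)) ->
  continuous F -> continuous ('D_(delta_mx ord0 j) F) ->
  (forall x, `|F x| <= M * decay x) ->
  (forall x, `|'D_(delta_mx ord0 j) F x| <= M * decay x) ->
  (\int[leb R n]_x ('D_(delta_mx ord0 j) F x)%:E = 0)%E.
Proof.
elim: n j F M => [[]//|n IH] j F M dF cF cdF FM dFM.
have idF : (leb R n.+1).-integrable setT (EFin \o 'D_(delta_mx ord0 j) F).
  exact: dominated_integrable_rV (continuous_measurable_rV cdF) dFM.
case: (unliftP ord0 j) => [i|] jE; subst j.
  rewrite (integral_lebS12 idF)/= integral0_eq// => a _.
  pose G := F \o (fun v : 'rV[R]_n => rV_cons (a, v)).
  have H v := @derive_along R _ _ (fun v : 'rV[R]_n => rV_cons (a, v)) F v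
    (delta_mx ord0 i) _ (fun h => rV_cons_lineS a h v i).
  rewrite (eq_integral (fun v => ('D_(delta_mx ord0 i) G v)%:E)); last first.
    by move=> v _; rewrite (H v).1.
  have dG : 'D_(delta_mx ord0 i) G =
      'D_(delta_mx ord0 (lift ord0 i)) F \o (fun v : 'rV[R]_n => rV_cons (a, v)).
    by apply/funext => v; rewrite (H v).1.
  have B v : M * decay (rV_cons (a, v)) = (M * (1 + a ^+ 2)^-1) * decay v.
    by rewrite decay_cons mulrA.
  apply: (IH i G (M * (1 + a ^+ 2)^-1)).
  - by move=> v; apply/(H v).2; exact: dF.
  - by move=> v; apply: continuous_comp; [exact: continuous_rV_cons_r|exact: cF].
  - move=> v; rewrite dG.
    by apply: continuous_comp; [exact: continuous_rV_cons_r|exact: cdF].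
  - by move=> v; rewrite -B; exact: FM.
  - by move=> v; rewrite (H v).1 -B; exact: dFM.
rewrite (integral_lebS21 idF)/= integral0_eq// => v _.
have H a := @derive_along R R^o _ (fun a : R => rV_cons (a, v)) F a
  1 _ (fun h => rV_cons_line0 a h v).
pose G := F \o (fun a : R => rV_cons (a, v)).
have B a : M * decay (rV_cons (a, v)) = (M * decay v) * (1 + a ^+ 2)^-1.
  by rewrite decay_cons mulrCA [RHS]mulrC.
apply: (@integral_derive1_eq0 G _ (M * decay v)).
- by move=> a; apply/(H a).2; exact: dF.
- by move=> a; exact: (H a).1.
- move=> a.
  apply: (@continuous_comp _ _ _ (fun a : R => rV_cons (a, v))
    ('D_(delta_mx ord0 ord0) F)).
    exact: continuous_rV_cons_l.
  exact: cdF.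
- by move=> a; rewrite -B; exact: FM.
- by move=> a; rewrite -B; exact: dFM.
Qed.

End integral_of_derivative.

(** * Symmetry of mixed derivatives *)

Section clairaut.
Context (R : realType) (V : normedModType R).
Implicit Types (f : V -> R) (p e : V).

Lemma derive_line f p e (s : R) :
  'D_1 (fun s : R => f (s *: e + p)) s = 'D_e f (s *: e + p) /\
  (derivable (fun s : R => f (s *: e + p)) s 1 <->
   derivable f (s *: e + p) e).
Proof.
apply: (@derive_along R R^o V (fun s : R => s *: e + p) f s 1 e) => h.
by rewrite [X in X *: e + p](_ : _ = h + s) ?scalerDl ?addrA// [h *: _]mulr1.
Qed.

Lemma MVT_line f p e (h : R) : (forall q, derivable f q e) -> 0 < h ->
  exists2 c, 0 <= c <= h & f (h *: e + p) - f p = h * 'D_e f (c *: e + p).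
Proof.
move=> df h0; pose g (s : R) := f (s *: e + p).
have dg s : derivable g s 1 by apply/(derive_line f p e s).2.
have [||c] := @MVT_segment R g (fun s => 'D_1 g s) 0 h (ltW h0).
- by move=> x _; exact: derivableP.
- apply: continuous_subspaceT => x.
  exact/differentiable_continuous/derivable1_diffP.
rewrite in_itv /= => ch; rewrite (derive_line f p e c).1 /g scale0r add0r subr0.
by move=> E; exists c; rewrite // E mulrC.
Qed.

Lemma derive_translate f e w p :
  'D_e (fun q => f (q + w)) p = 'D_e f (p + w) /\
  (derivable (fun q => f (q + w)) p e <-> derivable f (p + w) e).
Proof.
by apply: (@derive_along R V V (fun q => q + w) f p e e) => h; rewrite addrA.
Qed.

(** The mean value theorem along [e] for the increment of [f] in the direction
    [e'], then along [e'] for the derivative of [f]. *)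
Lemma second_difference f e e' p (h : R) :
  (forall q, derivable f q e) -> (forall q, derivable ('D_e f) q e') -> 0 < h ->
  exists c c', [/\ 0 <= c <= h, 0 <= c' <= h &
   f (h *: e + p + h *: e') - f (h *: e + p) - (f (p + h *: e') - f p) =
   h ^+ 2 * 'D_e' ('D_e f) (c' *: e' + (c *: e + p))].
Proof.
move=> df ddf h0; pose g q := f (q + h *: e') - f q.
have dt q : derivable (fun q => f (q + h *: e')) q e.
  by apply/(derive_translate f e (h *: e') q).2.
have dg q : derivable g q e by apply: derivableB.
have [c ch E] := MVT_line p dg h0.
have [c' ch' E'] := MVT_line (c *: e + p) ddf h0.
exists c, c'; split => //; rewrite expr2 -mulrA -E'.
rewrite -[LHS]/(g (h *: e + p) - g p) {}E; congr (_ * _).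
by rewrite /g deriveB// (derive_translate f e _ _).1 [h *: e' + _]addrC.
Qed.

Lemma two_sided_close (x y z z' eps : R) :
  `|x - z| < eps / 2 -> `|y - z'| < eps / 2 -> z = z' -> `|x - y| <= eps.
Proof.
move=> xz yz zz; rewrite (splitr eps) (le_trans (ler_distD z _ _))//.
by rewrite lerD ?ltW// distrC zz.
Qed.

(** Both mixed derivatives are limits of one second difference, which is
    symmetric in the two directions. *)
Lemma derive_comm f e e' :
  (forall q, derivable f q e) -> (forall q, derivable f q e') ->
  (forall q, derivable ('D_e f) q e') -> (forall q, derivable ('D_e' f) q e) ->
  continuous ('D_e' ('D_e f)) -> continuous ('D_e ('D_e' f)) ->
  'D_e' ('D_e f) = 'D_e ('D_e' f).
Proof.
move=> df df' ddf ddf' cA cB; apply/funext => p.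
apply/eqP; rewrite -subr_eq0 -normr_le0; apply/ler_addgt0Pl => eps eps0.
rewrite addr0; have e20 : 0 < eps / 2 by rewrite divr_gt0.
have /cvgrPdist_lt/(_ _ e20)/nbhs_ballP[a /= a0 aA] := cA p.
have /cvgrPdist_lt/(_ _ e20)/nbhs_ballP[b /= b0 bB] := cB p.
(* The points of the second difference are within h (|e| + |e'|) of p; the
   summand 1 keeps the quotient meaningful when e and e' vanish. *)
pose h := Num.min a b / 2 / (`|e| + `|e'| + 1).
have N0 : 0 < `|e| + `|e'| + 1 by rewrite ltr_wpDl// addr_ge0.
have m0 : 0 < Num.min a b by rewrite lt_min a0.
have h0 : 0 < h by rewrite !divr_gt0.
have near_p c c' d d' : `|d| + `|d'| = `|e| + `|e'| -> 0 <= c <= h -> 0 <= c' <= h ->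
    ball p (Num.min a b) (c' *: d' + (c *: d + p)).
  move=> dE /andP[c0 ch] /andP[c'0 c'h]; rewrite -ball_normE /ball_ /=.
  rewrite addrA opprD addrCA subrr addr0 normrN.
  rewrite (le_lt_trans (ler_normD _ _))// !normrZ !ger0_norm//.
  apply: (@le_lt_trans _ _ (h * (`|e| + `|e'|))).
    by rewrite -dE addrC mulrDr lerD// ler_wpM2r.
  apply: (@le_lt_trans _ _ (h * (`|e| + `|e'| + 1))).
    by rewrite ler_wpM2l ?ltW// ltrDl.
  by rewrite /h divfK ?gt_eqF// ltr_pdivrMr// ltr_pMr// ltr1n.
have [c [c' [hc hc' E]]] := second_difference p df ddf h0.
have [d [d' [hd hd' E']]] := second_difference p df' ddf' h0.
have {E E'} E : 'D_e' ('D_e f) (c' *: e' + (c *: e + p)) =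
    'D_e ('D_e' f) (d' *: e + (d *: e' + p)).
  apply: (@mulfI _ (h ^+ 2)); first by rewrite expf_neq0// gt_eqF.
  apply: (etrans (esym E)); apply: (etrans _ E').
  rewrite (_ : h *: e' + p + h *: e = h *: e + p + h *: e'); last first.
    by rewrite addrAC [RHS]addrAC [h *: e' + _]addrC.
  rewrite [h *: e' + p]addrC [p + h *: e]addrC; ring.
have minl : Num.min a b <= a by rewrite ge_min lexx.
have minr : Num.min a b <= b by rewrite ge_min lexx orbT.
have nA := aA _ (le_ball minl (near_p _ _ _ _ erefl hc hc')).
have nB := bB _ (le_ball minr (near_p _ _ _ _ (addrC _ _) hd hd')).
exact: two_sided_close nA nB E.
Qed.

End clairaut.

Section derivation_rules.
Context (R : realType) (V : normedModType R).
Implicit Types (f g : V -> R) (p e : V) (a b c : R).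

Lemma is_derive_add f g p e a b : is_derive p e f a -> is_derive p e g b ->
  is_derive p e (fun q => f q + g q) (a + b).
Proof. by move=> df dg; exact: (@is_deriveD R V R^o f g p e a b df dg). Qed.

Lemma is_derive_mul f g p e a b : is_derive p e f a -> is_derive p e g b ->
  is_derive p e (fun q => f q * g q) (f p * b + g p * a).
Proof. by move=> df dg; exact: (@is_deriveM R V f g p e a b df dg). Qed.

Lemma is_derive_scale f p e a c : is_derive p e f a ->
  is_derive p e (fun q => c * f q) (c * a).
Proof. by move=> df; exact: (@is_deriveZ R V R^o f c p e a df). Qed.

Lemma is_deriveE f p e : derivable f p e -> is_derive p e f ('D_e f p).
Proof. by move=> df; split. Qed.

End derivation_rules.

(** * Iterated partial derivatives and the product rule *)

Section partials.
Context (R : realType) (m n : nat).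
Local Notation V := ('rV[R]_m * 'rV[R]_n)%type.
Local Notation idx := ('I_m + 'I_n)%type.
Implicit Types (u v : V -> R) (k l : idx) (s : seq idx) (p : V).

Definition pder k u : V -> R := 'D_(dir R k) u.

Definition smooth_real u : Prop :=
  forall s, continuous (foldr pder u s) /\
    forall k p, derivable (foldr pder u s) p (dir R k).

Definition mulx (j : 'I_n) u : V -> R := fun p => p.2 ord0 j * u p.

Lemma smooth_real_foldr u s : smooth_real u -> smooth_real (foldr pder u s).
Proof. by move=> su s'; rewrite -foldr_cat; exact: su. Qed.

Lemma smooth_real_pder u k : smooth_real u -> smooth_real (pder k u).
Proof. exact: (@smooth_real_foldr u [:: k]). Qed.

Lemma smooth_real_cont u : smooth_real u -> continuous u.
Proof. by move=> /(_ [::])[]. Qed.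

Lemma smooth_real_derivable u k p : smooth_real u -> derivable u p (dir R k).
Proof. by move=> /(_ [::])[_]; exact. Qed.

Lemma pder_comm u k l : smooth_real u -> pder k (pder l u) = pder l (pder k u).
Proof.
move=> su; apply: derive_comm.
- by move=> q; exact: smooth_real_derivable.
- by move=> q; exact: smooth_real_derivable.
- by move=> q; exact/smooth_real_derivable/smooth_real_pder.
- by move=> q; exact/smooth_real_derivable/smooth_real_pder.
- exact: (su [:: k; l]).1.
- exact: (su [:: l; k]).1.
Qed.

(** Words, and not multi-indices, index the iterated derivatives below: they
    make inductions simple, and this lemma makes the two equivalent. *)
Lemma foldr_pder_perm u s s' : smooth_real u -> perm_eq s s' ->
  foldr pder u s = foldr pder u s'.
Proof.
move=> su; elim: s s' => [|k s IH] s' ss'.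
  by move: ss'; rewrite perm_sym => /perm_nilP ->.
have ks' : k \in s' by rewrite -(perm_mem ss') mem_head.
rewrite /= (IH (rem k s')); last first.
  by rewrite -(perm_cons k) (perm_trans ss')// perm_to_rem.
elim: s' ks' {ss' IH} => // l s' IH; rewrite inE.
rewrite /=; have [->//|lk] := eqVneq l k.
move=> /= ks'.
rewrite (pder_comm _ _ (smooth_real_foldr _ su)).
by rewrite (IH ks').
Qed.

Lemma smooth_real_is_derive u s k p : smooth_real u ->
  is_derive p (dir R k) (foldr pder u s) (foldr pder u (k :: s) p).
Proof. by move=> su; apply: is_deriveE; have [_] := su s; exact. Qed.

Lemma coord_line (j : 'I_n) k p (h : R) :
  (h *: dir R k + p).2 ord0 j = h *: ((k == inr j)%:R : R) + p.2 ord0 j.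
Proof.
case: k => i /=; first by rewrite scaler0 add0r scaler0 add0r.
by rewrite !mxE eqxx /= [j == i]eq_sym.
Qed.

Lemma is_derive_coord (j : 'I_n) k p :
  is_derive p (dir R k) (fun q : V => q.2 ord0 j) ((k == inr j)%:R : R).
Proof.
have [E D] := @derive_along R V R^o (fun q => q.2 ord0 j) id p (dir R k) _
   (coord_line j k p).
split; first by apply/D; exact: derivable_id.
by have := E; rewrite derive_id.
Qed.

Lemma is_derive_mulx (j : 'I_n) u k p d : is_derive p (dir R k) u d ->
  is_derive p (dir R k) (mulx j u) (p.2 ord0 j * d + (k == inr j)%:R * u p).
Proof.
move=> du; rewrite [_%:R * _]mulrC; apply: is_derive_mul => //.
exact: is_derive_coord.
Qed.

(** Leibniz rule: a coordinate has constant derivatives, so at most one letter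
    of [s] falls on it, and only a letter [inr j] does. When [s] has none,
    [rem] leaves [s] as it is, but the multiplicity in front is zero. *)
Lemma foldr_pder_mulx (j : 'I_n) u s : smooth_real u ->
  foldr pder (mulx j u) s =
  fun p => mulx j (foldr pder u s) p +
    (count_mem (inr j) s)%:R * foldr pder u (rem (inr j) s) p.
Proof.
move=> su; elim: s => [|k s IH].
  by apply/funext => p /=; rewrite mul0r addr0.
rewrite [LHS]/= {}IH; apply/funext => p.
have d1 := is_derive_mulx j (smooth_real_is_derive s k p su).
have d2 := is_derive_scale (count_mem (inr j) s)%:R
  (smooth_real_is_derive (rem (inr j) s) k p su).
have [_ E] := is_derive_add d1 d2.
rewrite [LHS]E -addrA; congr (_ + _).
rewrite /=; have [->|kj] := eqVneq k (inr j).
  rewrite natrD mulrDl mul1r; congr (_ + _).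
  have [js|/count_memPn ->] := boolP (inr j \in s); last by rewrite !mul0r.
  congr (_ * _); rewrite -[pder _ _]/(foldr pder u (inr j :: rem (inr j) s)).
  by rewrite (@foldr_pder_perm u _ s)// perm_sym perm_to_rem.
by rewrite mul0r add0r add0n.
Qed.

Lemma continuous_mulx (j : 'I_n) u : continuous u -> continuous (mulx j u).
Proof.
move=> cu p; apply: (@cvgM R V (nbhs p)); last exact: cu.
apply: (@continuous_comp _ _ _ (fun q : V => q.2) (fun x : 'rV[R]_n => x ord0 j)).
  exact: cvg_snd.
exact: continuous_coord.
Qed.

Lemma smooth_real_mulx (j : 'I_n) u : smooth_real u -> smooth_real (mulx j u).
Proof.
move=> su s; rewrite foldr_pder_mulx//; split=> [p|k p].
  apply: (@cvgD R R^o V (nbhs p)); first exact/continuous_mulx/(su s).1.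
  apply: (@cvgM R V (nbhs p)); first exact: cvg_cst.
  exact: (su _).1.
have d1 := is_derive_mulx j (smooth_real_is_derive s k p su).
have d2 := is_derive_scale (count_mem (inr j) s)%:R
  (smooth_real_is_derive (rem (inr j) s) k p su).
by have [] := is_derive_add d1 d2.
Qed.

Lemma foldr_pderD u v s : smooth_real u -> smooth_real v ->
  foldr pder (fun p => u p + v p) s =
  fun p => foldr pder u s p + foldr pder v s p.
Proof.
move=> su sv; elim: s => //= k s ->; apply/funext => p.
have [_ E] := is_derive_add (smooth_real_is_derive s k p su)
  (smooth_real_is_derive s k p sv).
exact: E.
Qed.

Lemma smooth_realD u v : smooth_real u -> smooth_real v ->
  smooth_real (fun p => u p + v p).
Proof.
move=> su sv s; rewrite foldr_pderD//; split=> [p|k p].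
  by apply: (@cvgD R R^o V (nbhs p)); [exact: (su s).1|exact: (sv s).1].
by have [] := is_derive_add (smooth_real_is_derive s k p su)
  (smooth_real_is_derive s k p sv).
Qed.

Lemma foldr_pderZ (c : R) u s : smooth_real u ->
  foldr pder (fun p => c * u p) s = fun p => c * foldr pder u s p.
Proof.
move=> su; elim: s => //= k s ->; apply/funext => p.
by have [_ E] := is_derive_scale c (smooth_real_is_derive s k p su); exact: E.
Qed.

Lemma smooth_realZ (c : R) u : smooth_real u -> smooth_real (fun p => c * u p).
Proof.
move=> su s; rewrite foldr_pderZ//; split=> [p|k p].
  by apply: (@cvgM R V (nbhs p)); [exact: cvg_cst|exact: (su s).1].
by have [] := is_derive_scale c (smooth_real_is_derive s k p su).
Qed.

End partials.

(** * Integrals depending on a parameter *)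

Section parameter.
Context (R : realType).

(** Dominated convergence is about sequences; this transfers it to the
    neighbourhood filter of a point. *)
Lemma sequentially_continuous (V : normedModType R) (f : V -> R) (p : V) :
  (forall w : nat -> V, w @ \oo --> p -> (fun k => f (w k)) @ \oo --> f p) ->
  f @ p --> f p.
Proof.
move=> H; apply/cvgrPdist_lt => e e0; apply: contrapT => nb.
have K (k : nat) : exists q, ball p k.+1%:R^-1 q /\ e <= `|f p - f q|.
  apply: contrapT => /forallNP nq; apply: nb.
  apply/nbhs_ballP; exists k.+1%:R^-1 => /=; first by rewrite invr_gt0.
  move=> q pq; rewrite ltNge; apply/negP => le.
  by apply: (nq q).
pose w k := projT1 (cid (K k)).
have wK k : ball p k.+1%:R^-1 (w k) /\ e <= `|f p - f (w k)|.
  by rewrite /w; case: cid.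
have wp : w @ \oo --> p.
  apply/cvg_ballP => d d0; near=> k.
  apply: le_ball (wK k).1; apply: ltW.
  by near: k; exact: near_infty_natSinv_lt (PosNum d0).
have /cvgrPdist_lt/(_ e e0) [N _ /(_ N (leqnn N))] := H w wp.
by rewrite /= ltNge (wK N).2.
Unshelve. all: by end_near. Qed.

Lemma continuous_Rintegral_decay (V : normedModType R) n
    (G : V -> 'rV[R]_n -> R) (M : R) :
  (forall x, continuous (fun p => G p x)) ->
  (forall p, measurable_fun setT (G p)) ->
  (forall p x, `|G p x| <= M * decay x) ->
  continuous (fun p => \int[leb R n]_x G p x).
Proof.
move=> cG mG GM p; apply: sequentially_continuous => w wp.
have iG q : (leb R n).-integrable setT (EFin \o G q).
  exact: dominated_integrable_rV (mG q) (GM q).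
have iM : (leb R n).-integrable setT (EFin \o (fun x => M * decay x)).
  apply: (@dominated_integrable_rV _ _ _ `|M|).
    apply: measurable_funM => //.
    by apply/measurable_EFinP; exact: measurable_decay.
  by move=> x; rewrite normrM ler_wpM2l// ger0_norm// ltW// decay_gt0.
have [] := @dominated_convergence _ _ _ (leb R n) setT measurableT
    (fun k => EFin \o G (w k)) (EFin \o G p)
    (EFin \o (fun x => M * decay x)) _ _ _ iM _.
- by move=> k; exact/measurable_EFinP.
- exact/measurable_EFinP.
- apply: aeW => x _ /=; apply: cvg_EFin; first exact: nearW.
  apply: (cvg_comp w (fun q => G q x) wp).
  exact: cG.
- by apply: aeW => x k _ /=; rewrite lee_fin.
move=> _ _; rewrite -(fineK (integrable_fin_num measurableT (iG p))).
by move=> /fine_cvg; exact.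
Qed.

(** The point 0 is enough, since a directional derivative at [p] is the
    derivative at 0 along a line through [p]. *)
Lemma is_derive_Rintegral_decay n (F dF : R -> 'rV[R]_n -> R) (M : R) :
  (forall h, (leb R n).-integrable setT (EFin \o F h)) ->
  (forall (h : R) x, is_derive h (1 : R) (fun h : R => F h x) (dF h x)) ->
  (forall h x, `|dF h x| <= M * decay x) ->
  is_derive (0 : R) (1 : R) (fun h : R => \int[leb R n]_x F h x) (\int[leb R n]_x dF 0 x).
Proof.
move=> iF der dM.
have E (h : R) x : partial1of2 F h x = dF h x.
  by rewrite partial1of2E; case: (der h x).
have M0 (x : 'rV[R]_n) : 0 <= M * decay x by rewrite (le_trans _ (dM 0 x)).
have iM : (leb R n).-integrable setT (EFin \o (fun x => M * decay x)).
  apply: (@dominated_integrable_rV _ _ _ `|M|).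
    apply: measurable_funM => //.
    by apply/measurable_EFinP; exact: measurable_decay.
  by move=> x; rewrite normrM ler_wpM2l// ger0_norm// ltW// decay_gt0.
have I0 : `](-1), 1[%classic (0 : R) by rewrite /= in_itv/= ltrN10 ltr01.
have iF' (h : R) : `](-1), 1[%classic h -> (leb R n).-integrable setT (EFin \o F h) by [].
have dF' (h : R) x : `](-1), 1[%classic h -> setT x -> derivable (F^~ x) h 1.
  by move=> _ _; case: (der h x).
have ub (h : R) x : `](-1), 1[%classic h -> setT x -> `|partial1of2 F h x| <= M * decay x.
  by move=> _ _; rewrite E.
have D := derivable_under_integral measurableT I0 iF' dF' M0 iM ub.
split; first exact: D.
rewrite -derive1E (differentiation_under_integral measurableT I0 iF' dF' M0 iM ub).
by apply: eq_Rintegral => x _; rewrite E.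
Qed.

End parameter.

(** * The cosine transform *)

Section transform.
Context (R : realType) (m n : nat).
Local Notation V := ('rV[R]_m * 'rV[R]_n)%type.
Local Notation idx := ('I_m + 'I_n)%type.
Implicit Types (u v : V -> R) (k l : idx) (s : seq idx) (p : V) (th : R).

(** The phase [th] makes one real operator out of the cosine and the sine
    transforms: they are the phases 0 and - pi / 2. *)
Definition cosint th u : V -> R := fun p =>
  \int[leb R n]_x (u (p.1, x) * cos (dotp p.2 x + th)).

Definition dominated (M : R) u : Prop := forall p, `|u p| <= M * decay p.2.

Lemma continuous_dotp (xi : 'rV[R]_n) : continuous (dotp xi).
Proof.
rewrite /dotp; apply: continuous_big => [p|j _ x]; first exact: add_continuous.
by apply: (@cvgM R 'rV[R]_n (nbhs x)); [exact: cvg_cst|exact: continuous_coord].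
Qed.

Lemma dotpC (xi x : 'rV[R]_n) : dotp xi x = dotp x xi.
Proof. by apply: eq_bigr => j _; rewrite mulrC. Qed.

Lemma dotp_line (j : 'I_n) (h : R) (xi x : 'rV[R]_n) :
  dotp (h *: delta_mx ord0 j + xi) x = h * x ord0 j + dotp xi x.
Proof.
rewrite /dotp (eq_bigr (fun i => (h * (i == j)%:R) * x ord0 i + xi ord0 i * x ord0 i)).
  rewrite big_split /=; congr (_ + _).
  rewrite (bigD1 j)//= eqxx mulr1 big1 ?addr0// => i /negbTE ->.
  by rewrite mulr0 mul0r.
by move=> i _; rewrite !mxE eqxx /= mulrDl.
Qed.

Lemma continuous_pair_r (U W : pseudoMetricType R) (t : U) :
  continuous (fun x : W => (t, x)).
Proof.
move=> x A /nbhs_ballP[e /= e0 eA]; apply/nbhs_ballP; exists e => // y xy.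
by apply: eA; split => //=; exact: ballxx.
Qed.

Lemma continuous_pair_l (U W : pseudoMetricType R) (y : W) :
  continuous (fun t : U => (t, y)).
Proof.
move=> x A /nbhs_ballP[e /= e0 eA]; apply/nbhs_ballP; exists e => // t xt.
by apply: eA; split => //=; exact: ballxx.
Qed.

Lemma continuous_section u (t : 'rV[R]_m) :
  continuous u -> continuous (fun x => u (t, x)).
Proof.
move=> cu x; apply: (@continuous_comp _ _ _ (fun x => (t, x)) u); last exact: cu.
exact: continuous_pair_r.
Qed.

Lemma continuous_cosdot (xi : 'rV[R]_n) th : continuous (fun x => cos (dotp xi x + th)).
Proof.
move=> x; apply: (@continuous_comp _ _ _ (fun x => dotp xi x + th) cos).
  by apply: (@cvgD R R^o 'rV[R]_n (nbhs x)); [exact: continuous_dotp|exact: cvg_cst].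
exact: continuous_cos.
Qed.

Lemma continuous_integrand u th p : continuous u ->
  continuous (fun x => u (p.1, x) * cos (dotp p.2 x + th)).
Proof.
move=> cu x; apply: (@cvgM R 'rV[R]_n (nbhs x)); first exact: continuous_section.
exact: continuous_cosdot.
Qed.

Lemma integrand_le u th p x : `|u (p.1, x) * cos (dotp p.2 x + th)| <= `|u (p.1, x)|.
Proof. by rewrite normrM ler_piMr// cos_max. Qed.

Lemma integrable_cosint u th p M : continuous u -> dominated M u ->
  (leb R n).-integrable setT
    (EFin \o (fun x => u (p.1, x) * cos (dotp p.2 x + th))).
Proof.
move=> cu uM; apply: (@dominated_integrable_rV _ _ _ M).
  by apply: continuous_measurable_rV; exact: continuous_integrand.
by move=> x; rewrite (le_trans (integrand_le _ _ _ _))// uM.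
Qed.

Lemma cosint_le u th p M : continuous u -> dominated M u ->
  `|cosint th u p| <= M * decay_mass R n.
Proof.
move=> cu uM; apply: le_Rintegral_decay.
  by apply: continuous_measurable_rV; exact: continuous_integrand.
by move=> x; rewrite (le_trans (integrand_le _ _ _ _))// uM.
Qed.

Lemma continuous_cosint u th M : continuous u -> dominated M u ->
  continuous (cosint th u).
Proof.
move=> cu uM; apply: (@continuous_Rintegral_decay _ _ _
  (fun p x => u (p.1, x) * cos (dotp p.2 x + th)) M).
- move=> x p; apply: (@cvgM R V (nbhs p)).
    apply: (@continuous_comp _ _ _ (fun p : V => (p.1, x)) u); last exact: cu.
    apply: (@continuous_comp _ _ _ (fun p : V => p.1) (fun t => (t, x))).
      exact: cvg_fst.
    exact: continuous_pair_l.
  apply: (@continuous_comp _ _ _ (fun p : V => dotp p.2 x + th) cos).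
    apply: (@cvgD R R^o V (nbhs p)); last exact: cvg_cst.
    apply: (@continuous_comp _ _ _ (fun p : V => p.2) (fun xi => dotp xi x)).
      exact: cvg_snd.
    rewrite (_ : (fun xi => _) = dotp x); last by apply/funext => xi; rewrite dotpC.
    exact: continuous_dotp.
  exact: continuous_cos.
- by move=> p; apply: continuous_measurable_rV; exact: continuous_integrand.
- by move=> p x; rewrite (le_trans (integrand_le _ _ _ _))// uM.
Qed.

Lemma is_derive_cosint_line (w : R -> V -> R) (e : V) th u p d :
  (forall h : R, cosint th u (h *: e + p) =
     \int[leb R n]_x (w h (p.1, x))) ->
  is_derive (0 : R) (1 : R) (fun h : R => \int[leb R n]_x (w h (p.1, x))) d ->
  is_derive p e (cosint th u) d.
Proof.
move=> E [D1 D2].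
have [L1 L2] := derive_line (cosint th u) p e 0.
have F : (fun h : R => cosint th u (h *: e + p)) =
    (fun h : R => \int[leb R n]_x (w h (p.1, x))) by apply/funext.
rewrite scale0r add0r in L1 L2; rewrite F in L1 L2.
split; first exact: (iffLR L2 D1).
exact: (etrans (esym L1) D2).
Qed.

Lemma is_derive_cosint_t (i : 'I_m) u th p M : continuous u -> dominated M u ->
  (forall q, derivable u q (dir R (inl i))) ->
  continuous (pder (inl i) u) -> dominated M (pder (inl i) u) ->
  is_derive p (dir R (inl i)) (cosint th u) (cosint th (pder (inl i) u) p).
Proof.
move=> cu uM du cdu duM.
pose F (h : R) (x : 'rV[R]_n) :=
  u (h *: dir R (inl i) + (p.1, x)) * cos (dotp p.2 x + th).
pose dF (h : R) (x : 'rV[R]_n) :=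
  pder (inl i) u (h *: dir R (inl i) + (p.1, x)) * cos (dotp p.2 x + th).
have dirE (h : R) q x : h *: dir R (inl i) + (q.1, x) =
    ((h *: dir R (inl i) + q).1, x) :> V.
  by rewrite /dir; congr pair; rewrite /= scaler0 add0r.
have dir2 (h : R) q : (h *: dir R (inl i) + q).2 = q.2 :> 'rV[R]_n.
  by rewrite /= scaler0 add0r.
have FE (h : R) : F h = fun x => u ((h *: dir R (inl i) + p).1, x) *
    cos (dotp (h *: dir R (inl i) + p).2 x + th).
  by apply/funext => x; rewrite /F dirE dir2.
apply: (@is_derive_cosint_line (fun h q => F h q.2)).
  by move=> h; rewrite /cosint; apply: eq_Rintegral => x _; rewrite FE.
have -> : cosint th (pder (inl i) u) p = \int[leb R n]_x dF 0 x.
  by apply: eq_Rintegral => x _; rewrite /dF scale0r add0r.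
apply: (@is_derive_Rintegral_decay _ _ F dF M).
- by move=> h; rewrite FE; exact: (@integrable_cosint u th _ M).
- move=> h x; rewrite /F /dF mulrC [X in is_derive _ _ X](_ : _ = (fun h : R =>
      cos (dotp p.2 x + th) * u (h *: dir R (inl i) + (p.1, x)))); last first.
    by apply/funext => h'; rewrite mulrC.
  apply: (@is_derive_scale R R^o).
  have [L1 L2] := derive_line u (p.1, x) (dir R (inl i)) h.
  by split; [apply/L2|rewrite L1].
- move=> h x; rewrite /dF dirE -(dir2 h p).
  exact: (le_trans (integrand_le _ _ _ _) (duM _)).
Qed.

Lemma is_derive_cos_affine (a b h : R) :
  is_derive h (1 : R) (fun h : R => cos (h * a + b)) (a * cos (h * a + b + pi / 2)).
Proof.
have d1 : is_derive h (1 : R) (fun h : R => h * a + b) a.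
  have lin (k : R) : (k *: (1 : R) + h) * a + b = k *: a + (h * a + b).
    by rewrite mulrDl addrA; congr (_ * _ + _ + _); exact: mulr1.
  have [E D] := @derive_along R R^o R^o (fun h : R => h * a + b) id h 1 a lin.
  split; first by apply/D; exact: derivable_id.
  by have := E; rewrite derive_id.
rewrite mulrC cosDpihalf.
exact: (@is_derive1_comp R cos (fun h : R => h * a + b) h _ _ (is_derive_cos _) d1).
Qed.

(** Differentiation of the cosine produces the factor x_j and advances the
    phase by a quarter turn. *)
Lemma is_derive_cosint_x (j : 'I_n) u th p M : continuous u -> dominated M u ->
  dominated M (mulx j u) ->
  is_derive p (dir R (inr j)) (cosint th u) (cosint (th + pi / 2) (mulx j u) p).
Proof.
move=> cu uM juM.
pose F (h : R) (x : 'rV[R]_n) :=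
  u (p.1, x) * cos (h * x ord0 j + (dotp p.2 x + th)).
pose dF (h : R) (x : 'rV[R]_n) :=
  u (p.1, x) * (x ord0 j * cos (h * x ord0 j + (dotp p.2 x + th) + pi / 2)).
have FE (h : R) : F h = fun x => u ((h *: dir R (inr j) + p).1, x) *
    cos (dotp (h *: dir R (inr j) + p).2 x + th).
  by apply/funext => x; rewrite /F /= dotp_line scaler0 add0r addrA.
apply: (@is_derive_cosint_line (fun h q => F h q.2)).
  by move=> h; rewrite /cosint; apply: eq_Rintegral => x _; rewrite FE.
have -> : cosint (th + pi / 2) (mulx j u) p = \int[leb R n]_x dF 0 x.
  apply: eq_Rintegral => x _; rewrite /dF mul0r add0r /mulx /= addrA.
  by rewrite mulrCA mulrA.
apply: (@is_derive_Rintegral_decay _ _ F dF M).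
- by move=> h; rewrite FE; exact: (@integrable_cosint u th _ M).
- move=> h x; apply: (@is_derive_scale R R^o); exact: is_derive_cos_affine.
- move=> h x; rewrite /dF mulrA normrM (le_trans (ler_piMr _ (cos_max _)))//.
  by rewrite mulrC; exact: (juM (p.1, x)).
Qed.

(** The derivative along x_j of u cos (xi . x + th - pi / 2) integrates to
    zero. Its two terms are xi_j u cos (xi . x + th) and the derivative of u
    times cos (xi . x + th - pi / 2), and the sign between them turns the last
    phase into th + pi / 2: the same advance as in [is_derive_cosint_x]. *)
Lemma cosint_parts (j : 'I_n) u th p M : continuous u -> dominated M u ->
  (forall q, derivable u q (dir R (inr j))) ->
  continuous (pder (inr j) u) -> dominated M (pder (inr j) u) ->
  p.2 ord0 j * cosint th u p = cosint (th + pi / 2) (pder (inr j) u) p.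
Proof.
move=> cu uM du cdu duM; set xi := p.2.
(* The function whose derivative produces both integrals is taken with the
   phase that precedes th by a quarter turn. *)
pose ph := th - pi / 2.
pose F (x : 'rV[R]_n) := u (p.1, x) * cos (dotp xi x + ph).
pose A (x : 'rV[R]_n) := u (p.1, x) * cos (dotp xi x + th).
pose B (x : 'rV[R]_n) := pder (inr j) u (p.1, x) * cos (dotp xi x + ph).
have dF x : is_derive x (delta_mx ord0 j) F (xi ord0 j * A x + B x).
  have sec (h : R) : (p.1, h *: delta_mx ord0 j + x) = h *: dir R (inr j) + (p.1, x) :> V.
    by congr pair; rewrite /= scaler0 add0r.
  have [S1 S2] := @derive_along R _ _ (fun x : 'rV[R]_n => (p.1, x)) u x
    (delta_mx ord0 j) _ sec.
  have d1 : is_derive x (delta_mx ord0 j) (fun x => u (p.1, x)) (pder (inr j) u (p.1, x)).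
    by split; [exact/S2|exact: S1].
  have lin (h : R) : dotp xi (h *: delta_mx ord0 j + x) = h * xi ord0 j + dotp xi x.
    by rewrite dotpC dotp_line [dotp x xi]dotpC.
  have [T1 T2] := derive_line (fun x => cos (dotp xi x + ph)) x (delta_mx ord0 j) 0.
  rewrite scale0r add0r in T1 T2.
  have EF : (fun s : R => cos (dotp xi (s *: delta_mx ord0 j + x) + ph)) =
      (fun s : R => cos (s * xi ord0 j + (dotp xi x + ph))).
    apply/funext => s; congr cos.
    exact: etrans (congr1 (fun z => z + ph) (lin s)) (esym (addrA _ _ _)).
  rewrite EF in T1 T2.
  have [C1 C2] := is_derive_cos_affine (xi ord0 j) (dotp xi x + ph) 0.
  have d2 : is_derive x (delta_mx ord0 j) (fun x => cos (dotp xi x + ph))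
      (xi ord0 j * cos (dotp xi x + th)).
    split; first exact: (iffLR T2 C1).
    rewrite -T1 C2 mul0r add0r; congr (_ * cos _).
    by rewrite /ph -addrA subrK.
  have := is_derive_mul d1 d2.
  by rewrite /A /B [cos _ * _]mulrC mulrCA.
have EdF : 'D_(delta_mx ord0 j) F = fun x => xi ord0 j * A x + B x.
  by apply/funext => x; case: (dF x).
have cA : continuous A by exact: (@continuous_integrand u th p cu).
have cB : continuous B by exact: (@continuous_integrand _ ph p cdu).
have cF : continuous F by exact: (@continuous_integrand u ph p cu).
have iA : (leb R n).-integrable setT (EFin \o A) by exact: (@integrable_cosint u th p M).
have iB : (leb R n).-integrable setT (EFin \o B) by exact: (@integrable_cosint _ ph p M).
have M0 (x : 'rV[R]_n) : 0 <= M * decay x by exact: le_trans (normr_ge0 _) (uM (p.1, x)).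
have Z : (\int[leb R n]_x ('D_(delta_mx ord0 j) F x)%:E = 0)%E.
  apply: (@integral_partial_eq0 _ _ _ _ (M * (`|xi ord0 j| + 1))).
  - by move=> x; case: (dF x).
  - exact: cF.
  - rewrite EdF => x; apply: (@cvgD R R^o 'rV[R]_n (nbhs x)); last exact: cB.
    by apply: (@cvgM R 'rV[R]_n (nbhs x)); [exact: cvg_cst|exact: cA].
  - move=> x; rewrite mulrAC.
    apply: le_trans (le_trans (integrand_le u ph p x) (uM (p.1, x))) _.
    by rewrite ler_peMr// lerDr.
  - move=> x; case: (dF x) => _ ->.
    rewrite (le_trans (ler_normD _ _))// mulrAC mulrDr mulr1 lerD//.
      rewrite normrM mulrC ler_wpM2r//.
      exact: le_trans (integrand_le u th p x) (uM (p.1, x)).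
    exact: le_trans (integrand_le _ ph p x) (duM (p.1, x)).
have E0 : xi ord0 j * cosint th u p + (\int[leb R n]_x B x) = 0.
  rewrite -RintegralZl// -RintegralD//; last first.
    rewrite (_ : EFin \o _ = (fun x => (xi ord0 j)%:E * (EFin \o A) x)%E)//.
    exact: integrableZl.
  rewrite -[RHS]/(fine 0%E) -Z; apply: eq_Rintegral => x _.
  by case: (dF x).
rewrite -[LHS]addr0 -[X in _ + X](subrr (\int[leb R n]_x B x)) addrA E0 add0r.
have -> : - (\int[leb R n]_x B x) = -1 * (\int[leb R n]_x B x) by rewrite mulN1r.
rewrite -RintegralZl//; apply: eq_Rintegral => x _.
rewrite /B mulrCA; congr (_ * _).
rewrite (_ : dotp p.2 x + (th + pi / 2) = dotp xi x + ph + pi).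
  by rewrite cosDpi mulN1r.
by rewrite /ph /xi; lra.
Qed.

End transform.

(** * Factorial weights of words of letters *)

Section weight.
Context (R : realType) (m n : nat) (sigma mu : R).
Local Notation idx := ('I_m + 'I_n)%type.
Implicit Types (z : seq idx).

Definition expo (k : idx) : R := if k is inl _ then sigma else mu.

(** The letter [inr j] stands both for the derivative in x_j and for the
    multiplication by x_j. Since the Fourier transform exchanges the two, it
    does not change this weight, unlike (alpha! beta!) ^ mu gamma! ^ sigma,
    from which it differs only by a geometric factor. *)
Definition wt z : R := \prod_(k : idx) ((count_mem k z)`!%:R `^ expo k).

Lemma wt_gt0 z : 0 < wt z.
Proof. by apply: prodr_gt0 => k _; rewrite powR_gt0// ltr0n fact_gt0. Qed.

Lemma wt_perm z z' : perm_eq z z' -> wt z = wt z'.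
Proof. by move=> /permP zz'; apply: eq_bigr => k _; rewrite zz'. Qed.

Lemma wt_cons k z : wt (k :: z) = (count_mem k z).+1%:R `^ expo k * wt z.
Proof.
rewrite /wt (bigD1 k)//= [in RHS](bigD1 k)//= mulrA; congr (_ * _).
  by rewrite eqxx add1n factS natrM powRM.
apply: eq_bigr => l /negbTE lk; rewrite eq_sym lk//.
Qed.

Hypothesis hmu : 2^-1 <= mu.

(** A derivative that falls on a coordinate costs a factor c at most the
    multiplicity of the letter, and removes two occurrences of this letter
    from the weight. These pay for it, because c <= c ^ (2 mu). *)
Lemma wt_double j z :
  (count_mem (inr j) z).+1%:R * wt z <= wt (inr j :: inr j :: z).
Proof.
rewrite !wt_cons /= eqxx add1n mulrA ler_wpM2r ?(ltW (wt_gt0 _))//.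
set c := (count_mem _ z).+1.
have c1 : 1 <= c%:R :> R by rewrite ler1n.
have mu0 : 0 <= mu by rewrite (le_trans _ hmu).
apply: (@le_trans _ _ (c%:R `^ mu * c%:R `^ mu)).
  rewrite -powRD; last by apply/implyP => _; rewrite pnatr_eq0.
  rewrite -[leLHS]powRr1//; apply: ler_powR => //.
  by have := hmu; lra.
by rewrite ler_wpM2r ?powR_ge0// ge0_ler_powR ?nnegrE// ler_nat.
Qed.

Hypothesis hsigma : 0 <= sigma.

Definition wt_base : R := 2 `^ (sigma + mu).

Lemma wt_base_ge1 : 1 <= wt_base.
Proof.
rewrite -[leLHS](powRr0 2); apply: ler_powR; first by rewrite ler1n.
by rewrite addr_ge0// (le_trans _ hmu).
Qed.

Lemma expo_le k : expo k <= sigma + mu.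
Proof. by case: k => _ /=; rewrite ?lerDl ?lerDr// (le_trans _ hmu). Qed.

(** One more letter costs at most (N + 1) ^ (sigma + mu), which is geometric
    in N, since N + 1 <= 2 ^ N. *)
Lemma wt_cons_le k z N : (size z <= N)%N -> wt (k :: z) <= wt_base ^+ N * wt z.
Proof.
move=> zN; rewrite wt_cons ler_wpM2r ?(ltW (wt_gt0 _))//.
have E : wt_base ^+ N = (2 ^+ N) `^ (sigma + mu).
  rewrite -(powR_mulrn N (powR_ge0 _ _)) -(powR_mulrn N (ler0n R 2)).
  by rewrite -[LHS]powRrM -[RHS]powRrM mulrC.
rewrite E (@le_trans _ _ ((count_mem k z).+1%:R `^ (sigma + mu)))//.
  by apply: ler_powR; [rewrite ler1n|exact: expo_le].
rewrite ge0_ler_powR ?nnegrE ?exprn_ge0//.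
  by rewrite addr_ge0// (le_trans _ hmu).
rewrite -natrX ler_nat (leq_trans _ (ltn_expl N (ltnSn 1)))// ltnS.
by rewrite (leq_trans (count_size _ _)).
Qed.

Lemma wt_cat_le e z N : (size e + size z <= N)%N ->
  wt (e ++ z) <= (wt_base ^+ N) ^+ size e * wt z.
Proof.
elim: e => [|k e IH] eN; first by rewrite expr0 mul1r.
have wb0 : 0 <= wt_base ^+ N by rewrite exprn_ge0// (le_trans _ wt_base_ge1).
rewrite (le_trans (@wt_cons_le k (e ++ z) N _))//.
  by rewrite size_cat (leq_trans _ eN)// leq_add2r.
by rewrite exprS -mulrA ler_wpM2l// IH// (leq_trans _ eN)// leq_add2r.
Qed.

End weight.

(** * Words of derivatives and coordinates acting on Schwartz functions *)

Section schwartz.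
Context (R : realType) (m n : nat).
Local Notation V := ('rV[R]_m * 'rV[R]_n)%type.
Local Notation idx := ('I_m + 'I_n)%type.
Implicit Types (u v : V -> R) (k l : idx) (s z : seq idx) (r e b : seq 'I_n)
  (p : V) (th : R).

Definition mono r p : R := \prod_(j <- r) p.2 ord0 j.

Lemma foldr_mulxE u r p : foldr (@mulx R m n) u r p = mono r p * u p.
Proof.
rewrite /mono; elim: r => [|j r IH] /=; first by rewrite big_nil mul1r.
by rewrite /mulx IH big_cons mulrA.
Qed.

Definition schwartz u : Prop := smooth_real u /\
  forall r s, exists M : R, forall p, `|mono r p * foldr (@pder R m n) u s p| <= M.

Lemma smooth_real_mono u r : smooth_real u -> smooth_real (foldr (@mulx R m n) u r).
Proof. by move=> su; elim: r => [//|j r IH]; exact: (smooth_real_mulx j IH). Qed.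

(** Only these 2 ^ n monomials, of degree at most 2 n, are needed to control
    the product [decay]: one for each possible set of large coordinates. *)
Definition square_word (S : {set 'I_n}) : seq 'I_n := enum S ++ enum S.

Lemma size_square_word S : (size (square_word S) <= 2 * n)%N.
Proof.
rewrite size_cat -cardE addnn -mul2n leq_mul2l /=.
by rewrite (leq_trans (max_card _))// card_ord.
Qed.

(** If S is the set of j with |x_j| > 1, each 1 + x_j^2 is at most 2 x_j^2 for
    j in S and at most 2 for the others. *)
Lemma dominated_square_word u (M : R) :
  (forall S p, `|mono (square_word S) p * u p| <= M) ->
  dominated (2 ^+ n * M) u.
Proof.
move=> uM p; pose S : {set 'I_n} := finset (fun j => 1 < `|p.2 ord0 j|).
have P0 : 0 < \prod_(j < n) (1 + p.2 ord0 j ^+ 2) by apply: prodr_gt0 => j _; exact: onesqr_gt0.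
rewrite /decay prodfV -[leRHS]/(2 ^+ n * M / _) ler_pdivlMr// [leLHS]mulrC.
suff le1 : \prod_(j < n) (1 + p.2 ord0 j ^+ 2) <=
    2 ^+ n * `|mono (square_word S) p|.
  apply: (le_trans (ler_wpM2r (normr_ge0 (u p)) le1)).
  by rewrite -mulrA ler_wpM2l ?exprn_ge0// -normrM.
have -> : 2 ^+ n * `|mono (square_word S) p| =
    \prod_(j < n) (2 * if j \in S then p.2 ord0 j ^+ 2 else 1).
  rewrite big_split /= prodr_const card_ord; congr (_ * _).
  rewrite /mono /square_word big_cat /= -expr2 ger0_norm ?sqr_ge0//.
  by rewrite -prodrXl big_enum -big_mkcond.
apply: ler_prod => j _; rewrite (ltW (onesqr_gt0 _)) /= inE.
case: ltP => h.
  have : 1 <= p.2 ord0 j ^+ 2 by rewrite -real_normK ?num_real// exprn_ege1// ltW.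
  by lra.
have : p.2 ord0 j ^+ 2 <= 1 by rewrite -real_normK ?num_real// exprn_ile1.
by lra.
Qed.

Lemma schwartz_dominated u : schwartz u -> exists M, dominated M u.
Proof.
move=> [_ Hu].
pose B S := projT1 (cid (Hu (square_word S) [::])).
have HB S p : `|mono (square_word S) p * u p| <= B S.
  by rewrite /B; case: cid => M /= HM; exact: HM.
have B0 S : 0 <= B S by rewrite (le_trans _ (HB S (0, 0))).
exists (2 ^+ n * \sum_S B S); apply: dominated_square_word => S p.
rewrite (le_trans (HB S p))// (bigD1 S)//= lerDl sumr_ge0//.
Qed.

Lemma schwartz_foldr u s : schwartz u -> schwartz (foldr (@pder R m n) u s).
Proof.
move=> [su Hu]; split; first exact: smooth_real_foldr.
by move=> r s'; rewrite -foldr_cat; exact: Hu.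
Qed.

Lemma schwartz_pder u k : schwartz u -> schwartz (pder k u).
Proof. exact: (@schwartz_foldr u [:: k]). Qed.

Lemma schwartz_mulx u j : schwartz u -> schwartz (mulx j u).
Proof.
move=> [su Hu]; split; first exact: smooth_real_mulx.
move=> r s; have [M1 H1] := Hu (j :: r) s.
have [M2 H2] := Hu r (rem (inr j) s).
exists (M1 + (count_mem (inr j : idx) s)%:R * M2) => p.
rewrite foldr_pder_mulx// mulrDr (le_trans (ler_normD _ _))// lerD//.
  by move: (H1 p); rewrite /mono big_cons /mulx [p.2 _ _ * \prod_(_ <- _) _]mulrC mulrA.
by rewrite mulrCA normrM ger0_norm// ler_wpM2l.
Qed.

Lemma is_derive_cosint_schwartz u th k p : schwartz u ->
  is_derive p (dir R k) (cosint th u)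
    (match k with
     | inl i => cosint th (pder (inl i) u) p
     | inr j => cosint (th + pi / 2) (mulx j u) p end).
Proof.
move=> Su; have cu := smooth_real_cont Su.1.
have [M uM] := schwartz_dominated Su.
case: k => [i|j].
  have Sd := schwartz_pder (inl i) Su.
  have [M' uM'] := schwartz_dominated Sd.
  apply: (@is_derive_cosint_t _ _ _ i u th p (Num.max M M')) => //.
  - by move=> q; rewrite (le_trans (uM q))// ler_wpM2r ?(ltW (decay_gt0 _))// le_max lexx.
  - by move=> q; exact: (smooth_real_derivable Su.1).
  - exact: smooth_real_cont Sd.1.
  - by move=> q; rewrite (le_trans (uM' q))// ler_wpM2r ?(ltW (decay_gt0 _))// le_max lexx orbT.
have Sd := schwartz_mulx j Su.
have [M' uM'] := schwartz_dominated Sd.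
apply: (@is_derive_cosint_x _ _ _ j u th p (Num.max M M')) => //.
- by move=> q; rewrite (le_trans (uM q))// ler_wpM2r ?(ltW (decay_gt0 _))// le_max lexx.
- by move=> q; rewrite (le_trans (uM' q))// ler_wpM2r ?(ltW (decay_gt0 _))// le_max lexx orbT.
Qed.

Lemma mulx_cosint u th j : schwartz u ->
  mulx j (cosint th u) = cosint (th + pi / 2) (pder (inr j) u).
Proof.
move=> Su; have cu := smooth_real_cont Su.1.
have [M uM] := schwartz_dominated Su.
have Sd := schwartz_pder (inr j) Su.
have [M' uM'] := schwartz_dominated Sd.
apply/funext => p; apply: (@cosint_parts _ _ _ j u th p (Num.max M M')) => //.
- by move=> q; rewrite (le_trans (uM q))// ler_wpM2r ?(ltW (decay_gt0 _))// le_max lexx.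
- by move=> q; exact: (smooth_real_derivable Su.1).
- exact: smooth_real_cont Sd.1.
- by move=> q; rewrite (le_trans (uM' q))// ler_wpM2r ?(ltW (decay_gt0 _))// le_max lexx orbT.
Qed.

(** What a derivative with letter [k] of a cosine transform does to the
    function under the integral sign. *)
Definition dual k u : V -> R :=
  match k with inl i => pder (inl i) u | inr j => mulx j u end.

Lemma schwartz_dual u k : schwartz u -> schwartz (dual k u).
Proof. by case: k => i; [exact: schwartz_pder|exact: schwartz_mulx]. Qed.

(** The phase is not recorded: no estimate of a cosine transform depends on
    it. *)
Lemma foldr_pder_cosint u th s : schwartz u -> exists th',
  foldr (@pder R m n) (cosint th u) s = cosint th' (foldr dual u s) /\
  schwartz (foldr dual u s).
Proof.
move=> Su; elim: s => [|k s [th' [E S']]]; first by exists th.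
have S'' := schwartz_dual k S'.
have D p := is_derive_cosint_schwartz th' k p S'.
case: k => [i|j] in S'' D *.
  by exists th'; split => //=; rewrite E; apply/funext => p; case: (D p).
by exists (th' + pi / 2); split => //=; rewrite E; apply/funext => p; case: (D p).
Qed.

Lemma foldr_mulx_cosint u th r : schwartz u -> exists th',
  foldr (@mulx R m n) (cosint th u) r =
  cosint th' (foldr (@pder R m n) u (map inr r)).
Proof.
move=> Su; elim: r => [|j r [th' E]]; first by exists th.
exists (th' + pi / 2); rewrite /= E mulx_cosint//.
exact: schwartz_foldr.
Qed.

Lemma smooth_real_cosint u th : schwartz u -> smooth_real (cosint th u).
Proof.
move=> Su s; have [th' [E S']] := foldr_pder_cosint th s Su.
rewrite E; split=> [|k p]; last by have [] := is_derive_cosint_schwartz th' k p S'.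
have [M uM] := schwartz_dominated S'.
exact: continuous_cosint (smooth_real_cont S'.1) uM.
Qed.

Definition is_t k : bool := if k is inl _ then true else false.
Definition xpart s : seq 'I_n :=
  pmap (fun k => if k is inr j then Some j else None) s.

Lemma pder_t_mono i u r : smooth_real u ->
  pder (inl i) (foldr (@mulx R m n) u r) = foldr (@mulx R m n) (pder (inl i) u) r.
Proof.
move=> su; elim: r => //= j r IH.
have := foldr_pder_mulx j [:: inl i] (smooth_real_mono r su).
rewrite /= IH => ->; apply/funext => p.
by rewrite mul0r addr0.
Qed.

(** Derivatives in t commute with multiplications by coordinates of x, so the
    dual letters can be sorted. *)
Lemma foldr_dualE u s : smooth_real u ->
  foldr dual u s = foldr (@mulx R m n) (foldr (@pder R m n) u [seq k <- s | is_t k]) (xpart s).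
Proof.
move=> su; elim: s => //= k s ->; case: k => [i|j] //=.
by rewrite pder_t_mono//; exact: smooth_real_foldr.
Qed.

Lemma perm_parts s : perm_eq (map inr (xpart s) ++ [seq k <- s | is_t k]) s.
Proof.
elim: s => //= -[i|j] s IH /=; last by rewrite perm_cons.
by rewrite perm_catC /= perm_cons perm_catC.
Qed.

End schwartz.

(** * The Gelfand-Shilov estimate for a cosine transform *)

Section estimate.
Context (R : realType) (m n : nat) (sigma mu : R).
Local Notation V := ('rV[R]_m * 'rV[R]_n)%type.
Local Notation idx := ('I_m + 'I_n)%type.
Implicit Types (u v : V -> R) (k l : idx) (s c z : seq idx) (r e b : seq 'I_n)
  (p : V) (th : R).
Local Notation wt := (@wt R m n sigma mu).
Local Notation pders := (foldr (@pder R m n)).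
Local Notation mulxs := (foldr (@mulx R m n)).

(** The counterpart for words of the Gelfand-Shilov estimate; x_j and the
    derivative in x_j count as the same letter in the weight. *)
Definition gs_bound (C0 C1 : R) u : Prop := forall r s p,
  `|mono r p * pders u s p| <=
    C0 * C1 ^+ (size r + size s) * wt (map inr r ++ s).

Definition gs_real u : Prop :=
  exists C0 C1 : R, [/\ 0 < C0, 1 <= C1 & gs_bound C0 C1 u].

Lemma gs_schwartz u : smooth_real u -> gs_real u -> schwartz u.
Proof.
move=> su [C0 [C1 [_ _ H]]]; split => // r s.
by exists (C0 * C1 ^+ (size r + size s) * wt (map inr r ++ s)) => p; exact: H.
Qed.

Lemma mono_rcons r j p : mono (rcons r j) p = mono r p * p.2 ord0 j.
Proof. by rewrite /mono big_rcons /= mulrC. Qed.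

Hypothesis hmu : 2^-1 <= mu.

(** Induction on [b]. Moving its first coordinate x_j to the left of the
    derivatives [s] gives two terms. In one, x_j has joined [e]. In the other,
    x_j and a derivative in x_j have disappeared and left behind the
    multiplicity of this derivative, which [wt_double] absorbs. Thus each
    letter of [b] at most doubles the bound. *)
Lemma commute_bound (C0 C1 : R) u : 0 < C0 -> 1 <= C1 -> smooth_real u ->
  gs_bound C0 C1 u -> forall b e s c p,
  `|mono e p * pders (mulxs (pders u c) b) s p| <=
  C0 * C1 ^+ (size e + size b + size s + size c) * 2 ^+ size b *
    wt (map inr (e ++ b) ++ s ++ c).
Proof.
move=> C00 C11 su Hu; have C10 : 0 < C1 by rewrite (lt_le_trans ltr01).
elim=> [|j b IH] e s c p.
  rewrite /= -foldr_cat cats0 addn0 expr0 mulr1 -addnA -size_cat.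
  exact: Hu.
have sv : smooth_real (mulxs (pders u c) b).
  by apply: smooth_real_mono; exact: smooth_real_foldr.
rewrite [mulxs _ _]/= foldr_pder_mulx// mulrDr (le_trans (ler_normD _ _))//.
(* Each of the two terms is at most half of the bound. *)
pose W := C0 * C1 ^+ (size e + (size b).+1 + size s + size c) * 2 ^+ size b *
    wt (map inr (e ++ j :: b) ++ s ++ c).
have WE : W = C0 * C1 ^+ (size e + (size b).+1 + size s + size c) * 2 ^+ size b *
    wt (map inr (e ++ j :: b) ++ s ++ c) by [].
rewrite (_ : _ * wt _ = W + W); last by rewrite WE /= exprS; ring.
rewrite lerD//.
  rewrite /mulx mulrA -mono_rcons (le_trans (IH _ _ _ _))// WE.
  rewrite size_rcons addSnnS cat_rcons le_eqVlt eqxx//.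
set z := map inr (e ++ b) ++ rem (inr j) s ++ c : seq idx.
have [js|/count_memPn ->] := boolP (inr j \in s); last first.
  rewrite mul0r mulr0 normr0 WE mulr_ge0 ?(ltW (wt_gt0 _ _ _))//.
  by rewrite !mulr_ge0 ?exprn_ge0// ltW.
have ps := perm_to_rem js.
have -> : W = C0 * C1 ^+ (size e + size b + size (rem (inr j) s) + size c).+2 *
   2 ^+ size b * wt (inr j :: inr j :: z).
  rewrite WE; congr (_ * _ ^+ _ * _ * _).
    by rewrite (perm_size ps) /= !(addnS, addSn).
  apply: wt_perm; apply/permP => P; have /permP/(_ P) /= Ps := ps.
  by rewrite /z !map_cat /= !count_cat /= Ps; ring.
rewrite mulrCA normrM ger0_norm//.
(* One occurrence in s is gone from z, hence the successor in [wt_double]. *)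
have cz : (count_mem (inr j) s <= (count_mem (inr j) z).+1)%N.
  have /permP/(_ (pred1 (inr j))) /= := ps; rewrite eqxx add1n => ->.
  by rewrite ltnS /z !count_cat addnCA leq_addr.
apply: le_trans (ler_wpM2l _ (IH _ _ _ _)) _ => //.
set N := (size e + _ + _ + _)%N.
rewrite mulrCA.
apply: (@le_trans _ _ (C0 * C1 ^+ N.+2 * 2 ^+ size b * ((count_mem (inr j) s)%:R * wt z))).
  apply: ler_wpM2r; first by rewrite mulr_ge0// ltW// wt_gt0.
  rewrite ler_wpM2r ?exprn_ge0// ler_wpM2l ?(ltW C00)//.
  by rewrite ler_weXn2l// leqW// leqW.
apply: ler_wpM2l.
  exact: ltW (mulr_gt0 (mulr_gt0 C00 (exprn_gt0 _ C10)) (exprn_gt0 _ (ltr0Sn _ _))).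
apply: le_trans (wt_double _ hmu _ _).
by rewrite ler_wpM2r ?(ltW (wt_gt0 _ _ _))// ler_nat.
Qed.

Hypothesis hsigma : 0 <= sigma.

(** A derivative [s] and a monomial [r] of the transform are a transform of
    the derivatives [r] of the monomial [b] times derivatives [c] of u, where
    [b] and [c] are the letters of [s] in x and in t. For its integral one
    needs a bound of this function by [decay], that is, of its products with
    the words [square_word S], and [commute_bound] gives them. The weight has
    the letters of [r] and [s], together with at most 2 n more, which cost a
    geometric factor. *)
Lemma gs_cosint u th : smooth_real u -> gs_real u -> gs_real (cosint th u).
Proof.
move=> su gu; have Su := gs_schwartz su gu.
case: gu => C0 [C1 [C00 C11 Hu]].
have C10 : 0 < C1 by rewrite (lt_le_trans ltr01).
set Q := wt_base sigma mu.
have Q1 : 1 <= Q by exact: wt_base_ge1.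
have Q0 : 0 <= Q by rewrite (le_trans _ Q1).
pose D1 := 2 * C1.
have D11 : 1 <= D1 by rewrite /D1 mulr2n mulrDl mul1r ler_wpDl// ltW.
have D10 : 0 <= D1 by rewrite (le_trans _ D11).
pose M0 := decay_mass R n + 1.
have M00 : 0 < M0 by rewrite ltr_wpDl// decay_mass_ge0.
exists (2 ^+ n * C0 * D1 ^+ (2 * n) * Q ^+ (2 * n * (2 * n)) * M0), (D1 * Q ^+ (2 * n)).
split; first 2 last.
- move=> r s p.
  have [th' [E S']] := foldr_pder_cosint th s Su.
  have [th'' E'] := foldr_mulx_cosint th' r S'.
  rewrite -foldr_mulxE E E' (foldr_dualE s su).
  set c := [seq k <- s | is_t k]; set b := xpart s.
  set w := pders _ _.
  have sw : smooth_real w.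
    by apply: smooth_real_foldr; apply: smooth_real_mono; exact: smooth_real_foldr.
  set N := (size r + size s)%N.
  set z := map inr r ++ s : seq idx.
  have zN : size z = N by rewrite size_cat size_map.
  have sizes : (size b + size c = size s)%N.
    by have /perm_size := perm_parts s; rewrite size_cat size_map.
  pose B := C0 * D1 ^+ (2 * n) * Q ^+ (2 * n * (2 * n)) * (D1 * Q ^+ (2 * n)) ^+ N * wt z.
  (* The exponents of the constants are separated into a part that depends on n
     only, from the letters of [square_word S], and a power of the length N. *)
  have wB S q : `|mono (square_word S) q * w q| <= B.
    have := commute_bound C00 C11 su Hu b (square_word S) (map inr r) c q.
    move/le_trans; apply.
    have e2n := size_square_word S; set e := square_word S in e2n *.
    rewrite size_map (_ : size e + size b + size r + size c = size e + N)%N; last first.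
      by rewrite /N -sizes; ring.
    have -> : wt (map inr (e ++ b) ++ map inr r ++ c) = wt (map inr e ++ z).
      apply: wt_perm; rewrite map_cat -catA perm_cat2l /z.
      by rewrite perm_catCA perm_cat2l perm_parts.
    have bN : (size b <= size e + N)%N.
      by rewrite /N -sizes (leq_trans _ (leq_addl _ _))// (leq_trans (leq_addr (size c) _))// leq_addl.
    apply: (@le_trans _ _ (C0 * D1 ^+ (size e + N) * wt (map inr e ++ z))).
      rewrite ler_wpM2r ?(ltW (wt_gt0 _ _ _))// -mulrA ler_wpM2l ?(ltW C00)//.
      rewrite /D1 exprMn mulrC ler_wpM2r ?exprn_ge0 ?(ltW C10)//.
      by rewrite ler_weXn2l// ler1n.
    have szle : (size (map (@inr 'I_m 'I_n) e) + size z <= 2 * n + N)%N.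
      by rewrite size_map zN leq_add2r.
    apply: (@le_trans _ _ (C0 * D1 ^+ (size e + N) *
        ((Q ^+ (2 * n + N)) ^+ size (map (@inr 'I_m 'I_n) e) * wt z))).
      by rewrite ler_wpM2l ?mulr_ge0 ?exprn_ge0 ?(ltW C00)// wt_cat_le.
    rewrite size_map mulrA ler_wpM2r ?(ltW (wt_gt0 _ _ _))//.
    apply: (@le_trans _ _ (C0 * D1 ^+ (2 * n + N) * (Q ^+ (2 * n + N)) ^+ (2 * n))).
      rewrite ler_pM ?mulr_ge0 ?exprn_ge0 ?(ltW C00)//.
        by rewrite ler_wpM2l ?(ltW C00)// ler_weXn2l// leq_add2r.
      by rewrite ler_weXn2l// exprn_ege1.
    have -> : (Q ^+ (2 * n + N)) ^+ (2 * n) =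
        Q ^+ (2 * n * (2 * n)) * (Q ^+ (2 * n)) ^+ N.
      by rewrite -!exprM mulnDl (exprD Q (2 * n * (2 * n)) (N * (2 * n))) [(N * _)%N]mulnC.
    rewrite (exprD D1 (2 * n) N) (exprMn N D1) le_eqVlt; apply/orP; left; apply/eqP.
    move: (Q ^+ (2 * n * (2 * n))) ((Q ^+ (2 * n)) ^+ N) (D1 ^+ (2 * n)) (D1 ^+ N).
    by move=> q1 q2 d1 d2; ring.
  have wd := dominated_square_word wB.
  have B0 : 0 <= B by rewrite (le_trans _ (wB finset.set0 (0, 0))).
  apply: (le_trans (cosint_le th'' p (smooth_real_cont sw) wd)).
  apply: (@le_trans _ _ (2 ^+ n * B * M0)).
    apply: ler_wpM2l; first by rewrite mulr_ge0// exprn_ge0.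
    by rewrite /M0; apply: ler_wpDr.
  by rewrite /B le_eqVlt; apply/orP; left; apply/eqP; ring.
- by rewrite !mulr_gt0 ?exprn_gt0 ?(lt_le_trans _ Q1) ?(lt_le_trans _ D11).
- by rewrite -[leLHS]mulr1 ler_pM// exprn_ege1.
Qed.

Lemma gs_realD u v : smooth_real u -> smooth_real v ->
  gs_real u -> gs_real v -> gs_real (fun p => u p + v p).
Proof.
move=> su sv [C0 [C1 [C00 C11 Hu]]] [D0 [D1 [D00 D11 Hv]]].
exists (C0 + D0), (Num.max C1 D1); split.
- by rewrite addr_gt0.
- by rewrite le_max C11.
move=> r s p; rewrite foldr_pderD// mulrDr (le_trans (ler_normD _ _))// !mulrDl lerD//.
  rewrite (le_trans (Hu _ _ _))// ler_wpM2r ?(ltW (wt_gt0 _ _ _))//.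
  rewrite ler_wpM2l ?(ltW C00)// lerXn2r ?nnegrE ?le_max ?lexx//.
    by rewrite (le_trans _ C11).
  by rewrite (le_trans _ C11).
rewrite (le_trans (Hv _ _ _))// ler_wpM2r ?(ltW (wt_gt0 _ _ _))//.
rewrite ler_wpM2l ?(ltW D00)// lerXn2r ?nnegrE ?le_max ?lexx ?orbT//.
  by rewrite (le_trans _ D11).
by rewrite (le_trans _ D11) ?orbT.
Qed.

Lemma gs_realZ a u : smooth_real u -> gs_real u -> gs_real (fun p => a * u p).
Proof.
move=> su [C0 [C1 [C00 C11 Hu]]]; exists ((`|a| + 1) * C0), C1; split => //.
  by rewrite mulr_gt0// ltr_wpDl.
move=> r s p; rewrite foldr_pderZ// mulrCA normrM -!mulrA ler_pM//.
  by rewrite lerDl.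
by rewrite mulrA; exact: Hu.
Qed.

End estimate.

(** * Gaussians and their cosine transforms *)

Section gaussian.
Context (R : realType).
Notation lebesgue := (@lebesgue_measure R).

Definition gauss n (a : R) (x y : 'rV[R]_n) : R :=
  expR (- (a * dotp (y - x) (y - x))).

Definition gauss_mass (a : R) : R := Num.sqrt (pi / a).

Lemma integral_gauss1 (a x : R) : 0 < a ->
  (\int[lebesgue]_y (expR (- (a * (y - x) ^+ 2)))%:E = (gauss_mass a)%:E)%E.
Proof.
move=> a0; pose s : R := (Num.sqrt (2 * a))^-1.
have s0 : s != 0 by rewrite invr_eq0 gt_eqF// sqrtr_gt0 mulr_gt0.
have s2 : s ^+ 2 *+ 2 = a^-1.
  rewrite exprVn sqr_sqrtr ?mulr_ge0 ?(ltW a0)// -mulr_natr.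
  by field; rewrite gt_eqF.
have E := integral_normal_pdf x s.
rewrite normal_pdfE// in E.
have peakE : normal_peak s = (gauss_mass a)^-1.
  by rewrite /normal_peak /gauss_mass -mulrnAl s2 mulrC.
have g0 : gauss_mass a != 0 by rewrite gt_eqF// sqrtr_gt0 divr_gt0// pi_gt0.
have EF (y : R) : expR (- (a * (y - x) ^+ 2)) = gauss_mass a *
    (normal_peak s * normal_fun x s y).
  rewrite peakE (mulVKf g0) /normal_fun; congr expR.
  by rewrite s2 invrK mulrC mulNr.
under eq_integral => y _ do rewrite EF EFinM.
rewrite ge0_integralZl//; first by rewrite E mule1.
- apply/measurable_EFinP; apply: measurable_funM => //.
  exact: measurable_normal_fun.
- by move=> y _; rewrite lee_fin mulr_ge0 ?expR_ge0// normal_peak_ge0.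
- by rewrite lee_fin sqrtr_ge0.
Qed.

Lemma continuous_gauss n (a : R) (x : 'rV[R]_n) : continuous (gauss a x).
Proof.
have cd : continuous (fun y : 'rV[R]_n => dotp (y - x) (y - x)).
  apply: continuous_big => [p|j _ y]; first exact: add_continuous.
  have c : (fun y : 'rV[R]_n => (y - x) ord0 j) @ y --> (y - x) ord0 j.
    rewrite (_ : (fun y : 'rV[R]_n => _) = (fun y : 'rV[R]_n => y ord0 j - x ord0 j)).
      rewrite !mxE; apply: (@cvgB R R^o 'rV[R]_n (nbhs y)); last exact: cvg_cst.
      exact: continuous_coord.
    by apply/funext => z; rewrite !mxE.
  exact: (@cvgM R 'rV[R]_n (nbhs y) _ _ _ _ _ c c).
move=> y.
apply: (@continuous_comp _ _ _ (fun y : 'rV[R]_n => - (a * dotp (y - x) (y - x))) expR);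
  last exact: continuous_expR.
apply: (@cvgN R R^o 'rV[R]_n (nbhs y)).
by apply: (@cvgM R 'rV[R]_n (nbhs y)); [exact: cvg_cst|exact: cd].
Qed.

Lemma gauss_ge0 n (a : R) (x y : 'rV[R]_n) : 0 <= gauss a x y.
Proof. exact: expR_ge0. Qed.

Lemma sub_entry n (x y : 'rV[R]_n) j : (y - x) ord0 j = y ord0 j - x ord0 j.
Proof. by rewrite mxE [(- x) _ _]mxE. Qed.

Lemma gauss_cons n (a : R) (x : 'rV[R]_n.+1) (t : R) (v : 'rV[R]_n) :
  gauss a x (rV_cons (t, v)) = expR (- (a * (t - x ord0 ord0) ^+ 2)) *
    gauss a (\row_j x ord0 (lift ord0 j)) v.
Proof.
have -> : gauss a x (rV_cons (t, v)) = expR (- (a * ((t - x ord0 ord0) ^+ 2 +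
    dotp (v - \row_j x ord0 (lift ord0 j)) (v - \row_j x ord0 (lift ord0 j))))).
  congr (expR (- (a * _))); rewrite [LHS]big_ord_recl; congr (_ + _).
    by rewrite sub_entry rV_consl expr2.
  apply: eq_bigr => j _.
  by rewrite !sub_entry rV_consr mxE.
by rewrite mulrDr opprD expRD.
Qed.

Lemma integral_gauss n (a : R) (x : 'rV[R]_n) : 0 < a ->
  (\int[leb R n]_y (gauss a x y)%:E = (gauss_mass a ^+ n)%:E)%E.
Proof.
move=> a0; have mg k (z : 'rV[R]_k) : measurable_fun setT (fun y => (gauss a z y)%:E).
  by apply/measurable_EFinP; exact: continuous_measurable_rV (@continuous_gauss _ a z).
elim: n x => [|n IH] x.
  by rewrite integral_leb0// /gauss /dotp big_ord0 mulr0 oppr0 expR0 expr0.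
rewrite ge0_integral_lebS//; last by move=> y; rewrite lee_fin gauss_ge0.
have E (t : R) : (\int[leb R n]_v (gauss a x (rV_cons (t, v)))%:E =
    (expR (- (a * (t - x ord0 ord0) ^+ 2)))%:E * (gauss_mass a ^+ n)%:E)%E.
  under eq_integral => v _ do rewrite gauss_cons EFinM.
  rewrite -(IH (\row_j x ord0 (lift ord0 j))) ge0_integralZl//.
  - exact: mg.
  - by move=> v _; rewrite lee_fin gauss_ge0.
under eq_integral => t _ do rewrite E.
rewrite /= ge0_integralZr//.
- by rewrite integral_gauss1// exprS EFinM.
- apply/measurable_EFinP; apply: continuous_measurable_fun => t.
  apply: (@continuous_comp _ _ _ (fun t : R => - (a * (t - x ord0 ord0) ^+ 2)) expR);
    last exact: continuous_expR.
  apply: (@cvgN R R^o R (nbhs t)); apply: (@cvgM R R (nbhs t)); first exact: cvg_cst.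
  apply: (@continuous_comp _ _ _ (fun t : R => t - x ord0 ord0) (fun t : R => t ^+ 2)).
    by apply: (@cvgB R R^o R (nbhs t)); [exact: cvg_id|exact: cvg_cst].
  exact: exprn_continuous.
- by rewrite lee_fin exprn_ge0// sqrtr_ge0.
Qed.

(** The factor 2 pi per dimension in the inversion formula: [(4 * a)^-1] is the
    exponent of the transform of a Gaussian with exponent [a]. *)
Lemma gauss_mass_dual (a : R) : 0 < a ->
  gauss_mass a * gauss_mass (4 * a)^-1 = 2 * pi.
Proof.
move=> a0; rewrite /gauss_mass -sqrtrM ?divr_ge0 ?pi_ge0 ?(ltW a0)// invrK.
rewrite (_ : pi / a * (pi * (4 * a)) = (2 * pi) ^+ 2); last by field; rewrite gt_eqF.
by rewrite sqrtr_sqr ger0_norm// mulr_ge0// pi_ge0.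
Qed.

Lemma sq_dotp n (x : 'rV[R]_n) : dotp x x = \sum_(j < n) x ord0 j ^+ 2.
Proof. by apply: eq_bigr => j _; rewrite expr2. Qed.

(** One half of the exponent is left after -(y - x)^2 <= x^2 - y^2 / 2, and
    exp (b y^2) >= 1 + b y^2 dominates 1 + y^2 up to the factor 1 + 1 / b. *)
Lemma gauss_decay n (a : R) (x : 'rV[R]_n) : 0 < a ->
  exists M, forall y, gauss a x y <= M * decay y.
Proof.
move=> a0; pose b := a / 2; have b0 : 0 < b by rewrite divr_gt0.
(* (1 + 1 / b) (1 + b s) = 1 + s + b s + 1 / b, which is at least 1 + s. *)
pose K := 1 + b^-1; have K1 : 1 <= K by rewrite /K lerDl invr_ge0 ltW.
have K0 : 0 <= K by rewrite (le_trans _ K1).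
exists (expR (a * dotp x x) * K ^+ n) => y.
have split_sq : - (a * dotp (y - x) (y - x)) <= a * dotp x x + \sum_(j < n) - (b * y ord0 j ^+ 2).
  rewrite !sq_dotp !mulr_sumr -sumrN -big_split /=.
  apply: ler_sum => j _; rewrite sub_entry /b.
  set s := y _ _; set t := x _ _.
  have : 0 <= a * (s / 2 - t) ^+ 2 *+ 2 by rewrite mulrn_wge0// mulr_ge0 ?sqr_ge0// ltW.
  by rewrite -mulr_natr; lra.
rewrite /gauss (@le_trans _ _ (expR (a * dotp x x + \sum_(j < n) - (b * y ord0 j ^+ 2))))//.
  by rewrite ler_expR.
rewrite expRD -mulrA ler_wpM2l ?expR_ge0// expR_sum /decay.
have -> : K ^+ n = \prod_(j < n) K by rewrite prodr_const card_ord.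
rewrite -big_split /=; apply: ler_prod => j _; rewrite expR_ge0 /=.
rewrite expRN -[leLHS]div1r ler_pdivrMr ?expR_gt0// mulrAC ler_pdivlMr ?onesqr_gt0// mul1r.
set t := y _ _ ^+ 2; have t0 : 0 <= t by rewrite sqr_ge0.
apply: (@le_trans _ _ (K * (1 + b * t))).
  have -> : K * (1 + b * t) = 1 + b * t + b^-1 + t by rewrite /K; field; rewrite gt_eqF.
  have : 0 <= b^-1 by rewrite invr_ge0 ltW.
  have : 0 <= b * t by rewrite mulr_ge0// ltW.
  lra.
by rewrite ler_wpM2l// expR_ge1Dx.
Qed.

End gaussian.

Section gauss_transform.
Context (R : realType).

Lemma is_derive_idR (s : R) : is_derive s (1 : R) (fun h : R => h) (1 : R).
Proof. exact: (@is_derive_id R R^o s 1). Qed.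

Lemma is_derive_expR_comp (g : R -> R) (s d : R) : is_derive s (1 : R) g d ->
  is_derive s (1 : R) (fun h => expR (g h)) (expR (g s) * d).
Proof. by move=> dg; exact: (@is_derive1_comp R expR g s _ _ (is_derive_expR _) dg). Qed.

Lemma dotpBr n (xi y x : 'rV[R]_n) : dotp xi (y - x) = dotp xi y - dotp xi x.
Proof.
by rewrite /dotp -sumrB; apply: eq_bigr => j _; rewrite sub_entry mulrBr.
Qed.

Lemma dotpZl n (s : R) (xi y : 'rV[R]_n) : dotp (s *: xi) y = s * dotp xi y.
Proof. by rewrite /dotp mulr_sumr; apply: eq_bigr => j _; rewrite mxE mulrA. Qed.

Lemma line_entry n (h : R) (z : 'rV[R]_n) j :
  (h *: delta_mx ord0 j + z) ord0 j = h + z ord0 j.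
Proof. by rewrite !mxE !eqxx mulr1. Qed.

Lemma is_derive_gauss m n (a : R) (x : 'rV[R]_n) (j : 'I_n) (p : 'rV[R]_m * 'rV[R]_n) :
  is_derive p (dir R (inr j)) (fun q : 'rV[R]_m * 'rV[R]_n => gauss a x q.2)
    (gauss a x p.2 * (- (2 * a) * (p.2 ord0 j - x ord0 j))).
Proof.
set u := fun q : _ * _ => _; set z := p.2 - x.
have [L1 L2] := derive_line u p (dir R (inr j)) 0.
rewrite scale0r add0r in L1 L2.
pose g (h : R) := - a * (h * h) + (- (2 * a) * z ord0 j * h + - a * dotp z z).
have E : (fun h : R => u (h *: dir R (inr j) + p)) = fun h => expR (g h).
  apply/funext => h; rewrite /u /gauss /g; congr expR.
  rewrite [_ - x](_ : _ = h *: delta_mx ord0 j + z); last by rewrite /z addrA.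
  rewrite dotp_line [dotp z _]dotpC dotp_line line_entry.
  by ring.
have D : is_derive (0 : R) (1 : R) (fun h => expR (g h))
    (expR (g 0) * (- a * (0 * 1 + 0 * 1) + (- (2 * a) * z ord0 j * 1 + 0))).
  apply: is_derive_expR_comp.
  apply: (@is_derive_add R R^o (fun h => - a * (h * h))
    (fun h => - (2 * a) * z ord0 j * h + - a * dotp z z)).
    apply: (@is_derive_scale R R^o).
    exact: (@is_derive_mul R R^o _ _ _ _ _ _ (is_derive_idR 0) (is_derive_idR 0)).
case: D => D1 D2; rewrite E in L1 L2; split; first exact: (iffLR L2 D1).
apply: (etrans (esym L1)); apply: (etrans D2).
rewrite /g /gauss -/z -sub_entry -/z; congr (expR _ * _); ring.
Qed.

(** One half of the exponent absorbs the linear factor; the other half is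
    again a Gaussian. *)
Lemma gauss_moment_decay n (a : R) (x : 'rV[R]_n) : 0 < a ->
  exists M : R, forall (j : 'I_n) (y : 'rV[R]_n), (1 + `|y ord0 j - x ord0 j|) * gauss a x y <= M * decay y.
Proof.
move=> a0; have a20 : 0 < a / 2 by rewrite divr_gt0.
have [M HM] := gauss_decay x a20.
exists ((2 + 2 * (a / 2)^-1) * M) => j y; rewrite -mulrA.
have C0 : 0 <= 2 + 2 * (a / 2)^-1 by rewrite addr_ge0// mulr_ge0// invr_ge0 ltW.
apply: le_trans (ler_wpM2l C0 (HM y)).
rewrite /gauss; set q := dotp _ _; set t := `|_|.
have tq : t ^+ 2 <= q.
  rewrite /t /q sq_dotp (bigD1 j)//= sub_entry real_normK ?num_real// lerDl.
  by apply: sumr_ge0 => i _; exact: sqr_ge0.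
rewrite (_ : - (a * q) = - (a / 2 * q) - (a / 2 * q)); last by field.
rewrite expRD mulrA ler_wpM2r ?expR_ge0//.
rewrite expRN ler_pdivrMr ?expR_gt0//.
apply: (@le_trans _ _ ((2 + 2 * (a / 2)^-1) * (1 + a / 2 * q))); last first.
  by rewrite ler_wpM2l// expR_ge1Dx.
have -> : (2 + 2 * (a / 2)^-1) * (1 + a / 2 * q) =
    2 + a * q + 2 * (a / 2)^-1 + 2 * q by field; rewrite gt_eqF.
have q0 : 0 <= q by rewrite (le_trans _ tq)// sqr_ge0.
have := mulr_ge0 (ltW a0) q0.
have : 0 <= (a / 2)^-1 by rewrite invr_ge0 ltW.
have := sqr_ge0 (t - 1).
by rewrite !expr2 in tq *; nra.
Qed.

Lemma Rintegral_sum d (T : measurableType d) (mu : {measure set T -> \bar R})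
    (I : eqType) (r : seq I) (F : I -> T -> R) :
  (forall i, mu.-integrable setT (EFin \o F i)) ->
  mu.-integrable setT (EFin \o (fun x => \sum_(i <- r) F i x)) /\
  \int[mu]_x (\sum_(i <- r) F i x) = \sum_(i <- r) \int[mu]_x F i x.
Proof.
move=> iF; elim: r => [|i r [IH1 IH2]].
  rewrite big_nil; have -> : (fun x => \sum_(i <- [::]) F i x) = cst 0.
    by apply/funext => x; rewrite big_nil.
  split; last by rewrite /Rintegral integral0.
  exact: integrable0.
have -> : (fun x => \sum_(i <- i :: r) F i x) = (fun x => F i x + \sum_(i <- r) F i x).
  by apply/funext => x; rewrite big_cons.
split; last by rewrite big_cons -IH2 RintegralD.
have := integrableD measurableT (iF i) IH1.
by rewrite (_ : (_ \+ _)%E = EFin \o (fun x => F i x + \sum_(i <- r) F i x)).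
Qed.

(** Let F s be the transform on the ray [s *: xi]. Integration by parts, with
    the gradient - 2 a (y - x) of the exponent, gives the differential equation
    2 a F' = - s |xi|^2 F. Hence F s exp (s^2 |xi|^2 / (4 a)) is constant, and
    at s = 0 the function F is the mass of the Gaussian times cos th. *)
Lemma gauss_transform n (a : R) (x xi : 'rV[R]_n) (th : R) : 0 < a ->
  \int[leb R n]_y (gauss a x y * cos (dotp xi (y - x) + th)) =
  gauss_mass a ^+ n * gauss (4 * a)^-1 0 xi * cos th.
Proof.
move=> a0; have [M HM] := gauss_moment_decay x a0.
pose D (y : 'rV[R]_n) := dotp xi (y - x).
pose F (s : R) := \int[leb R n]_y (gauss a x y * cos (s * D y + th)).
pose F1 (s : R) := \int[leb R n]_y (gauss a x y * (D y * cos (s * D y + th + pi / 2))).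
have cg := @continuous_gauss R n a x.
(* The Gaussian as a function on R^0 x R^n, in the domain of the cosine
   transform. *)
pose u (q : 'rV[R]_0 * 'rV[R]_n) := gauss a x q.2.
pose du j (q : 'rV[R]_0 * 'rV[R]_n) := gauss a x q.2 * (- (2 * a) * (q.2 ord0 j - x ord0 j)).
have cu : continuous u.
  move=> q; apply: (@continuous_comp _ _ _ (fun q : 'rV[R]_0 * 'rV[R]_n => q.2) (gauss a x)).
    exact: cvg_snd.
  exact: cg.
have Edu j : pder (inr j) u = du j.
  by apply/funext => q; have [_] := @is_derive_gauss 0 n a x j q.
have cdu j : continuous (du j).
  move=> q; apply: (@cvgM R _ (nbhs q)); first exact: cu.
  apply: (@cvgM R _ (nbhs q)); first exact: cvg_cst.
  apply: (@cvgB R R^o _ (nbhs q)); last exact: cvg_cst.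
  apply: (@continuous_comp _ _ _ (fun q : 'rV[R]_0 * 'rV[R]_n => q.2) (fun y => y ord0 j)).
    exact: cvg_snd.
  exact: continuous_coord.
pose M' := (2 * a + 1) * `|M|.
have a1 : 0 <= 2 * a by rewrite mulr_ge0// ltW.
have du_le j : dominated M' (du j).
  move=> q; rewrite /du /M' normrM ger0_norm ?gauss_ge0// normrM normrN (ger0_norm a1).
  apply: (@le_trans _ _ ((2 * a) * ((1 + `|q.2 ord0 j - x ord0 j|) * gauss a x q.2))).
    by rewrite mulrCA ler_wpM2l// mulrC ler_wpM2r ?gauss_ge0// lerDr.
  apply: (@le_trans _ _ ((2 * a) * (`|M| * decay q.2))).
    rewrite ler_wpM2l// (le_trans (HM j q.2))// ler_wpM2r ?ler_norm//.
    exact: ltW (decay_gt0 _).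
  rewrite -[leRHS]mulrA ler_wpM2r ?lerDl// mulr_ge0//.
  exact: ltW (decay_gt0 _).
have [Mg Hg] := gauss_decay x a0.
have u_le : dominated Mg u.
  by move=> q; rewrite /u ger0_norm ?gauss_ge0//; exact: Hg.
pose B j (s : R) := \int[leb R n]_y ((y ord0 j - x ord0 j) *
  (gauss a x y * cos (s * D y + th + pi / 2))).
have phase (s c : R) (y : 'rV[R]_n) :
    dotp (s *: xi) y + (th - s * dotp xi x + c) = s * D y + th + c.
  by rewrite dotpZl /D dotpBr; ring.
have FE (s : R) : F s = cosint (th - s * dotp xi x) u (0, s *: xi).
  apply: eq_Rintegral => y _; rewrite /u /=; congr (_ * cos _).
  by have := phase s 0 y; rewrite !addr0.
have iB j (s : R) : (leb R n).-integrable setT (EFin \o (fun y : 'rV[R]_n => (y ord0 j - x ord0 j) *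
    (gauss a x y * cos (s * D y + th + pi / 2)))).
  have /(integrableZl measurableT (- (2 * a))^-1) :=
    integrable_cosint (th - s * dotp xi x + pi / 2) (0, s *: xi) (cdu j) (du_le j).
  apply: eq_integrable => // y _ /=; rewrite -EFinM; congr EFin.
  rewrite phase /du /=; field; rewrite gt_eqF//.
(* Integration by parts in one coordinate; [odeF] sums these over j. *)
have ode j (s : R) : s * xi ord0 j * F s = - (2 * a) * B j s.
  have := @cosint_parts R 0 n j u (th - s * dotp xi x) (0, s *: xi) (Num.max M' Mg) cu.
  rewrite Edu -FE /= mxE => ->.
  - rewrite /B -RintegralZl//; apply: eq_Rintegral => y _.
    by rewrite phase /du /=; ring.
  - move=> q; rewrite (le_trans (u_le q))// ler_wpM2r ?(ltW (decay_gt0 _))//.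
    by rewrite le_max lexx orbT.
  - by move=> q; have [] := @is_derive_gauss 0 n a x j q.
  - exact: cdu.
  - move=> q; rewrite (le_trans (du_le j q))// ler_wpM2r ?(ltW (decay_gt0 _))//.
    by rewrite le_max lexx.
have F1E (s : R) : F1 s = \sum_(j < n) xi ord0 j * B j s.
  have iB' j : (leb R n).-integrable setT (EFin \o (fun y : 'rV[R]_n => xi ord0 j *
      ((y ord0 j - x ord0 j) * (gauss a x y * cos (s * D y + th + pi / 2))))).
    have := integrableZl measurableT (xi ord0 j) (iB j s).
    by apply: eq_integrable => // y _ /=; rewrite EFinM.
  have [_ S] := Rintegral_sum (index_enum 'I_n) iB'.
  transitivity (\sum_(j < n) \int[leb R n]_y (xi ord0 j *
      ((y ord0 j - x ord0 j) * (gauss a x y * cos (s * D y + th + pi / 2)))));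
    last by apply: eq_bigr => j _; rewrite RintegralZl.
  rewrite -S; apply: eq_Rintegral => y _.
  rewrite mulrCA {1}/D /dotp mulr_suml; apply: eq_bigr => j _.
  by rewrite sub_entry; ring.
have odeF (s : R) : s * dotp xi xi * F s = - (2 * a) * F1 s.
  rewrite F1E mulr_sumr /dotp mulr_sumr mulr_suml; apply: eq_bigr => j _.
  by rewrite [RHS]mulrCA -ode; ring.
have dF (s : R) : is_derive (s : R) (1 : R) F (F1 s).
  pose Fh (h : R) (y : 'rV[R]_n) := gauss a x y * cos (h * D y + (s * D y + th)).
  pose dFh (h : R) (y : 'rV[R]_n) :=
    gauss a x y * (D y * cos (h * D y + (s * D y + th) + pi / 2)).
  have FhE (h : R) : Fh h = fun y => u (0, y) *
      cos (dotp ((h + s) *: xi) y + (th - (h + s) * dotp xi x)).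
    apply/funext => y; have := phase (h + s) 0 y; rewrite !addr0 => ->.
    by rewrite /Fh mulrDl addrA.
  have [D1 D2] : is_derive (0 : R) (1 : R) (fun h => \int[leb R n]_y Fh h y)
      (\int[leb R n]_y dFh 0 y).
    apply: (@is_derive_Rintegral_decay _ _ Fh dFh (\sum_(j < n) `|xi ord0 j| * M)).
    - move=> h; rewrite FhE.
      exact: (integrable_cosint (th - (h + s) * dotp xi x) (0, (h + s) *: xi) cu u_le).
    - by move=> h y; apply: (@is_derive_scale R R^o); exact: is_derive_cos_affine.
    - move=> h y; rewrite /dFh mulrA normrM (le_trans (ler_piMr _ (cos_max _)))//.
      rewrite normrM ger0_norm ?gauss_ge0// /D /dotp mulr_suml.
      rewrite (le_trans (ler_wpM2l (gauss_ge0 _ _ _) (ler_norm_sum _ _ _)))// mulr_sumr.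
      apply: ler_sum => j _; rewrite normrM mulrCA -mulrA ler_wpM2l// sub_entry.
      apply: le_trans (HM j y); rewrite mulrC ler_wpM2r ?gauss_ge0//.
      by rewrite lerDr.
  have FT : (fun h => \int[leb R n]_y Fh h y) = fun h => F (h + s).
    apply/funext => h; apply: eq_Rintegral => y _.
    by rewrite /Fh mulrDl addrA.
  have F10 : \int[leb R n]_y dFh 0 y = F1 s.
    by apply: eq_Rintegral => y _; rewrite /dFh mul0r add0r.
  rewrite FT in D1 D2; rewrite F10 in D2.
  have [T1 T2] := @derive_translate R R^o F 1 s 0.
  rewrite add0r in T1 T2; split; first exact: (iffLR T2 D1).
  exact: etrans (esym T1) D2.
pose c := dotp xi xi / (4 * a).
pose G (s : R) := F s * expR (c * (s * s)).
have dG (s : R) : is_derive (s : R) (1 : R) G 0.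
  have d2 : is_derive s (1 : R) (fun s : R => c * (s * s)) (c * (s * 1 + s * 1)).
    exact: (@is_derive_scale R R^o _ _ _ _ c
      (@is_derive_mul R R^o (fun s : R => s) (fun s : R => s) s 1 1 1
        (is_derive_idR s) (is_derive_idR s))).
  have := @is_derive_mul R R^o _ _ _ _ _ _ (dF s) (is_derive_expR_comp d2).
  rewrite (_ : F s * _ + _ = 0)//.
  have F1s : F1 s = - (s * dotp xi xi * F s) / (2 * a).
    by rewrite odeF; field; rewrite gt_eqF.
  by rewrite F1s /c; field; rewrite gt_eqF.
have := @is_derive_0_is_cst R G 1 0 dG.
rewrite /G !mulr1 !mulr0 expR0 mulr1 => FF.
have -> : \int[leb R n]_y (gauss a x y * cos (dotp xi (y - x) + th)) = F 1.
  by apply: eq_Rintegral => y _; rewrite mul1r.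
have F0 : F 0 = gauss_mass a ^+ n * cos th.
  have ig : (leb R n).-integrable setT (EFin \o gauss a x).
    apply: (@dominated_integrable_rV _ _ _ Mg); first exact: continuous_measurable_rV.
    by move=> y; rewrite ger0_norm ?gauss_ge0//; exact: Hg.
  rewrite [RHS](_ : _ = (\int[leb R n]_y gauss a x y) * cos th); last first.
    by rewrite /Rintegral integral_gauss.
  rewrite -RintegralZr//; apply: eq_Rintegral => y _.
  by rewrite mul0r add0r.
rewrite mulrAC -F0 -FF -mulrA /gauss -expRD subr0 /c.
by rewrite [_^-1 * _]mulrC subrr expR0 mulr1.
Qed.

End gauss_transform.

(** * Fubini with a bounded kernel *)

Section fubini.
Context (R : realType) (n : nat).
Local Notation mu := (leb R n).
Local Notation E := 'rV[R]_n.

Lemma measurable_dotp2 : measurable_fun setT (fun z : E * E => dotp z.1 z.2).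
Proof.
apply: measurable_sum => j; apply: measurable_funM.
  apply: (@measurableT_comp _ _ _ _ _ _ (fun y : E => y ord0 j : measurableTypeR R)) => //.
  exact: measurable_rV_coord.
apply: (@measurableT_comp _ _ _ _ _ _ (fun y : E => y ord0 j : measurableTypeR R)) => //.
exact: measurable_rV_coord.
Qed.

Lemma measurable_cosdot2 (x : E) (c : R) :
  measurable_fun setT (fun z : E * E => cos (dotp z.1 (z.2 - x) + c)).
Proof.
apply: measurableT_comp; first exact: continuous_measurable_fun (@continuous_cos R).
rewrite (_ : (fun z : E * E => _) = fun z => (dotp z.1 z.2 - dotp x z.1) + c); last first.
  by apply/funext => z; rewrite dotpBr [dotp z.1 x]dotpC.
apply: measurable_funD; last exact: measurable_cst.
apply: measurable_funB; first exact: measurable_dotp2.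
apply: (@measurableT_comp _ _ _ _ _ _ (dotp x)) => //.
exact: continuous_measurable_rV (@continuous_dotp _ _ x).
Qed.

Lemma RintegralE (g : E -> R) : mu.-integrable setT (EFin \o g) ->
  (\int[mu]_x (g x)%:E = (\int[mu]_x g x)%:E)%E.
Proof. by move=> ig; rewrite /Rintegral fineK// (integrable_fin_num measurableT ig). Qed.

Lemma integrable_boundM (h w : E -> R) : mu.-integrable setT (EFin \o h) ->
  measurable_fun setT w -> (forall y, `|w y| <= 1) ->
  mu.-integrable setT (EFin \o (fun y => h y * w y)).
Proof.
move=> ih mw w1; apply: (le_integrable _ _ _ ih) => //.
  apply/measurable_EFinP; apply: measurable_funM => //.
  by apply/measurable_EFinP; exact: measurable_int ih.
by move=> y _ /=; rewrite lee_fin normrM ler_piMr.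
Qed.

Lemma Fubini_bounded (k h : E -> R) (phi : E * E -> R) :
  mu.-integrable setT (EFin \o k) -> mu.-integrable setT (EFin \o h) ->
  measurable_fun setT phi -> (forall z, `|phi z| <= 1) ->
  mu.-integrable setT (EFin \o (fun xi => k xi * \int[mu]_y (h y * phi (xi, y)))) /\
  \int[mu]_xi (k xi * \int[mu]_y (h y * phi (xi, y))) =
  \int[mu]_y (h y * \int[mu]_xi (k xi * phi (xi, y))).
Proof.
move=> ik ih mphi phi1.
have mk : measurable_fun setT k by apply/measurable_EFinP; exact: measurable_int ik.
have mh : measurable_fun setT h by apply/measurable_EFinP; exact: measurable_int ih.
pose g (z : E * E) : \bar R := (`|k z.1| * `|h z.2|)%:E.
pose f (z : E * E) : \bar R := (k z.1 * h z.2 * phi z)%:E.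
have mk1 : measurable_fun setT (fun z : E * E => k z.1) by exact: measurableT_comp.
have mh2 : measurable_fun setT (fun z : E * E => h z.2) by exact: measurableT_comp.
have mg : measurable_fun setT g.
  by apply/measurable_EFinP; apply: measurable_funM; exact: measurableT_comp.
have mf : measurable_fun setT f.
  by apply/measurable_EFinP; apply: measurable_funM => //; exact: measurable_funM.
have ig : (mu \x mu)%E.-integrable setT g.
  apply/(integrable12ltyP _ _ mg).
  have inner xi : (\int[mu]_y `|g (xi, y)| = `|k xi|%:E * (\int[mu]_y `|h y|)%:E)%E.
    rewrite -RintegralE; last exact: integrable_norm ih.
    rewrite -ge0_integralZl//.
    - by apply: eq_integral => y _; rewrite /g /= ger0_norm// mulr_ge0.
    - by apply/measurable_EFinP; exact: measurableT_comp.
  under eq_integral => xi _ do rewrite inner.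
  rewrite ge0_integralZr//.
  - by rewrite RintegralE ?ltry//; exact: integrable_norm ik.
  - by apply/measurable_EFinP; exact: measurableT_comp.
  - by rewrite lee_fin Rintegral_ge0.
have ifz : (mu \x mu)%E.-integrable setT f.
  apply: (le_integrable _ _ _ ig) => // z _.
  by rewrite /f /g /= lee_fin normrM normrM [leRHS]ger0_norm ?mulr_ge0// ler_piMr// mulr_ge0.
have s1 xi : mu.-integrable setT (EFin \o (fun y => h y * phi (xi, y))).
  apply: integrable_boundM => //.
  exact: measurableT_comp mphi (pair1_measurable xi).
have s2 y : mu.-integrable setT (EFin \o (fun xi => k xi * phi (xi, y))).
  apply: integrable_boundM => //.
  exact: measurableT_comp mphi (pair2_measurable y).
have FE xi : (\int[mu]_y f (xi, y) = (k xi * \int[mu]_y (h y * phi (xi, y)))%:E)%E.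
  rewrite -RintegralZl// -RintegralE; last first.
    have := integrableZl measurableT (k xi) (s1 xi).
    by apply: eq_integrable => // y _ /=; rewrite EFinM.
  by apply: eq_integral => y _; rewrite /f /= mulrA.
have GE y : (\int[mu]_xi f (xi, y) = (h y * \int[mu]_xi (k xi * phi (xi, y)))%:E)%E.
  rewrite -RintegralZl// -RintegralE; last first.
    have := integrableZl measurableT (h y) (s2 y).
    by apply: eq_integrable => // xi _ /=; rewrite EFinM.
  by apply: eq_integral => xi _; rewrite /f /= mulrCA mulrA.
split.
  by have := integrable_fubini_F ifz; apply: eq_integrable => // xi _; exact: FE.
have := Fubini ifz; rewrite (eq_integral _ _ (fun xi _ => FE xi)).
by rewrite [X in _ = X](eq_integral _ _ (fun y _ => GE y)) => /(congr1 fine).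
Qed.

End fubini.

(** * Continuous functions orthogonal to all Gaussians *)

Section vanish.
Context (R : realType) (n : nat).
Local Notation mu := (leb R n).
Local Notation E := 'rV[R]_n.

Lemma leb_cube (x : E) (d : R) : 0 < d ->
  let C := [set y : E | forall j, x ord0 j <= y ord0 j < x ord0 j + d] in
  measurable C /\ mu C = (d ^+ n)%:E.
Proof.
move=> d0 C; pose A (j : 'I_n) : set (measurableTypeR R) :=
  `[x ord0 j, x ord0 j + d[%classic.
have CE : C = [set y : E | forall j, A j (y ord0 j)].
  by apply/seteqP; split=> y /= H j; have := H j; rewrite /A /= in_itv.
split.
  rewrite CE (_ : [set y : E | _] = \big[setI/setT]_(j < n)
      ((fun y : E => y ord0 j) @^-1` A j)).
    apply: bigsetI_measurable => j _; rewrite -[X in measurable X]setTI.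
    by apply: measurable_rV_coord => //; exact: measurable_itv.
  apply/seteqP; split=> y /=; rewrite -bigcap_seq /=.
    by move=> Ay j _; exact: Ay.
  by move=> Ay j; apply: Ay => /=; rewrite mem_index_enum.
rewrite CE leb_box; last by move=> j; exact: measurable_itv.
transitivity (\prod_(j < n) d%:E)%E.
  apply: eq_bigr => j _; rewrite /A lebesgue_measure_itv /= lte_fin ltrDl d0.
  by rewrite -EFinB addrAC subrr add0r.
by rewrite prodEFin prodr_const card_ord.
Qed.

(** Suppose U x > 0, so that U >= U x / 2 in a sup-norm ball of radius d. A
    cube with corner x and side e contributes at least w exp (- a n e^2) to the
    pairing with exp (- a |y - x|^2), where w > 0, the rest of the ball at
    least 0, and the complement of the ball at least - I exp (- a d^2), where
    I is the integral of |U|. If n e^2 < d^2, the pairing cannot be zero for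
    large a. *)
Lemma gauss_orthogonal_le0 (U : E -> R) (x : E) : continuous U ->
  mu.-integrable setT (EFin \o U) ->
  (forall a, 0 < a -> \int[mu]_y (U y * gauss a x y) = 0) -> U x <= 0.
Proof.
move=> cU iU H; rewrite leNgt; apply/negP => Ux.
pose c := U x / 2; have c0 : 0 < c by rewrite divr_gt0.
have /cvgrPdist_lt/(_ _ c0)/nbhs_ballP[d /= d0 dU] := cU x.
have Uc y : ball x d y -> c <= U y.
  move=> /dU /=; rewrite ltr_distlC => /andP[+ _]; rewrite {1}(splitr (U x)) addrK.
  exact: ltW.
(* With this side n e^2 < d^2 also when n = 0. *)
pose e := d / n.+1%:R; have e0 : 0 < e by rewrite divr_gt0.
have ed : e <= d by rewrite ler_pdivrMr// ler_peMr ?(ltW d0)// ler1n.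
pose C := [set y : E | forall j, x ord0 j <= y ord0 j < x ord0 j + e].
have [mC muC] : measurable C /\ mu C = (e ^+ n)%:E := leb_cube x e0.
have Cball y : C y -> ball x d y.
  move=> Cy; split=> // i j; rewrite (ord1 i) /ball /=.
  have /andP[h1 h2] := Cy j; rewrite distrC ger0_norm ?subr_ge0//.
  by rewrite ltrBlDl (lt_le_trans h2)// lerD2l.
pose near_exp := n%:R * e ^+ 2.
have Cnear y : C y -> dotp (y - x) (y - x) <= near_exp.
  move=> Cy; have -> : near_exp = \sum_(j < n) e ^+ 2.
    by rewrite sumr_const card_ord -mulr_natl.
  rewrite sq_dotp.
  apply: ler_sum => j _; rewrite sub_entry; have /andP[h1 h2] := Cy j.
  by rewrite lerXn2r ?nnegrE ?subr_ge0 ?(ltW e0)// lerBlDl ltW.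
have far y : ~ ball x d y -> d ^+ 2 <= dotp (y - x) (y - x).
  move=> yd; rewrite leNgt; apply/negP => yd2; apply: yd.
  split=> // i j; rewrite (ord1 i) /ball /= distrC -sub_entry.
  rewrite -(@ltr_pXn2r _ 2)// ?nnegrE ?(ltW d0)// real_normK ?num_real//.
  apply: le_lt_trans yd2; rewrite sq_dotp (bigD1 j)//= lerDl.
  by apply: sumr_ge0 => k _; exact: sqr_ge0.
pose kap := d ^+ 2 - near_exp.
have kap0 : 0 < kap.
  rewrite /kap /near_exp /e subr_gt0 exprMn mulrCA -[ltRHS]mulr1.
  rewrite ltr_pM2l ?exprn_gt0// exprVn ltr_pdivrMr ?exprn_gt0// mul1r.
  by rewrite -natrX ltr_nat -mulnn leq_pmulr.
pose I := \int[mu]_y `|U y|.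
have I0 : 0 <= I by apply: Rintegral_ge0.
pose w := c * e ^+ n.
have w0 : 0 < w by rewrite mulr_gt0// exprn_gt0.
have key a : 0 < a -> w * (1 + a * kap) <= I.
  move=> a0.
  have ptw y : c * expR (- (a * near_exp)) * \1_C y - expR (- (a * d ^+ 2)) * `|U y| <=
      U y * gauss a x y.
    have g0 := gauss_ge0 a x y.
    have r0 : 0 <= expR (- (a * d ^+ 2)) * `|U y| by rewrite mulr_ge0// expR_ge0.
    have [Cy|nCy] := pselect (C y).
      rewrite indicE mem_set// mulr1.
      apply: (@le_trans _ _ (c * expR (- (a * near_exp)))); first by rewrite gerBl.
      rewrite ler_pM ?(ltW c0) ?expR_ge0 ?Uc//; first exact: Cball.
      by rewrite ler_expR lerN2 ler_wpM2l ?(ltW a0)// Cnear.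
    rewrite indicE memNset// mulr0 add0r.
    have [yd|nyd] := pselect (ball x d y).
      by rewrite (@le_trans _ _ 0)// ?oppr_le0// mulr_ge0// (le_trans (ltW c0))// Uc.
    rewrite lerNl -mulNr mulrC.
    apply: (@le_trans _ _ (gauss a x y * `|U y|)).
      by rewrite ler_wpM2l// -[leRHS]normrN ler_norm.
    rewrite ler_wpM2r// ler_expR lerN2 ler_wpM2l ?(ltW a0)//; exact: far.
  have ig : mu.-integrable setT (EFin \o (fun y => U y * gauss a x y)).
    apply: integrable_boundM => //; first exact: continuous_measurable_rV (@continuous_gauss _ _ a x).
    move=> y; rewrite ger0_norm ?gauss_ge0// -[leRHS]expR0 ler_expR oppr_le0 mulr_ge0 ?(ltW a0)//.
    by rewrite sq_dotp sumr_ge0// => j _; exact: sqr_ge0.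
  have iU' : mu.-integrable setT (EFin \o (fun y => `|U y|)) by exact: integrable_norm iU.
  have iC : mu.-integrable setT (EFin \o \1_C).
    apply/integrableP; split; first by apply/measurable_EFinP; exact: measurable_indic.
    rewrite (eq_integral (EFin \o \1_C)); last first.
      by move=> y _; rewrite /= ger0_norm// indicE.
    rewrite integral_indic// setIT.
    by have := ltry (e ^+ n); rewrite -muC.
  have i1 : mu.-integrable setT (EFin \o (fun y => c * expR (- (a * near_exp)) * \1_C y)).
    have := integrableZl measurableT (c * expR (- (a * near_exp))) iC.
    by apply: eq_integrable => // y _ /=; rewrite EFinM.
  have i2 : mu.-integrable setT (EFin \o (fun y => expR (- (a * d ^+ 2)) * `|U y|)).
    have := integrableZl measurableT (expR (- (a * d ^+ 2))) iU'.
    by apply: eq_integrable => // y _ /=; rewrite EFinM.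
  have i12 : mu.-integrable setT (EFin \o (fun y =>
      c * expR (- (a * near_exp)) * \1_C y - expR (- (a * d ^+ 2)) * `|U y|)).
    have := integrableB measurableT i1 i2.
    by apply: eq_integrable.
  have := le_Rintegral measurableT i12 ig (fun y _ => ptw y).
  rewrite H// RintegralB// !RintegralZl//.
  have -> : \int[mu]_y \1_C y = e ^+ n.
    rewrite /Rintegral integral_indic// setIT.
    by rewrite -[RHS]/(fine (e ^+ n)%:E) -muC.
  rewrite subr_le0 -/I mulrAC -/w => le1.
  have : w * expR (a * kap) <= I.
    rewrite -(ler_pM2r (expR_gt0 (- (a * d ^+ 2)))) -mulrA -expRD.
    rewrite (_ : a * kap + - (a * d ^+ 2) = - (a * near_exp)); last by rewrite /kap; ring.
    by rewrite [leRHS]mulrC.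
  by apply: le_trans; rewrite ler_wpM2l ?(ltW w0)// expR_ge1Dx.
(* The value of a that makes the left-hand side of [key] equal to
   w + I + 1. *)
have := key ((I + 1) / (w * kap)) _.
have -> : w * (1 + (I + 1) / (w * kap) * kap) = w + I + 1.
  by field; rewrite !gt_eqF.
move=> /(_ _)/wrap[]; first by rewrite divr_gt0 ?ltr_wpDl// mulr_gt0.
by lra.
Qed.

Lemma gauss_orthogonal_eq0 (U : E -> R) : continuous U ->
  mu.-integrable setT (EFin \o U) ->
  (forall x a, 0 < a -> \int[mu]_y (U y * gauss a x y) = 0) -> forall x, U x = 0.
Proof.
move=> cU iU H x; apply/eqP; rewrite eq_le; apply/andP; split.
  by apply: gauss_orthogonal_le0 => // a; exact: H.
rewrite -oppr_le0.
apply: (@gauss_orthogonal_le0 (fun y => - U y)).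
- by move=> y; apply: (@cvgN R R^o E (nbhs y)); exact: cU.
- have := integrableN iU; exact: eq_integrable.
- move=> a a0.
  transitivity (\int[mu]_y (-1 * (U y * gauss a x y))).
    by apply: eq_Rintegral => y _; rewrite mulN1r mulNr.
  rewrite RintegralZl ?H ?mulr0//.
  apply: integrable_boundM => //; first exact: continuous_measurable_rV (@continuous_gauss _ _ a x).
  move=> y; rewrite ger0_norm ?gauss_ge0// -[leRHS]expR0 ler_expR oppr_le0 mulr_ge0 ?(ltW a0)//.
  by rewrite sq_dotp sumr_ge0// => j _; exact: sqr_ge0.
Qed.

End vanish.

(** * Inversion of the cosine transform *)

Section inversion.
Context (R : realType) (m n : nat).
Local Notation V := ('rV[R]_m * 'rV[R]_n)%type.
Local Notation mu := (leb R n).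
Implicit Types (u v p q : V -> R) (t : 'rV[R]_m) (x : 'rV[R]_n).

Definition integrable_section u t : Prop :=
  mu.-integrable setT (EFin \o (fun x => u (t, x))).

Lemma continuous_dominated_section u t M : continuous u -> dominated M u ->
  integrable_section u t.
Proof.
move=> cu uM; apply: (@dominated_integrable_rV _ _ _ M).
  by apply: continuous_measurable_rV; exact: continuous_section.
by move=> x; exact: uM.
Qed.

Lemma integrable_cos_section u t th x xi : integrable_section u t ->
  mu.-integrable setT (EFin \o (fun y => u (t, y) * cos (dotp xi (y - x) + th))).
Proof.
move=> iu; apply: integrable_boundM => //; last by move=> y; exact: cos_max.
apply: continuous_measurable_rV.
rewrite (_ : (fun y => _) = fun y => cos (dotp xi y + (th - dotp xi x))).
  exact: continuous_cosdot.
by apply/funext => y; rewrite dotpBr; congr cos; ring.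
Qed.

Lemma integrable_gauss a x : 0 < a -> mu.-integrable setT (EFin \o gauss a x).
Proof.
move=> a0; have [M HM] := gauss_decay x a0.
apply: (@dominated_integrable_rV _ _ _ M).
  exact: continuous_measurable_rV (@continuous_gauss _ _ a x).
by move=> y; rewrite ger0_norm ?gauss_ge0.
Qed.

Lemma gauss_le1 a x (y : 'rV[R]_n) : 0 < a -> `|gauss a x y| <= 1.
Proof.
move=> a0; rewrite ger0_norm ?gauss_ge0// -[leRHS]expR0 ler_expR oppr_le0.
by rewrite mulr_ge0 ?(ltW a0)// sq_dotp sumr_ge0// => j _; exact: sqr_ge0.
Qed.

Lemma integrable_gaussM u t a x : 0 < a -> integrable_section u t ->
  mu.-integrable setT (EFin \o (fun y => u (t, y) * gauss a x y)).
Proof.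
move=> a0 iu; apply: integrable_boundM => //.
  exact: continuous_measurable_rV (@continuous_gauss _ _ a x).
by move=> y; exact: gauss_le1.
Qed.

(** Two transforms return the original exponent. *)
Lemma dual_gauss a x (y : 'rV[R]_n) : 0 < a ->
  gauss (4 * (4 * a)^-1)^-1 0 (y - x) = gauss a x y.
Proof.
move=> a0; rewrite /gauss subr0; congr expR; congr (- (_ * _)).
by field; rewrite gt_eqF.
Qed.

(** By Fubini the pairing of a cosine transform with a Gaussian is the pairing
    of the function with the transform of the Gaussian. *)
Lemma cosint_gauss p t th a x : 0 < a -> integrable_section p t ->
  \int[mu]_y (gauss a x y * cosint th p (t, y)) =
  gauss_mass a ^+ n *
    \int[mu]_xi (gauss (4 * a)^-1 0 xi * (p (t, xi) * cos (dotp xi x + th))).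
Proof.
move=> a0 ip.
have E y : cosint th p (t, y) =
    \int[mu]_xi (p (t, xi) * (fun z : _ * _ => cos (dotp z.1 (z.2 - 0) + th)) (xi, y)).
  by apply: eq_Rintegral => xi _ /=; rewrite subr0 dotpC.
under eq_Rintegral => y _ do rewrite E.
rewrite -(@Fubini_bounded _ _ (fun xi => p (t, xi)) (gauss a x)
  (fun z => cos (dotp z.1 (z.2 - 0) + th)) _ _ _ _).2//.
- rewrite -RintegralZl//; last first.
    rewrite (_ : EFin \o _ = EFin \o (fun xi => (p (t, xi) * cos (dotp x (xi - 0) + th)) *
        gauss (4 * a)^-1 0 xi)); last first.
      by apply/funext => xi /=; rewrite subr0 dotpC mulrC.
    apply: integrable_boundM; first exact: integrable_cos_section.
      exact: continuous_measurable_rV (@continuous_gauss _ _ _ _).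
    by move=> xi; apply: gauss_le1; rewrite invr_gt0 mulr_gt0.
  apply: eq_Rintegral => xi _.
  have -> : \int[mu]_y (gauss a x y * cos (dotp (xi, y).1 ((xi, y).2 - 0) + th)) =
      \int[mu]_y (gauss a x y * cos (dotp xi (y - x) + (dotp xi x + th))).
    by apply: eq_Rintegral => y _ /=; rewrite subr0 dotpBr; congr (_ * cos _); ring.
  by rewrite gauss_transform//; ring.
- exact: integrable_gauss.
- exact: measurable_cosdot2.
- by move=> z; exact: cos_max.
Qed.

(** For fixed t, p + i q is the Fourier transform of u + i v, and the claim is
    the real part of the inversion formula. No regularity in x beyond
    continuity is available for u and v, so both sides are compared through
    their pairings with Gaussians: a Gaussian at x on the left moves to the
    frequency side by [cosint_gauss]; there p and q are replaced by their
    definitions, and a second use of Fubini and of [gauss_transform] returns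
    the Gaussian at x, now paired with u. The terms with v vanish, since the
    transform of an even function has no sine part. *)
Lemma cosint_inversion u v p q t M :
  continuous u -> integrable_section u t -> integrable_section v t ->
  continuous p -> continuous q -> dominated M p -> dominated M q ->
  continuous (cosint 0 p) -> continuous (cosint (pi / 2) q) ->
  dominated M (cosint 0 p) -> dominated M (cosint (pi / 2) q) ->
  (forall xi, p (t, xi) = cosint 0 u (t, xi) + cosint (- (pi / 2)) v (t, xi)) ->
  (forall xi, q (t, xi) = cosint 0 v (t, xi) + cosint (pi / 2) u (t, xi)) ->
  forall x, cosint 0 p (t, x) + cosint (pi / 2) q (t, x) = (2 * pi) ^+ n * u (t, x).
Proof.
move=> cu iu iv cp cq pM qM cP cQ PM QM hp hq.
have ip := continuous_dominated_section t cp pM.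
have iq := continuous_dominated_section t cq qM.
have iP := continuous_dominated_section t cP PM.
have iQ := continuous_dominated_section t cQ QM.
pose U x := cosint 0 p (t, x) + cosint (pi / 2) q (t, x) - (2 * pi) ^+ n * u (t, x).
suff U0 x : U x = 0 by move=> x; apply/eqP; rewrite -subr_eq0; exact/eqP/U0.
move: x; apply: gauss_orthogonal_eq0.
- move=> x; apply: (@cvgB R R^o 'rV[R]_n (nbhs x)).
    by apply: (@cvgD R R^o 'rV[R]_n (nbhs x)); exact: continuous_section.
  apply: (@cvgM R 'rV[R]_n (nbhs x)); first exact: cvg_cst.
  exact: continuous_section.
- have := integrableB measurableT (integrableD measurableT iP iQ)
    (integrableZl measurableT ((2 * pi) ^+ n) iu).
  by apply: eq_integrable => // x _ /=; rewrite EFinM.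
move=> x a a0.
have b0 : 0 < (4 * a)^-1 by rewrite invr_gt0 mulr_gt0.
have igP := integrable_gaussM x a0 iP.
have igQ := integrable_gaussM x a0 iQ.
have igu := integrable_gaussM x a0 iu.
transitivity (\int[mu]_y (cosint 0 p (t, y) * gauss a x y) +
    \int[mu]_y (cosint (pi / 2) q (t, y) * gauss a x y) -
    (2 * pi) ^+ n * \int[mu]_y (u (t, y) * gauss a x y)).
  rewrite -RintegralZl// -RintegralD// -RintegralB//.
  - by apply: eq_Rintegral => y _; rewrite /U; ring.
  - have := integrableD measurableT igP igQ; exact: eq_integrable.
  - have := integrableZl measurableT ((2 * pi) ^+ n) igu.
    by apply: eq_integrable => // y _ /=; rewrite EFinM.
have swap (w : V -> R) : \int[mu]_y (w (t, y) * gauss a x y) =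
    \int[mu]_y (gauss a x y * w (t, y)).
  by apply: eq_Rintegral => y _; rewrite mulrC.
rewrite [X in X + _ - _]swap [X in _ + X - _]swap !cosint_gauss//.
set b := (4 * a)^-1.
have ig c th (w : V -> R) : integrable_section w t ->
    mu.-integrable setT (EFin \o (fun xi => gauss b 0 xi * (w (t, xi) * cos (dotp xi c + th)))).
  move=> iw; rewrite (_ : EFin \o _ = EFin \o (fun xi =>
      (w (t, xi) * cos (dotp c (xi - 0) + th)) * gauss b 0 xi)); last first.
    by apply/funext => xi /=; rewrite subr0 dotpC mulrC.
  apply: integrable_boundM; first exact: integrable_cos_section.
    exact: continuous_measurable_rV (@continuous_gauss _ _ _ _).
  by move=> xi; exact: gauss_le1.
rewrite -mulrDr -RintegralD//; [|exact: ig|exact: ig].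
pose phi th (z : 'rV[R]_n * 'rV[R]_n) := cos (dotp z.1 (z.2 - x) + th).
have mphi th : measurable_fun setT (phi th) by exact: measurable_cosdot2.
have phi1 th z : `|phi th z| <= 1 by exact: cos_max.
(* cos (A - B) and sin (A - B), with A = xi . x and B = xi . y, merge the
   two trigonometric factors into one. *)
have point xi : gauss b 0 xi * (p (t, xi) * cos (dotp xi x + 0)) +
    gauss b 0 xi * (q (t, xi) * cos (dotp xi x + pi / 2)) =
    gauss b 0 xi * \int[mu]_y (u (t, y) * phi 0 (xi, y)) +
    gauss b 0 xi * \int[mu]_y (v (t, y) * phi (- (pi / 2)) (xi, y)).
  rewrite -!mulrDr; congr (_ * _); rewrite hp hq /cosint /=.
  have iA w th : integrable_section w t ->
      mu.-integrable setT (EFin \o (fun y => w (t, y) * cos (dotp xi y + th))).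
    move=> iw; have := integrable_cos_section th 0 xi iw.
    by under eq_fun do rewrite subr0.
  have iB w th : integrable_section w t ->
      mu.-integrable setT (EFin \o (fun y => w (t, y) * phi th (xi, y))).
    by move=> iw; exact: integrable_cos_section.
  have iD (f g : 'rV[R]_n -> R) : mu.-integrable setT (EFin \o f) ->
      mu.-integrable setT (EFin \o g) ->
      mu.-integrable setT (EFin \o (fun y => f y + g y)).
    by move=> jf jg; have := integrableD measurableT jf jg; exact: eq_integrable.
  have iZ (f : 'rV[R]_n -> R) c : mu.-integrable setT (EFin \o f) ->
      mu.-integrable setT (EFin \o (fun y => f y * c)).
    move=> jf; have := integrableZl measurableT c jf.
    by apply: eq_integrable => // y _ /=; rewrite -EFinM mulrC.
  rewrite -!RintegralD -?RintegralZr -?RintegralD//;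
    do ?[exact: iA|exact: iB|apply: iD|apply: iZ].
  apply: eq_Rintegral => y _; rewrite /phi /= dotpBr !addr0 !cosDpihalf.
  rewrite !cosBpihalf cosB sinB; ring.
under eq_Rintegral => xi _ do rewrite point.
have igb := integrable_gauss 0 b0.
have iG th (w : V -> R) : integrable_section w t ->
    mu.-integrable setT (EFin \o (fun xi =>
      gauss b 0 xi * \int[mu]_y (w (t, y) * phi th (xi, y)))).
  by move=> iw; exact: (Fubini_bounded igb iw (mphi th) (phi1 th)).1.
rewrite RintegralD//; [|exact: iG|exact: iG].
rewrite (Fubini_bounded igb iu (mphi _) (phi1 _)).2 (Fubini_bounded igb iv (mphi _) (phi1 _)).2.
have inner th y : \int[mu]_xi (gauss b 0 xi * phi th (xi, y)) =
    gauss_mass b ^+ n * gauss a x y * cos th.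
  rewrite -(dual_gauss x y a0) -/b -(@gauss_transform _ _ b 0 (y - x) th b0).
  by apply: eq_Rintegral => xi _; rewrite /phi /= subr0 dotpC.
under eq_Rintegral => y _ do rewrite inner cos0 mulr1 mulrCA.
rewrite [X in _ * (_ + X)](_ : _ = 0); last first.
  transitivity (\int[mu]_(y in setT) (0 : R)); last by rewrite /Rintegral integral0.
  by apply: eq_Rintegral => y _; rewrite inner cosN cos_pihalf !mulr0.
by rewrite addr0 RintegralZl// mulrA -exprMn gauss_mass_dual// subrr.
Qed.

End inversion.

(** * Real and imaginary parts *)

Section complex_parts.
Context (R : realType).
Local Notation Re := (@complex.Re R).
Local Notation Im := (@complex.Im R).
Local Notation C := (Rcomplex R).

Lemma Rcomplex_normE (z : C) : `|z| = Num.sqrt (Re z ^+ 2 + Im z ^+ 2).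
Proof. by case: z. Qed.

Lemma Re_le_norm (z : C) : `|Re z| <= `|z|.
Proof.
rewrite Rcomplex_normE -sqrtr_sqr ler_wsqrtr// lerDl; exact: sqr_ge0.
Qed.

Lemma Im_le_norm (z : C) : `|Im z| <= `|z|.
Proof.
rewrite Rcomplex_normE -sqrtr_sqr ler_wsqrtr// lerDr; exact: sqr_ge0.
Qed.

Lemma norm_le_parts (z : C) : `|z| <= `|Re z| + `|Im z|.
Proof.
rewrite Rcomplex_normE -[leRHS]ger0_norm ?addr_ge0// -sqrtr_sqr ler_wsqrtr//.
rewrite sqrrD !real_normK ?num_real// addrAC lerDl mulrn_wge0// mulr_ge0//.
Qed.

Lemma ReB (z w : C) : Re (z - w) = Re z - Re w.
Proof. by case: z; case: w. Qed.
Lemma ImB (z w : C) : Im (z - w) = Im z - Im w.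
Proof. by case: z; case: w. Qed.
Lemma ReZ (a : R) (z : C) : Re (a *: z) = a * Re z.
Proof. by case: z. Qed.
Lemma ImZ (a : R) (z : C) : Im (a *: z) = a * Im z.
Proof. by case: z. Qed.

Lemma cvg_parts (T : Type) (F : set_system T) (FF : ProperFilter F) (f : T -> C) (z : C) :
  f @ F --> z <->
  (fun t => Re (f t)) @ F --> Re z /\ (fun t => Im (f t)) @ F --> Im z.
Proof.
split=> [/cvgrPdist_lt H|[/cvgrPdist_lt HR /cvgrPdist_lt HI]].
  split; apply/cvgrPdist_lt => e e0; near=> t.
    rewrite -ReB (le_lt_trans (Re_le_norm _))//.
    by near: t; exact: H.
  rewrite -ImB (le_lt_trans (Im_le_norm _))//.
  by near: t; exact: H.
apply/cvgrPdist_lt => e e0; near=> t.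
rewrite (le_lt_trans (norm_le_parts _))// ReB ImB (splitr e) ltrD//.
  by near: t; apply: HR; rewrite divr_gt0.
by near: t; apply: HI; rewrite divr_gt0.
Unshelve. all: by end_near. Qed.

Lemma is_derive_parts (V : normedModType R) (f : V -> C) (p e : V) (d : C) :
  is_derive p e f d <->
  is_derive p e (fun q => Re (f q)) (Re d) /\ is_derive p e (fun q => Im (f q)) (Im d).
Proof.
have QR (h : R) : Re (h^-1 *: ((f \o shift p) (h *: e) - f p)) =
    h^-1 *: (((fun q => Re (f q)) \o shift p) (h *: e) - Re (f p)).
  by rewrite ReZ ReB.
have QI (h : R) : Im (h^-1 *: ((f \o shift p) (h *: e) - f p)) =
    h^-1 *: (((fun q => Im (f q)) \o shift p) (h *: e) - Im (f p)).
  by rewrite ImZ ImB.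
have key (d' : C) : (fun h : R => h^-1 *: ((f \o shift p) (h *: e) - f p)) @ 0^' --> d' <->
    (fun h : R => h^-1 *: (((fun q => Re (f q)) \o shift p) (h *: e) - Re (f p))) @ 0^' --> Re d' /\
    (fun h : R => h^-1 *: (((fun q => Im (f q)) \o shift p) (h *: e) - Im (f p))) @ 0^' --> Im d'.
  rewrite cvg_parts.
  by under eq_fun do rewrite QR; under [X in _ /\ X @ _ --> _ <-> _]eq_fun do rewrite QI.
split=> [[D E]|[[DR ER] [DI EI]]].
  have /key[cR cI] : (fun h : R => h^-1 *: ((f \o shift p) (h *: e) - f p)) @ 0^' --> d.
    by rewrite -E; exact: D.
  split; split.
  - by apply/cvg_ex; exists (Re d).
  - exact: cvg_lim cR.
  - by apply/cvg_ex; exists (Im d).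
  - exact: cvg_lim cI.
have cd : (fun h : R => h^-1 *: ((f \o shift p) (h *: e) - f p)) @ 0^' --> d.
  by apply/key; split; [rewrite -ER; exact: DR|rewrite -EI; exact: DI].
split; first by apply/cvg_ex; exists d.
exact: cvg_lim cd.
Qed.

End complex_parts.

Section smooth_parts.
Context (R : realType) (m n : nat).
Local Notation V := ('rV[R]_m * 'rV[R]_n)%type.
Local Notation idx := ('I_m + 'I_n)%type.
Implicit Types (f : V -> Rcomplex R) (k : idx) (s : seq idx) (p : V).

Definition re f : V -> R := fun p => complex.Re (f p).
Definition im f : V -> R := fun p => complex.Im (f p).
Local Notation pders := (foldr (@pder R m n)).

Lemma partial_parts (g : V -> Rcomplex R) k : (forall p, derivable g p (dir R k)) ->
  re (partial k g) = pder k (re g) /\ im (partial k g) = pder k (im g).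
Proof.
move=> dg; have D p : is_derive p (dir R k) g (partial k g p) by split.
by split; apply/funext => p; have /is_derive_parts[[_ E1] [_ E2]] := D p.
Qed.

Lemma foldr_partial_smooth f s : smooth f ->
  re (foldr (@partial R m n) f s) = pders (re f) s /\
  im (foldr (@partial R m n) f s) = pders (im f) s.
Proof.
move=> sf; elim: s => [//|k s [IHr IHi]] /=; rewrite -IHr -IHi.
exact: (partial_parts ((sf s).2 k)).
Qed.

(** Differentiability of the complex derivative has to be obtained at each
    step of the induction, before the next derivative can be split. *)
Lemma foldr_partial_smooth_real f s :
  smooth_real (re f) -> smooth_real (im f) ->
  (re (foldr (@partial R m n) f s) = pders (re f) s /\
   im (foldr (@partial R m n) f s) = pders (im f) s) /\
  forall k p, derivable (foldr (@partial R m n) f s) p (dir R k).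
Proof.
move=> sr si; have der t : re (foldr (@partial R m n) f t) = pders (re f) t ->
    im (foldr (@partial R m n) f t) = pders (im f) t ->
    forall k p, derivable (foldr (@partial R m n) f t) p (dir R k).
  move=> Er Ei k p.
  have dr := smooth_real_is_derive t k p sr; rewrite -Er in dr.
  have di := smooth_real_is_derive t k p si; rewrite -Ei in di.
  have [D _] := (is_derive_parts (foldr (@partial R m n) f t) p (dir R k)
    (Complex (pders (re f) (k :: t) p) (pders (im f) (k :: t) p))).2 (conj dr di).
  exact: D.
elim: s => [|k s [[IHr IHi] D]]; first by split => //; exact: der.
have E : re (foldr (@partial R m n) f (k :: s)) = pders (re f) (k :: s) /\
   im (foldr (@partial R m n) f (k :: s)) = pders (im f) (k :: s).
  by rewrite /= -IHr -IHi; exact: (partial_parts (D k)).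
by split => //; apply: der; case: E.
Qed.

Lemma smooth_parts f : smooth f <-> smooth_real (re f) /\ smooth_real (im f).
Proof.
split=> [sf|[sr si] s].
  split=> s; have [Er Ei] := foldr_partial_smooth s sf.
    rewrite -Er; split=> [p|k p].
      by have /cvg_parts[] := (sf s).1 p.
    have D : is_derive p (dir R k) _ _ := DeriveDef ((sf s).2 k p) erefl.
    by have /is_derive_parts[[]] := D.
  rewrite -Ei; split=> [p|k p].
    by have /cvg_parts[] := (sf s).1 p.
  have D : is_derive p (dir R k) _ _ := DeriveDef ((sf s).2 k p) erefl.
  by have /is_derive_parts[_ []] := D.
have [[Er Ei] D] := foldr_partial_smooth_real s sr si.
split=> [p|]; last exact: D.
apply/cvg_parts; split.
  have := (sr s).1 p; rewrite -Er; exact.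
have := (si s).1 p; rewrite -Ei; exact.
Qed.

End smooth_parts.

(** * From multi-indices to words *)

Section words.
Variable T : finType.
Implicit Types (c : T -> nat) (s : seq T).

Definition spell c : seq T := flatten [seq nseq (c x) x | x <- enum T].

Lemma count_spell c x : count_mem x (spell c) = c x.
Proof.
rewrite /spell count_flatten -map_comp sumnE big_map big_enum /=.
rewrite (bigD1 x)//= count_nseq /= eqxx mul1n big1 ?addn0// => y /negbTE yx.
by rewrite count_nseq /= yx.
Qed.

Lemma size_spell c : size (spell c) = (\sum_x c x)%N.
Proof.
rewrite /spell size_flatten /shape -map_comp sumnE big_map big_enum /=.
by apply: eq_bigr => x _; rewrite size_nseq.
Qed.

Lemma prod_spell (R : comPzRingType) (F : T -> R) c :
  \prod_(x <- spell c) F x = \prod_x F x ^+ c x.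
Proof.
rewrite /spell big_flatten big_map big_enum /=; apply: eq_bigr => x _.
by rewrite big_nseq iter_mulr_1.
Qed.

End words.

Section estimates.
Context (R : realType) (m n : nat).
Local Notation V := ('rV[R]_m * 'rV[R]_n)%type.
Local Notation idx := ('I_m + 'I_n)%type.
Implicit Types (f : V -> Rcomplex R) (a b : {ffun 'I_n -> nat})
  (c : {ffun 'I_m -> nat}) (s : seq idx) (r : seq 'I_n) (p : V).

Definition xt_word b c : seq idx := map inr (spell b) ++ map inl (spell c).

Lemma foldr_iter_spell (I : Type) (h : I -> idx) (c : I -> nat) f (l : seq I) :
  foldr (fun i => iter (c i) (partial (h i))) f l =
  foldr (@partial R m n) f (map h (flatten [seq nseq (c i) i | i <- l])).
Proof.
elim: l => //= i l ->; rewrite map_cat foldr_cat map_nseq.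
by elim: (c i) => //= k ->.
Qed.

Lemma partial_xt b c f :
  partial_x b (partial_t c f) = foldr (@partial R m n) f (xt_word b c).
Proof. by rewrite /partial_x /partial_t !foldr_iter_spell /xt_word foldr_cat. Qed.

Lemma count_inr_map_inr (r : seq 'I_n) j :
  count_mem (inr j) (map (@inr 'I_m 'I_n) r) = count_mem j r.
Proof. by rewrite count_map; apply: eq_count => i. Qed.

Lemma count_inl_map_inl (r : seq 'I_m) i :
  count_mem (inl i) (map (@inl 'I_m 'I_n) r) = count_mem i r.
Proof. by rewrite count_map; apply: eq_count => k. Qed.

Lemma count_inl_map_inr (r : seq 'I_n) i :
  count_mem (inl i) (map (@inr 'I_m 'I_n) r) = 0%N.
Proof. by rewrite count_map (@eq_count _ _ pred0) ?count_pred0. Qed.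

Lemma count_inr_map_inl (r : seq 'I_m) j :
  count_mem (inr j) (map (@inl 'I_m 'I_n) r) = 0%N.
Proof. by rewrite count_map (@eq_count _ _ pred0) ?count_pred0. Qed.

Lemma mono_monom a p : mono (spell a) p = monom a p.2.
Proof. by rewrite /mono prod_spell. Qed.

Lemma mono_perm r r' p : perm_eq r r' -> mono r p = mono r' p.
Proof. exact: perm_big. Qed.

Lemma perm_xt_word s :
  perm_eq s (xt_word [ffun j => count_mem (inr j) s] [ffun i => count_mem (inl i) s]).
Proof.
apply/allP => -[i|j] _ /=; rewrite /xt_word count_cat.
  by rewrite count_inl_map_inr count_inl_map_inl count_spell ffunE.
by rewrite count_inr_map_inr count_inr_map_inl count_spell ffunE addn0.
Qed.

Lemma perm_spell_ffun r : perm_eq r (spell [ffun j => count_mem j r]).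
Proof. by apply/allP => x _ /=; rewrite count_spell ffunE. Qed.

Lemma mdegD a b : mdeg (a + b) = (mdeg a + mdeg b)%N.
Proof. by rewrite /mdeg -big_split /=; apply: eq_bigr => j _; rewrite ffunE. Qed.

Lemma size_xt_word b c : size (xt_word b c) = (mdeg b + mdeg c)%N.
Proof. by rewrite size_cat !size_map !size_spell. Qed.

Lemma powR_prod (I : finType) (F : I -> R) (e : R) : (forall i, 0 <= F i) ->
  \prod_i (F i `^ e) = (\prod_i F i) `^ e.
Proof.
move=> F0; suff [] : \prod_i (F i `^ e) = (\prod_i F i) `^ e /\ 0 <= \prod_i F i by [].
apply: (@big_ind2 _ _ (fun x y => x = y `^ e /\ 0 <= y)).
- by rewrite powR1.
- by move=> x1 x2 y1 y2 [-> p1] [-> p2]; rewrite powRM// mulr_ge0.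
- by move=> i _; split.
Qed.

Variables (sigma mu : R).
Local Notation wt := (@wt R m n sigma mu).

Lemma wt_xt_word a b c : wt (map inr (spell a) ++ xt_word b c) =
  (\prod_(j < n) (a j + b j)`!)%:R `^ mu * (mfact c)%:R `^ sigma.
Proof.
rewrite /wt big_sumType /= mulrC; congr (_ * _).
  rewrite natr_prod -powR_prod//; apply: eq_bigr => j _.
  by rewrite /xt_word !count_cat !count_inr_map_inr count_inr_map_inl !count_spell addn0.
rewrite /mfact natr_prod -powR_prod//; apply: eq_bigr => i _.
by rewrite /xt_word !count_cat !count_inl_map_inr count_inl_map_inl !count_spell.
Qed.

Lemma bin_le_exp2 k l : ('C(k, l) <= 2 ^ k)%N.
Proof.
elim: k l => [|k IH] [|l]; rewrite ?bin0 ?expn_gt0//.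
by rewrite binS expnS mul2n -addnn leq_add.
Qed.

Lemma fact_add_le k l : (k`! * l`! <= (k + l)`! <= 2 ^ (k + l) * (k`! * l`!))%N.
Proof.
have E := bin_fact (leq_addr l k); rewrite addKn in E.
by rewrite -E leq_pmull ?bin_gt0 ?leq_addr// leq_mul2r bin_le_exp2 orbT.
Qed.

Lemma mfact_add_ge a b : (mfact a * mfact b <= \prod_(j < n) (a j + b j)`!)%N.
Proof.
rewrite /mfact -big_split /=; apply: leq_prod => j _.
by have /andP[] := fact_add_le (a j) (b j).
Qed.

Lemma mfact_add_le a b :
  (\prod_(j < n) (a j + b j)`! <= 2 ^ mdeg (a + b)%R * (mfact a * mfact b))%N.
Proof.
rewrite /mfact -big_split /= /mdeg expn_sum -big_split /=; apply: leq_prod => j _.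
by rewrite ffunE; have /andP[] := fact_add_le (a j) (b j).
Qed.

Definition sup_bound (C0 C1 : R) f : Prop := forall a b c,
  (sup_mon_partial a b c f <=
   (C0 * C1 ^+ (mdeg (a + b) + mdeg c)
    * (mfact a * mfact b)%:R `^ mu * (mfact c)%:R `^ sigma)%:E)%E.

Lemma sup_mon_partial_leP a b c f (B : R) :
  (sup_mon_partial a b c f <= B%:E)%E <->
  forall p, `|monom a p.2 *: foldr (@partial R m n) f (xt_word b c) p| <= B.
Proof.
rewrite /sup_mon_partial -partial_xt; split=> [H p|H].
  by rewrite -lee_fin (le_trans _ H)//; apply: ereal_sup_ubound; exists p.
by apply: ge_ereal_sup => _ [p _ <-]; rewrite lee_fin.
Qed.

Hypothesis mu0 : 0 <= mu.

(** The derivatives of a smooth function may be reordered, so each word can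
    be replaced by that of a multi-index. *)
Lemma sup_bound_gs f : smooth f ->
  (exists C0 C1 : R, [/\ 0 < C0, 0 < C1 & sup_bound C0 C1 f]) ->
  gs_real sigma mu (re f) /\ gs_real sigma mu (im f).
Proof.
move=> sf [C0 [C1 [C00 C10 H]]].
have [sr si] := (smooth_parts f).1 sf.
have key r s p : `|mono r p *: foldr (@partial R m n) f s p| <=
    C0 * (Num.max 1 C1) ^+ (size r + size s) * wt (map inr r ++ s).
  set a := [ffun j => count_mem j r] : {ffun 'I_n -> nat}.
  set b := [ffun j => count_mem (inr j) s] : {ffun 'I_n -> nat}.
  set c := [ffun i => count_mem (inl i) s] : {ffun 'I_m -> nat}.
  have pr : perm_eq r (spell a) by exact: perm_spell_ffun.
  have ps : perm_eq s (xt_word b c) by exact: perm_xt_word.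
  have -> : foldr (@partial R m n) f s = foldr (@partial R m n) f (xt_word b c).
    have [Er Ei] := foldr_partial_smooth s sf.
    have [Er' Ei'] := foldr_partial_smooth (xt_word b c) sf.
    rewrite (foldr_pder_perm sr ps) -Er' in Er.
    rewrite (foldr_pder_perm si ps) -Ei' in Ei.
    apply/funext => q; apply/eqP; rewrite eq_complex; apply/andP.
    by split; apply/eqP; [exact: (congr1 (@^~ q) Er)|exact: (congr1 (@^~ q) Ei)].
  rewrite (mono_perm p pr) mono_monom (perm_size pr) (perm_size ps) size_xt_word size_spell.
  rewrite (@wt_perm _ _ _ _ _ _ (map inr (spell a) ++ xt_word b c)); last first.
    by rewrite perm_cat// perm_map.
  rewrite wt_xt_word.
  have /(sup_mon_partial_leP a b c f) := H a b c; move=> /(_ p)/le_trans; apply.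
  rewrite -!mulrA ler_wpM2l ?(ltW C00)//.
  rewrite mdegD -addnA ler_pM ?exprn_ge0 ?(ltW C10)//.
  - by rewrite lerXn2r ?nnegrE ?(ltW C10) ?le_max ?lexx ?orbT// ?ler01.
  - rewrite ler_wpM2r ?powR_ge0// ge0_ler_powR ?nnegrE// ler_nat.
    exact: mfact_add_ge.
split; exists C0, (Num.max 1 C1); split => //; rewrite ?le_max ?lexx//.
  move=> r s p; rewrite -(foldr_partial_smooth s sf).1.
  by apply: le_trans (key r s p); rewrite -ReZ; exact: Re_le_norm.
move=> r s p; rewrite -(foldr_partial_smooth s sf).2.
by apply: le_trans (key r s p); rewrite -ImZ; exact: Im_le_norm.
Qed.

Lemma gs_sup_bound f : smooth f ->
  gs_real sigma mu (re f) -> gs_real sigma mu (im f) ->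
  exists C0 C1 : R, [/\ 0 < C0, 0 < C1 & sup_bound C0 C1 f].
Proof.
move=> sf [C0 [C1 [C00 C11 Hr]]] [D0 [D1 [D00 D11 Hi]]].
pose M := Num.max C1 D1.
have M1 : 1 <= M by rewrite le_max C11.
have M0 : 0 < M by rewrite (lt_le_trans _ M1).
pose Q : R := 2 `^ mu.
have Q1 : 1 <= Q by rewrite -[leLHS](powRr0 2); apply: ler_powR; rewrite ?ler1n.
have Q0 : 0 < Q by rewrite (lt_le_trans _ Q1).
exists (C0 + D0), (M * Q); split.
- by rewrite addr_gt0.
- by rewrite mulr_gt0.
move=> a b c; apply/sup_mon_partial_leP => p.
rewrite (le_trans (norm_le_parts _))// ReZ ImZ.
have [Er Ei] := foldr_partial_smooth (xt_word b c) sf.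
have HR := Hr (spell a) (xt_word b c) p.
have HI := Hi (spell a) (xt_word b c) p.
rewrite mono_monom -Er in HR; rewrite mono_monom -Ei in HI.
set N := (mdeg (a + b)%R + mdeg c)%N.
have NE : (size (spell a) + size (xt_word b c) = N)%N.
  by rewrite size_xt_word size_spell /N mdegD addnA.
set W := wt (map inr (spell a) ++ xt_word b c).
have W0 : 0 <= W by rewrite ltW// wt_gt0.
have WQ : W <= Q ^+ N * ((mfact a * mfact b)%:R `^ mu * (mfact c)%:R `^ sigma).
  rewrite /W wt_xt_word mulrA ler_wpM2r ?powR_ge0//.
  apply: (@le_trans _ _ (Q ^+ mdeg (a + b) * (mfact a * mfact b)%:R `^ mu)); last first.
    by rewrite ler_wpM2r ?powR_ge0// ler_weXn2l// leq_addr.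
  have -> : Q ^+ mdeg (a + b) = (2 ^+ mdeg (a + b)) `^ mu.
    rewrite -(powR_mulrn _ (powR_ge0 _ _)) -(powR_mulrn _ (ler0n R 2)).
    by rewrite -[LHS]powRrM -[RHS]powRrM mulrC.
  rewrite -powRM ?exprn_ge0// ge0_ler_powR ?nnegrE ?mulr_ge0 ?exprn_ge0//.
  by rewrite -natrX -natrM ler_nat; exact: mfact_add_le.
rewrite NE -/W in HR HI.
apply: (@le_trans _ _ ((C0 + D0) * M ^+ N * W)).
  rewrite !mulrDl lerD//.
    apply: (le_trans HR); rewrite ler_wpM2r// ler_wpM2l ?(ltW C00)//.
    by rewrite lerXn2r ?nnegrE ?le_max ?lexx// ?(le_trans ler01)// ltW.
  apply: (le_trans HI); rewrite ler_wpM2r// ler_wpM2l ?(ltW D00)//.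
  by rewrite lerXn2r ?nnegrE ?le_max ?lexx ?orbT// ?(le_trans ler01)// ltW.
rewrite exprMn -!mulrA ler_wpM2l ?addr_ge0 ?(ltW C00) ?(ltW D00)//.
by rewrite ler_wpM2l ?exprn_ge0 ?(ltW M0).
Qed.

End estimates.

Section gelfand_shilov.
Context (R : realType) (m n : nat) (sigma mu : R).
Local Notation V := ('rV[R]_m * 'rV[R]_n)%type.
Implicit Types (f : V -> Rcomplex R).

Lemma sup_mon_partial_ge0 a b c f : (0 <= @sup_mon_partial R m n a b c f)%E.
Proof.
rewrite /sup_mon_partial; apply: ereal_sup_ge; exists (`|monom a (0 : V).2 *: partial_x b (partial_t c f) 0|%:E).
  by exists 0.
by rewrite lee_fin.
Qed.

Definition GS_coef (C : R) (a b : {ffun 'I_n -> nat}) (c : {ffun 'I_m -> nat}) : R :=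
  C ^- (mdeg (a + b) + mdeg c) * (mfact c)%:R `^ (- sigma)
    * (mfact a * mfact b)%:R `^ (- mu).

Lemma GS_coefE (C : R) a b c : GS_coef C a b c =
  (C ^+ (mdeg (a + b) + mdeg c) * (mfact a * mfact b)%:R `^ mu *
   (mfact c)%:R `^ sigma)^-1.
Proof. by rewrite /GS_coef !powRN !invfM -!mulrA; congr (_ * _); rewrite mulrC. Qed.

Lemma mfact_gt0 d (a : {ffun 'I_d -> nat}) : (0 < mfact a)%N.
Proof. by rewrite /mfact prodn_gt0// => i; rewrite fact_gt0. Qed.

Lemma GS_coef_gt0 (C : R) a b c : 0 < C -> 0 < GS_coef C a b c.
Proof.
move=> C0; rewrite GS_coefE invr_gt0 !mulr_gt0 ?exprn_gt0//.
  by rewrite powR_gt0// ltr0n muln_gt0 !mfact_gt0.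
by rewrite powR_gt0// ltr0n mfact_gt0.
Qed.

Lemma GS_sup_bound f : GS sigma mu f <->
  Cinfty f /\ exists C0 C1 : R, [/\ 0 < C0, 0 < C1 & sup_bound sigma mu C0 C1 f].
Proof.
split=> [[C C0 [Cf fin]]|[Cf [C0 [C1 [C00 C10 H]]]]].
  split => //; have C0' : 0 < C by [].
  have le a b c : ((GS_coef C a b c)%:E * sup_mon_partial a b c f <= GSnorm sigma mu C f)%E.
    apply: (@le_trans _ _ (ereal_sup [set ((GS_coef C a b c)%:E * sup_mon_partial a b c f)%E
        | c in [set: {ffun 'I_m -> nat}]])).
      by apply: ereal_sup_ubound; exists c.
    by apply: ereal_sup_ubound; exists (a, b).
  have GS0 : (0 <= GSnorm sigma mu C f)%E.
    apply: le_trans (le [ffun=> 0%N] [ffun=> 0%N] [ffun=> 0%N]).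
    by rewrite mule_ge0 ?sup_mon_partial_ge0// lee_fin ltW// GS_coef_gt0.
  have GSfin : GSnorm sigma mu C f \is a fin_num by rewrite ge0_fin_numE.
  pose M := fine (GSnorm sigma mu C f).
  have M0 : 0 <= M by exact: fine_ge0.
  (* The norm may be zero, while the constant has to be positive. *)
  exists (M + 1), C; split => //; first by rewrite ltr_wpDl.
  move=> a b c; have k0 := GS_coef_gt0 a b c C0'.
  have := le a b c; rewrite -(fineK GSfin) -/M muleC -lee_pdivlMr// => /le_trans; apply.
  rewrite -EFinM lee_fin GS_coefE invrK -!mulrA ler_wpM2r ?lerDl//.
  by rewrite !mulr_ge0 ?exprn_ge0 ?powR_ge0// ltW.
exists C1 => //; split => //.
apply: (@le_lt_trans _ _ C0%:E); last exact: ltry.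
apply: ge_ereal_sup => _ [[a b] _ <-] /=; apply: ge_ereal_sup => _ [c _ <-].
have k0 := GS_coef_gt0 a b c C10; rewrite -/(GS_coef C1 a b c).
rewrite muleC -lee_pdivlMr//; apply: (le_trans (H a b c)).
by rewrite -EFinM lee_fin GS_coefE invrK -!mulrA.
Qed.

End gelfand_shilov.

(** * The Fourier transform in terms of cosine transforms *)

Section fourier_parts.
Context (R : realType) (m n : nat).
Local Notation V := ('rV[R]_m * 'rV[R]_n)%type.
Implicit Types (f : V -> Rcomplex R) (p : V).

Lemma re_fourier f p : integrable_section (re f) p.1 -> integrable_section (im f) p.1 ->
  re (fourier_x f) p = cosint 0 (re f) p + cosint (- (pi / 2)) (im f) p.
Proof.
move=> ir ii.
have iA w th : integrable_section w p.1 -> (leb R n).-integrable setT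
    (EFin \o (fun y => w (p.1, y) * cos (dotp p.2 y + th))).
  move=> iw; have := integrable_cos_section th 0 p.2 iw.
  by under eq_fun do rewrite subr0.
rewrite /cosint -RintegralD//; [|exact: iA|exact: iA].
apply: eq_Rintegral => x _; rewrite /re /im /expi.
case: (f (p.1, x)) => a b /=.
by rewrite cosN sinN mulrN opprK addr0 cosBpihalf.
Qed.

Lemma im_fourier f p : integrable_section (re f) p.1 -> integrable_section (im f) p.1 ->
  im (fourier_x f) p = cosint 0 (im f) p + cosint (pi / 2) (re f) p.
Proof.
move=> ir ii.
have iA w th : integrable_section w p.1 -> (leb R n).-integrable setT
    (EFin \o (fun y => w (p.1, y) * cos (dotp p.2 y + th))).
  move=> iw; have := integrable_cos_section th 0 p.2 iw.
  by under eq_fun do rewrite subr0.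
rewrite /cosint -RintegralD//; [|exact: iA|exact: iA].
apply: eq_Rintegral => x _; rewrite /re /im /expi.
case: (f (p.1, x)) => a b /=.
by rewrite cosN sinN addr0 cosDpihalf addrC.
Qed.

Lemma periodic_fourier f : periodic_torus f -> periodic_torus (fourier_x f).
Proof.
move=> pf i p; rewrite /fourier_x /Cintegral.
have E x : f ((p + (pi *+ 2) *: dir R (inl i)).1, x) = f (p.1, x).
  rewrite -(pf i (p.1, x)); congr f; congr pair.
  by rewrite /= scaler0 addr0.
have E2 : (p + (pi *+ 2) *: dir R (inl i)).2 = p.2 by rewrite /= scaler0 addr0.
by congr Complex; apply: eq_Rintegral => x _; rewrite E E2.
Qed.

End fourier_parts.

(** * Periodic functions and null sets of parameters *)

Section torus_density.
Context (R : realType) (m n : nat).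
Local Notation V := ('rV[R]_m * 'rV[R]_n)%type.
Implicit Types (D : V -> R).

(** A small cube with lowest corner t0 stays in the half-open cell and has
    positive measure. *)
Lemma cell_point_in_cube (t0 : 'rV[R]_m) (N : set 'rV[R]_m) (d : R) :
  0 < d -> torus_cell t0 -> (leb R m).-negligible N ->
  exists t, [/\ torus_cell t, ~ N t & ball t0 d t].
Proof.
move=> d0 ct [A [mA A0 NA]].
have [e [e0 ed ce]] : exists e : R, [/\ 0 < e, e < d &
    forall i, e < pi *+ 2 - t0 ord0 i].
  have F : \forall e \near 0^'+, (0 : R) < e /\ e < d /\ forall i, e < pi *+ 2 - t0 ord0 i.
    near=> e; split; first by near: e; exact: nbhs_right_gt.
    split; first by near: e; exact: nbhs_right_lt.
    near: e; apply: filter_forall => i; apply: nbhs_right_lt.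
    by rewrite subr_gt0; case/andP: (ct i).
  have [e [? [? ?]]] := @filter_ex _ _ _ _ F.
  by exists e.
have [mC muC] := leb_cube t0 e0.
set C := [set y | _] in mC muC.
have [t [Ct nAt]] : exists t, C t /\ ~ A t.
  apply: contrapT => /forallNP H.
  have CA : C `<=` A by move=> t Ct; apply: contrapT => nA; exact: (H t).
  have : (leb R m C <= 0)%E by rewrite -A0 le_measure// ?inE.
  apply/negP; rewrite -ltNge.
  have : (0 < (e ^+ m)%:E)%E by rewrite lte_fin exprn_gt0.
  by rewrite -muC.
exists t; split.
- move=> i; have /andP[h1 h2] := Ct i; have /andP[g1 _] := ct i.
  rewrite (le_trans g1 h1) /= (lt_le_trans h2)// -lerBrDl.
  exact: ltW.
- by move=> Nt; exact/nAt/NA.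
- split=> // k i; rewrite (ord1 k) /ball /=; have /andP[h1 h2] := Ct i.
  by rewrite distrC ger0_norm ?subr_ge0// ltrBlDl (lt_trans h2)// ltrD2l.
Unshelve. all: by end_near. Qed.

Definition torus_periodic D : Prop :=
  forall i p, D (p + (pi *+ 2) *: dir R (inl i)) = D p.

Lemma torus_periodic_cell D t x : torus_periodic D ->
  exists2 t', torus_cell t' & D (t', x) = D (t, x).
Proof.
move=> pD; have P0 : 0 < pi *+ 2 :> R by rewrite mulrn_wgt0// pi_gt0.
have pn (i : 'I_m) k p : D (p + ((pi *+ 2) *: dir R (inl i)) *+ k) = D p.
  elim: k p => [|k IH] p; first by rewrite mulr0n addr0.
  by rewrite mulrS addrA IH pD.
have pz (i : 'I_m) (k : int) p : D (p + ((pi *+ 2) *: dir R (inl i)) *~ k) = D p.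
  case: k => k; first exact: pn.
  by rewrite NegzE mulrNz -{2}[p](subrK (((pi *+ 2) *: dir R (inl i)) *~ k.+1)) pn.
have ps (k : 'I_m -> int) (r : seq 'I_m) p :
    D (p + \sum_(i <- r) ((pi *+ 2) *: dir R (inl i)) *~ (k i)) = D p.
  elim: r p => [|i r IH] p; first by rewrite big_nil addr0.
  by rewrite big_cons addrA IH pz.
(* Translation by multiples of 2 pi into the cell. *)
pose k i := - Num.floor (t ord0 i / (pi *+ 2)).
have sumE (r : seq 'I_m) : \sum_(i <- r) ((pi *+ 2) *: dir R (inl i)) *~ (k i) =
    (\sum_(i <- r) ((pi *+ 2) * (k i)%:~R) *: delta_mx ord0 i, 0) :> V.
  elim: r => [|i r IH]; first by rewrite !big_nil.
  rewrite !big_cons IH -scaler_int scalerA /dir [_%:~R * _]mulrC.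
  by congr pair; rewrite /= scaler0 addr0.
pose t' : 'rV[R]_m := t + \sum_i ((pi *+ 2) * (k i)%:~R) *: delta_mx ord0 i.
exists t'; last first.
  rewrite -(ps k (index_enum 'I_m) (t, x)) sumE; congr D; congr pair.
  by rewrite /= addr0.
move=> i; have -> : t' ord0 i = t ord0 i + (pi *+ 2) * (k i)%:~R.
  rewrite mxE summxE (bigD1 i)//= big1 ?addr0 => [|j /negbTE ji]; rewrite !mxE eqxx /=.
    by rewrite eqxx mulr1.
  by rewrite eq_sym ji mulr0.
rewrite /k; set y := t ord0 i.
have /andP[] := mem_rg1_floor (y / (pi *+ 2)).
rewrite ler_pdivlMr// ltr_pdivrMr// mulrDl mul1r => h1 h2.
by rewrite mulrNz mulrN subr_ge0 ltrBlDr [_ * _%:~R]mulrC addrC h1.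
Qed.

End torus_density.

(** * The two implications *)

Section main.
Context (R : realType) (m n : nat).
Local Notation V := ('rV[R]_m * 'rV[R]_n)%type.
Implicit Types (D u : V -> R) (f : V -> Rcomplex R).

(** The complement of a null set is dense in the cell. *)
Lemma torus_eq0 D (N : set 'rV[R]_m) : continuous D -> torus_periodic D ->
  (leb R m).-negligible N ->
  (forall t, torus_cell t -> ~ N t -> forall x, D (t, x) = 0) -> forall p, D p = 0.
Proof.
move=> cD pD N0 H [t x]; have [t' ct' <-] := torus_periodic_cell t x pD.
apply/eqP; apply: contrapT => /negP; rewrite -normr_gt0 => Dpos.
have /cvgrPdist_lt/(_ _ Dpos)/nbhs_ballP[d /= d0 dD] := cD (t', x).
have [s [cs nNs ts]] := cell_point_in_cube d0 ct' N0.
have := dD (s, x) (conj ts (ballxx _ d0)); rewrite /= (H s cs nNs) subr0.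
by rewrite ltxx.
Qed.

Lemma measurable_torus_cell : measurable (@torus_cell R m).
Proof.
have [mC _] := leb_cube (0 : 'rV[R]_m) (mulrn_wgt0 2 (pi_gt0 R) : 0 < pi *+ 2 :> R).
rewrite (_ : @torus_cell R m = [set y : 'rV[R]_m |
  forall j, (0 : 'rV[R]_m) ord0 j <= y ord0 j < (0 : 'rV[R]_m) ord0 j + pi *+ 2])//.
by apply/seteqP; split=> t /= H j; have := H j; rewrite mxE add0r.
Qed.

Lemma ae_integrable_section u :
  (leb R m \x leb R n)%E.-integrable (@torus_cell R m `*` setT) (EFin \o u) ->
  (leb R m).-negligible [set t | torus_cell t /\ ~ integrable_section u t].
Proof.
move=> iu; have mD : measurable (@torus_cell R m `*` [set: 'rV[R]_n]).
  by apply: measurableX => //; exact: measurable_torus_cell.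
have := (integrable_mkcond _ mD).1 iu => /ae_integrable1.
apply: negligibleS => t [ct nt] /= H; apply: nt.
apply: eq_integrable H => // y _ /=.
by rewrite patchE mem_set.
Qed.

Lemma torus_periodic_cosint th u : torus_periodic u -> torus_periodic (cosint th u).
Proof.
move=> pu i p; rewrite /cosint.
have E x : u ((p + (pi *+ 2) *: dir R (inl i)).1, x) = u (p.1, x).
  rewrite -(pu i (p.1, x)); congr u; congr pair.
  by rewrite /= scaler0 addr0.
have E2 : (p + (pi *+ 2) *: dir R (inl i)).2 = p.2 by rewrite /= scaler0 addr0.
by apply: eq_Rintegral => x _; rewrite E E2.
Qed.

(** Half a turn of the phase changes the sign of the cosine. *)
Lemma cosint_quarter (w : V -> R) :
  cosint (- (pi / 2)) (fun z => -1 * w z) = cosint (pi / 2) w /\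
  cosint (pi / 2) (fun z => -1 * w z) = cosint (- (pi / 2)) w.
Proof.
split; apply/funext => z; apply: eq_Rintegral => x _.
  by rewrite cosBpihalf cosDpihalf mulN1r mulrN mulNr.
by rewrite cosBpihalf cosDpihalf mulN1r mulrNN.
Qed.

Lemma cosintN (w : V -> R) th t xi : integrable_section w t ->
  cosint th (fun z => -1 * w z) (t, xi) = - cosint th w (t, xi).
Proof.
move=> iw; rewrite -[RHS]mulN1r /cosint -RintegralZl//.
  by apply: eq_Rintegral => x _; rewrite mulrA.
have := integrable_cos_section th 0 xi iw.
by under eq_fun do rewrite subr0.
Qed.

(** The inversion formula holds at almost every t of the cell, namely where
    the sections are integrable. Both sides are continuous and periodic in t,
    so it holds everywhere. *)
Lemma torus_inversion u v p q (N : set 'rV[R]_m) :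
  continuous u -> torus_periodic u -> torus_periodic p -> torus_periodic q ->
  schwartz p -> schwartz q ->
  schwartz (cosint 0 p) -> schwartz (cosint (pi / 2) q) ->
  (leb R m).-negligible N ->
  (forall t, torus_cell t -> ~ N t -> integrable_section u t /\ integrable_section v t) ->
  (forall t xi, integrable_section u t -> integrable_section v t ->
    p (t, xi) = cosint 0 u (t, xi) + cosint (- (pi / 2)) v (t, xi)) ->
  (forall t xi, integrable_section u t -> integrable_section v t ->
    q (t, xi) = cosint 0 v (t, xi) + cosint (pi / 2) u (t, xi)) ->
  forall z, cosint 0 p z + cosint (pi / 2) q z = (2 * pi) ^+ n * u z.
Proof.
move=> cu pu pp pq Sp Sq SP SQ N0 good hp hq.
have cp := smooth_real_cont Sp.1; have cq := smooth_real_cont Sq.1.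
have cP := smooth_real_cont SP.1; have cQ := smooth_real_cont SQ.1.
have [M1 H1] := schwartz_dominated Sp; have [M2 H2] := schwartz_dominated Sq.
have [M3 H3] := schwartz_dominated SP; have [M4 H4] := schwartz_dominated SQ.
pose M := Num.max (Num.max M1 M2) (Num.max M3 M4).
have up M' (w : V -> R) : dominated M' w -> M' <= M -> dominated M w.
  move=> h le z; apply: (le_trans (h z)); apply: ler_wpM2r => //.
  exact: ltW (decay_gt0 _).
have D1 : dominated M p by apply: (up M1) => //; rewrite /M !le_max lexx.
have D2 : dominated M q by apply: (up M2) => //; rewrite /M !le_max lexx ?orbT.
have D3 : dominated M (cosint 0 p) by apply: (up M3) => //; rewrite /M !le_max lexx ?orbT.
have D4 : dominated M (cosint (pi / 2) q).
  by apply: (up M4) => //; rewrite /M !le_max lexx ?orbT.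
pose D z := cosint 0 p z + cosint (pi / 2) q z - (2 * pi) ^+ n * u z.
suff D0 z : D z = 0 by move=> z; apply/eqP; rewrite -subr_eq0; exact/eqP/D0.
move: z; apply: (@torus_eq0 D N) => //.
- move=> z; apply: (@cvgB R R^o V (nbhs z)).
    by apply: (@cvgD R R^o V (nbhs z)); [exact: cP|exact: cQ].
  by apply: (@cvgM R V (nbhs z)); [exact: cvg_cst|exact: cu].
- by move=> i z; rewrite /D !torus_periodic_cosint// pu.
- move=> t ct nt x; have [iu iv] := good t ct nt.
  rewrite /D (@cosint_inversion _ _ _ u v p q t M)//.
  + by rewrite subrr.
  + by move=> xi; exact: hp.
  + by move=> xi; exact: hq.
Qed.

Lemma gs_cosint_sum (sigma mu : R) th th' u v : 0 <= sigma -> 2^-1 <= mu ->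
  smooth_real u -> smooth_real v -> gs_real sigma mu u -> gs_real sigma mu v ->
  smooth_real (fun p => cosint th u p + cosint th' v p) /\
  gs_real sigma mu (fun p => cosint th u p + cosint th' v p).
Proof.
move=> s0 hmu su sv gu gv.
have sU := smooth_real_cosint th (gs_schwartz su gu).
have sW := smooth_real_cosint th' (gs_schwartz sv gv).
have gU : gs_real sigma mu (cosint th u) by exact: gs_cosint.
have gW : gs_real sigma mu (cosint th' v) by exact: gs_cosint.
by split; [exact: smooth_realD|exact: gs_realD].
Qed.

Lemma schwartz_cosint (sigma mu : R) th u : 0 <= sigma -> 2^-1 <= mu ->
  smooth_real u -> gs_real sigma mu u -> schwartz (cosint th u).
Proof.
move=> s0 hmu su gu; apply: (@gs_schwartz _ _ _ sigma mu).
  exact: smooth_real_cosint (gs_schwartz su gu).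
exact: gs_cosint.
Qed.

Lemma gs_fourier (sigma mu : R) f : 0 <= sigma -> 2^-1 <= mu ->
  smooth_real (re f) -> smooth_real (im f) ->
  gs_real sigma mu (re f) -> gs_real sigma mu (im f) ->
  smooth (fourier_x f) /\
  gs_real sigma mu (re (fourier_x f)) /\ gs_real sigma mu (im (fourier_x f)).
Proof.
move=> s0 hmu su sv gu gv.
have [Mu uM] := schwartz_dominated (gs_schwartz su gu).
have [Mv vM] := schwartz_dominated (gs_schwartz sv gv).
have iu t := continuous_dominated_section t (smooth_real_cont su) uM.
have iv t := continuous_dominated_section t (smooth_real_cont sv) vM.
have rE : re (fourier_x f) =
    fun p => cosint 0 (re f) p + cosint (- (pi / 2)) (im f) p.
  by apply/funext => p; exact: re_fourier.
have iE : im (fourier_x f) =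
    fun p => cosint 0 (im f) p + cosint (pi / 2) (re f) p.
  by apply/funext => p; exact: im_fourier.
have [sr gr] := gs_cosint_sum 0 (- (pi / 2)) s0 hmu su sv gu gv.
have [si gi] := gs_cosint_sum 0 (pi / 2) s0 hmu sv su gv gu.
rewrite -rE in sr gr; rewrite -iE in si gi.
by split; [apply/smooth_parts|].
Qed.

(** The inversion formula writes f, up to a constant, with cosine transforms
    of the real and imaginary parts p, q of its Fourier transform, so the
    estimate for f is [gs_cosint] applied to p and q. For the imaginary part of
    f = u + i v, the formula is used for - i f = v - i u, whose transform is
    q - i p. *)
Lemma gs_of_fourier (sigma mu : R) f : 0 <= sigma -> 2^-1 <= mu ->
  Cinfty f -> L1 f -> Cinfty (fourier_x f) ->
  gs_real sigma mu (re (fourier_x f)) -> gs_real sigma mu (im (fourier_x f)) ->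
  gs_real sigma mu (re f) /\ gs_real sigma mu (im f).
Proof.
move=> s0 hmu [perf sf] [L1r L1i] [perg sg].
have [sp sq] := (smooth_parts _).1 sg; have [su sv] := (smooth_parts f).1 sf.
have hp t xi := @re_fourier _ _ _ f (t, xi).
have hq t xi := @im_fourier _ _ _ f (t, xi).
have pp : torus_periodic (re (fourier_x f)) by move=> i z; rewrite /re perg.
have pq : torus_periodic (im (fourier_x f)) by move=> i z; rewrite /im perg.
move: (re (fourier_x f)) (im (fourier_x f)) sp sq hp hq pp pq.
move=> p q sp sq hp hq pp pq gp gq {sg perg}.
have pu : torus_periodic (re f) by move=> i z; rewrite /re perf.
have pv : torus_periodic (im f) by move=> i z; rewrite /im perf.
have N0 := negligibleU (ae_integrable_section L1r) (ae_integrable_section L1i).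
set N := (_ `|` _) in N0.
have good t : torus_cell t -> ~ N t ->
    integrable_section (re f) t /\ integrable_section (im f) t.
  by move=> ct nt; split; apply: contrapT => h; apply: nt; [left|right].
move: (re f) (im f) su sv hp hq pu pv N N0 good => u v su sv hp hq pu pv N N0 good.
have Sp := gs_schwartz sp gp; have Sq := gs_schwartz sq gq.
(* Negatives are written as multiples by -1, the form of [smooth_realZ]. *)
pose np : V -> R := fun z => -1 * p z; pose nu : V -> R := fun z => -1 * u z.
have snp : smooth_real np by exact: smooth_realZ.
have gnp : gs_real sigma mu np by exact: gs_realZ.
have pnp : torus_periodic np by move=> i z; rewrite /np pp.
have inu t : integrable_section u t -> integrable_section nu t.
  move=> iu; have := integrableZl measurableT (-1) iu.
  by apply: eq_integrable => // x _ /=; rewrite EFinM.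
have inu' t : integrable_section nu t -> integrable_section u t.
  move=> iu; have := integrableZl measurableT (-1) iu.
  by apply: eq_integrable => // x _ /=; rewrite -EFinM /nu mulrA mulrNN mul1r mul1r.
have [Q1 _] := cosint_quarter u.
have EK := torus_inversion (smooth_real_cont su) pu pp pq Sp Sq
  (schwartz_cosint 0 s0 hmu sp gp) (schwartz_cosint (pi / 2) s0 hmu sq gq) N0 good hp hq.
have good' t : torus_cell t -> ~ N t -> integrable_section v t /\ integrable_section nu t.
  by move=> ct nt; have [i1 i2] := good t ct nt; split => //; exact: inu.
have hq' t xi : integrable_section v t -> integrable_section nu t ->
    q (t, xi) = cosint 0 v (t, xi) + cosint (- (pi / 2)) nu (t, xi).
  by move=> iv /inu' iu; rewrite Q1; exact: hq.
have hnp t xi : integrable_section v t -> integrable_section nu t ->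
    np (t, xi) = cosint 0 nu (t, xi) + cosint (pi / 2) v (t, xi).
  move=> iv /inu' iu; rewrite cosintN// /np hp// mulN1r opprD; congr (_ + _).
  by rewrite -(cosint_quarter v).2 cosintN// opprK.
have EL := torus_inversion (smooth_real_cont sv) pv pq pnp Sq (gs_schwartz snp gnp)
  (schwartz_cosint 0 s0 hmu sq gq) (schwartz_cosint (pi / 2) s0 hmu snp gnp)
  N0 good' hq' hnp.
have pos0 : (2 * pi) ^+ n != 0 :> R by rewrite expf_neq0// mulf_neq0// gt_eqF// pi_gt0.
have [sK gK] := gs_cosint_sum 0 (pi / 2) s0 hmu sp sq gp gq.
have [sL gL] := gs_cosint_sum 0 (pi / 2) s0 hmu sq snp gq gnp.
split.
  have := gs_realZ ((2 * pi) ^+ n)^-1 sK gK.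
  by congr gs_real; apply/funext => z; rewrite EK mulKf.
have := gs_realZ ((2 * pi) ^+ n)^-1 sL gL.
by congr gs_real; apply/funext => z; rewrite EL mulKf.
Qed.

End main.

Theorem proposition3p6 (R : realType) (m n : nat) (sigma mu : R)
  (hsigma : 1 <= sigma) (hmu : 2^-1 <= mu)
  (f : 'rV[R]_m * 'rV[R]_n -> Rcomplex R)
  (f_smooth : Cinfty f) (f_L1 : L1 f) :
  GS sigma mu f <->
  Cinfty (fourier_x f) /\
  exists C0 C1 : R, [/\ 0 < C0, 0 < C1 &
    forall (a b : {ffun 'I_n -> nat}) (c : {ffun 'I_m -> nat}),
      (sup_mon_partial a b c (fourier_x f) <=
       (C0 * C1 ^+ (mdeg (a + b) + mdeg c)
        * (mfact a * mfact b)%:R `^ mu * (mfact c)%:R `^ sigma)%:E)%E].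
Proof.
have sigma0 : 0 <= sigma by rewrite (le_trans _ hsigma).
have mu0 : 0 <= mu by rewrite (le_trans _ hmu)// invr_ge0.
have [per_f sf] := f_smooth; have [su sv] := (smooth_parts f).1 sf.
split=> [/GS_sup_bound[_ Ef]|[Cg Eg]].
  have [gu gv] := sup_bound_gs mu0 sf Ef.
  have [sg [gr gi]] := gs_fourier sigma0 hmu su sv gu gv.
  split; first by split => //; exact: periodic_fourier.
  exact: (gs_sup_bound mu0 sg gr gi).
have [gp gq] := sup_bound_gs mu0 Cg.2 Eg.
have [gu gv] := gs_of_fourier sigma0 hmu f_smooth f_L1 Cg gp gq.
apply/GS_sup_bound; split => //.
exact: (gs_sup_bound mu0 sf gu gv).
Qed.
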